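(* Let $k,b$ be positive integers such that either $k\ge 4$, or $k=3$ and $b\ge 2$. Let $H$ be a graph for which there exists $H'\subseteq H$ with $d_1(H')=m_1(H)$ and either $H'=K_k$ or $H'=C_k$. Then there exist constants $c,C>0$ such that for the $(1:b)$ Client-Waiter vertex $H$-game played on $G\sim G(n,p)$, $$\lim_{n\to\infty}\Pr[G\text{ is Client's win}]=\begin{cases}1 & p\ge Cn^{-1/m_1(H)},\\ 0& p\le cn^{-1/m_1(H)}.\end{cases}$$
   Context: For a graph $F$ with $v(F)\ge 2$, $d_1(F)=\frac{e(F)}{v(F)-1}$ and $m_1(F)=\max\{d_1(F'):F'\subseteq F,\ v(F')\ge 2\}$. $G(n,p)$ is the binomial random graph. The $(1:b)$ Client-Waiter vertex $H$-game on a graph $G$: in each round Waiter offers a set of $t$ previously unclaimed vertices with $1\le t\le b+1$; Client claims one of them and Waiter claims the rest; in the last round, Client claims one of the remaining vertices and Waiter the rest. Client wins if the subgraph of $G$ induced by his vertices contains a (not necessarily induced) copy of $H$; otherwise Waiter wins. ''Client's win'' means Client has a winning strategy. *)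

(* Defs.v *)
From Stdlib Require Import Reals.
From mathcomp Require Import all_boot.
Set Implicit Arguments. Unset Strict Implicit. Unset Printing Implicit Defensive.

Definition is_graph (n : nat) (E : {set {set 'I_n}}) : bool :=
  [forall e in E, #|e| == 2].

Definition all_edges (n : nat) : {set {set 'I_n}} :=
  [set e : {set 'I_n} | #|e| == 2].

Definition is_subgraph (h : nat) (EH : {set {set 'I_h}})
  (W : {set 'I_h}) (F : {set {set 'I_h}}) : bool :=
  (F \subset EH) && [forall e in F, e \subset W].

Definition d1_density (h : nat) (W : {set 'I_h}) (F : {set {set 'I_h}}) : R :=
  Rdiv (INR #|F|) (Rminus (INR #|W|) 1).

Definition m1_density (h : nat) (EH : {set {set 'I_h}}) : R :=
  \big[Rmax/R0]_(WF : {set 'I_h} * {set {set 'I_h}} |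
                   is_subgraph EH WF.1 WF.2 && (2 <= #|WF.1|)) d1_density WF.1 WF.2.

Definition is_clique (h k : nat) (W : {set 'I_h}) (F : {set {set 'I_h}}) : Prop :=
  #|W| = k /\ F = [set e : {set 'I_h} | (e \subset W) && (#|e| == 2)].

Definition is_cycle (h k : nat) (W : {set 'I_h}) (F : {set {set 'I_h}}) : Prop :=
  exists f : 'I_k -> 'I_h, injective f /\ W = f @: setT /\
    F = [set [set f i; f (ordS i)] | i : 'I_k].

Definition has_copy (h n : nat) (EH : {set {set 'I_h}}) (EG : {set {set 'I_n}})
  (C : {set 'I_n}) : bool :=
  [exists f : {ffun 'I_h -> 'I_n},
     [&& injectiveb f, [forall x, f x \in C] & [forall e in EH, f @: e \in EG]]].

(** Client-Waiter (1:b) vertex game. State: Client's vertices C, free vertices U.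
    While U is nonempty, Waiter offers S \subset U with 1 <= |S| <= b+1, Client
    picks v in S, Waiter gets S \ {v}. Client wins iff at the end G[C] contains H.
    [client_wins fuel ...] is true iff Client has a winning strategy (fuel >= |U|
    suffices since each round removes at least one free vertex). *)
Fixpoint client_wins (h n b : nat) (EH : {set {set 'I_h}}) (EG : {set {set 'I_n}})
  (fuel : nat) (C U : {set 'I_n}) : bool :=
  match fuel with
  | 0 => has_copy EH EG C
  | f.+1 =>
    if U == set0 then has_copy EH EG C
    else [forall S : {set 'I_n},
            ((S \subset U) && (0 < #|S| <= b.+1)) ==>
            [exists v in S, client_wins b EH EG f (v |: C) (U :\: S)]]
  end.

Definition is_client_win (h n b : nat) (EH : {set {set 'I_h}}) (EG : {set {set 'I_n}})
  : bool := client_wins b EH EG n set0 setT.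

Definition prob_client_win (h b : nat) (EH : {set {set 'I_h}}) (n : nat) (p : R) : R :=
  \big[Rplus/R0]_(EG in powerset (all_edges n) | is_client_win b EH EG)
     Rmult (pow p #|EG|) (pow (Rminus R1 p) (subn #|all_edges n| #|EG|)).

(* Main.v *)
(** 1-statement: whatever Waiter does, Client ends up with at least n/(b+1)
    vertices. By Janson's inequality a fixed set of that size contains no copy of H
    with probability at most exp(-2n), so by a union bound every such set contains a
    copy, and Client wins by playing arbitrarily.

    0-statement: Waiter prevents even the copies of H' = K_k or C_k. He can treat
    separately the connected components of the family of copies, and he can answer
    separately a copy two vertices of which lie in no other copy. The remaining
    families are explored copy by copy, along paths of copies sharing one vertex
    whenever possible. If V and F are the vertices and edges found so far, the excess
    (k-1)|F| - e(H')(|V|-1) never decreases, it increases when a new copy meets V in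
    two vertices or more, and a path has to be restarted only after such a step; so
    before the excess exceeds e(H') only boundedly many steps are not path steps.
    Path steps have arbitrarily small weight when c is small, hence
    the expected number of explorations with excess larger than e(H') is O(n^(-1/e(H'))).
    When the excess stays at most e(H'), every copy contains one of the sets of new
    vertices met along the exploration (slightly enlarged), possibly after one initial
    offer, and Hall's theorem provides disjoint pairs of vertices, one in each of these
    sets; Waiter offers these pairs. *)

(* The first moment method rules out only unions of copies with (k-1)|F| > e(H')|V|, so Waiter needs
   a strategy on every connected union below this density, however many copies it has. A direct
   count of connected unions of m copies fails: attaching a copy anywhere costs a factor polynomial
   in m at every step. A path step has only k^2 choices of contact, hence a factor k^2 * rho with
   rho = p * n^(1/m_1), and small c makes this at most 1/4. With boundedly many free steps the total
   is 4^-m times a fixed power of a polynomial in m, which is summable.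

   Paths rarely get stuck because of the reduction by private vertices: the last copy of a path has
   two new vertices, one of which lies in another copy, necessarily unexplored. If that copy does
   not continue the path, it has two old vertices and the excess grows.

   In the game the excess is a budget for the shortfall of the steps from k-1 new vertices. Hall's
   condition asks for two vertices per step, so for k >= 4 a full step leaves one to spare. For
   triangles nothing is spared; up to three critical vertices are offered at once, whence b >= 2. *)
Require Import Defs.
From Stdlib Require Import Reals.
From mathcomp Require Import all_boot all_order all_algebra.
From mathcomp Require Import zify ring lra reals Rstruct.

Set Implicit Arguments.
Unset Strict Implicit.
Unset Printing Implicit Defensive.

(** * Hall's theorem and the positions won by Waiter *)

(* Rado's argument: as long as some [D i] has two elements, one of them can be
   discarded, because otherwise the two violating index sets contradict the
   submodularity of [J |-> #|\bigcup_(i in J) D i|]. *)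
Lemma hall_marriage (I T : finType) (D : I -> {set T}) :
  (forall J : {set I}, #|J| <= #|\bigcup_(i in J) D i|) ->
  exists2 r : I -> T, injective r & forall i, r i \in D i.
Proof.
have [m] := ubnP (\sum_i #|D i|); elim: m D => // m IHm D lt_m hallD.
have D_gt0 i : 0 < #|D i|.
  by have := hallD [set i]; rewrite big_set1 cards1; apply.
case: (pickP [pred i | 1 < #|D i|]) => [i /= D2|D1]; last first.
  have [r Dr] : exists r : I -> T, forall i, D i = [set r i].
    apply: (@fin_all_exists _ _ (fun i x => D i = [set x])) => i; apply/cards1P.
    by rewrite eqn_leq D_gt0 andbT leqNgt; have /= := D1 i; case: ltnP.
  exists r => [i j rij|i]; last by rewrite Dr set11.
  apply/eqP/idPn => ij; have := hallD [set i; j].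
  by rewrite cards2 ij bigcup_setU !big_set1 !Dr rij setUid cards1.
have /card_gt1P[x [y [xD yD xy]]] := D2.
pose E z j := if j == i then D i :\ z else D j.
have sumE z : z \in D i -> \sum_j #|E z j| < m.
  move=> zD; rewrite -ltnS (leq_trans _ lt_m) // ltnS (bigD1 i) //= [ltnRHS](bigD1 i) //=.
  rewrite /E eqxx -addSn leq_add //; first by rewrite [X in _ < X](cardsD1 z) zD.
  by rewrite leq_sum // => j /negPf->.
have subE z r : injective r /\ (forall j, r j \in E z j) ->
    exists2 r : I -> T, injective r & forall i, r i \in D i.
  case=> ri rE; exists r => // j; have := rE j; rewrite /E.
  by case: eqP => // ->; rewrite inE => /andP[].
have hallE z : z \in D i -> (exists2 r : I -> T, injective r & forall i, r i \in D i) \/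
   exists2 J : {set I}, i \notin J &
     #|\bigcup_(j in J) D j :|: (D i :\ z)| <= #|J|.
  move=> zD; have [/forallP hE|] := boolP [forall J : {set I}, #|J| <= #|\bigcup_(j in J) E z j|].
    by left; have [r r1 r2] := IHm _ (sumE _ zD) hE; apply: (subE z r).
  rewrite negb_forall => /existsP[J]; rewrite -ltnNge => ltJ; right.
  have iJ : i \in J.
    apply: contraLR ltJ => iJ; rewrite -leqNgt (leq_trans (hallD J)) //.
    rewrite (@eq_bigr _ _ _ _ _ _ D (E z)) // => j jJ; rewrite /E.
    by case: eqP jJ iJ => // -> ->.
  exists (J :\ i); first by rewrite !inE eqxx.
  rewrite -ltnS (leq_trans _ (_ : #|J| <= _)) //; last by rewrite (cardsD1 i) iJ.
  rewrite (leq_ltn_trans _ ltJ) // subset_leq_card //.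
  rewrite subUset andbC (bigcup_max i) //=; last by rewrite /E eqxx.
  apply/bigcupsP => j; rewrite !inE => /andP[ji jJ].
  by rewrite (bigcup_max j) ?jJ // /E (negPf ji).
have [//|[J iJ leJ]] := hallE x xD.
have [//|[K iK leK]] := hallE y yD.
have hU := hallD (i |: (J :|: K)); have hI := hallD (J :&: K).
rewrite cardsU1 !inE negb_or iJ iK /= in hU.
set X := _ :|: _ in leJ; set Y := _ :|: _ in leK.
have leU : #|\bigcup_(j in i |: (J :|: K)) D j| <= #|X :|: Y|.
  apply: subset_leq_card; apply/bigcupsP => j; rewrite !inE => /predU1P[->|].
    apply/subsetP => z zD; rewrite !inE zD !andbT.
    by case: (eqVneq z x) => [->|_]; rewrite ?xy ?orbT.
  by case/orP => jJ; apply/subsetP => z zD; rewrite !inE; apply/orP; [left|right];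
     apply/orP; left; apply/bigcupP; exists j.
have leI : #|\bigcup_(j in J :&: K) D j| <= #|X :&: Y|.
  apply: subset_leq_card; apply/bigcupsP => j; rewrite inE => /andP[jJ jK].
  by apply/subsetP => z zD; rewrite !inE; apply/andP; split; apply/orP; left; apply/bigcupP; exists j.
by have := cardsUI X Y; have := cardsUI J K; lia.
Qed.

(** Hall's theorem for the index set [P] times [bool]: each set gets two representatives, which form
    its pair. *)
Lemma hall_pairs (T : finType) (P : {set {set T}}) :
  (forall Q : {set {set T}}, Q \subset P -> 2 * #|Q| <= #|cover Q|) ->
  exists r : {set T} -> {set T},
    (forall D, D \in P -> r D \subset D /\ #|r D| = 2) /\
    (forall D E, D \in P -> E \in P -> D != E -> [disjoint r D & r E]).
Proof.
move=> hallP; pose I := ({D : {set T} | D \in P} * bool)%type.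
have [J|r r_inj rD] := @hall_marriage I T (fun i => val i.1).
  pose Q := [set val i.1 | i in J].
  have sQ : Q \subset P by apply/subsetP => D /imsetP[i _ ->]; apply: valP.
  have leJ : #|J| <= 2 * #|Q|.
    have : J \subset [set i : I | val i.1 \in Q].
      by apply/subsetP => i iJ; rewrite inE; apply/imsetP; exists i.
    move/subset_leq_card/leq_trans; apply.
    have -> : [set i : I | val i.1 \in Q] = setX [set d : {D | D \in P} | val d \in Q] setT.
      by apply/setP => -[d c]; rewrite !inE andbT.
    rewrite cardsX cardsT card_bool mulnC leq_mul2l /=.
    rewrite -(card_imset _ (@val_inj _ _ {D | D \in P})) subset_leq_card //.
    by apply/subsetP => D /imsetP[d]; rewrite inE => dQ ->.
  rewrite (leq_trans leJ) // (leq_trans (hallP Q sQ)) // subset_leq_card //.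
  apply/bigcupsP => D /imsetP[i iJ ->]; exact: (bigcup_max i).
exists (fun D => if insub D is Some d then [set r (d, false); r (d, true)] else set0).
split=> [D DP|D E DP EP DE]; rewrite !insubT; first split.
- by rewrite subUset !sub1set; have := rD (Sub D DP, false); have := rD (Sub D DP, true) => /= -> ->.
- by rewrite cards2 (inj_eq r_inj) xpair_eqE eqxx.
have neq : (Sub D DP == Sub E EP :> {D : {set T} | D \in P}) = false.
  by rewrite -val_eqE /= (negPf DE).
rewrite disjoints_subset; apply/subsetP => z; rewrite !inE negb_or.
by case/orP => /eqP->; rewrite !(inj_eq r_inj) !xpair_eqE neq.
Qed.

Section WaiterWins.
Variables (T : finType) (b : nat).

(* Only the board [B] still available to Waiter and the set [W] of vertices he
   already owns matter: once [W] meets every set of [H], Waiter may play anyhow. *)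
Inductive waiter_wins (H : {set {set T}}) : {set T} -> {set T} -> Prop :=
| waiter_done (B W : {set T}) : (forall A, A \in H -> ~~ [disjoint A & W]) -> waiter_wins H B W
| waiter_offer (B W S : {set T}) : S \subset B -> 0 < #|S| <= b.+1 ->
    (forall v, v \in S -> waiter_wins H (B :\: S) (W :|: (S :\ v))) ->
    waiter_wins H B W.

Lemma waiter_wins_mono (H H' : {set {set T}}) (B B' W W' : {set T}) :
  waiter_wins H B W -> B \subset B' -> W \subset W' ->
  (forall A, A \in H' -> ~~ [disjoint A & W'] \/ A \in H) ->
  waiter_wins H' B' W'.
Proof.
move=> wH; elim: wH B' W' => {B W} [B W dn|B W S SB S01 _ IH] B' W' BB WW HH.
  apply: waiter_done => A /HH[//|/dn]; apply: contraNN => dA.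
  by rewrite disjoint_sym (disjointWl WW) // disjoint_sym.
apply: (@waiter_offer _ _ _ S) => // [|v vS]; first exact: subset_trans BB.
apply: (IH v) => //; rewrite ?setSD ?setSU // => A /HH[dA|]; last by right.
by left; apply: contraNN dA => dA; rewrite disjoint_sym (disjointWl _ (_ : [disjoint W' :|: (S :\ v) & A])) ?subsetUl // disjoint_sym.
Qed.

(** Waiter completes the first strategy and then starts the second, whose board is still untouched;
    the vertices he already owns can only help. *)
Lemma waiter_wins_cat (H1 H2 : {set {set T}}) (B1 B2 W : {set T}) :
  waiter_wins H1 B1 W -> waiter_wins H2 B2 set0 -> [disjoint B1 & B2] ->
  waiter_wins (H1 :|: H2) (B1 :|: B2) W.
Proof.
move=> w1 w2; elim: w1 => {B1 W} [B W dn|B W S SB S01 _ IH] dB.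
  apply: (waiter_wins_mono w2); rewrite ?sub0set ?subsetUr // => A.
  by rewrite inE => /orP[/dn|]; [left|right].
apply: (@waiter_offer _ _ _ S) => // [|v vS]; first by rewrite (subset_trans SB) ?subsetUl.
have dB' : [disjoint B :\: S & B2] by rewrite (disjointWl _ dB) ?subsetDl.
apply: (waiter_wins_mono (IH v vS dB')) => // [|A ?]; last by right.
rewrite setDUl setUS //; apply/subsetP => z zB; rewrite inE zB andbT.
by apply: contraTN zB => /(subsetP SB) /(disjointFr dB) ->.
Qed.

Lemma waiter_wins_pairs (H P : {set {set T}}) (B W : {set T}) :
  0 < b ->
  (forall D, D \in P -> D \subset B) ->
  (forall Q : {set {set T}}, Q \subset P -> 2 * #|Q| <= #|cover Q|) ->
  (forall A, A \in H -> ~~ [disjoint A & W] \/ exists2 D, D \in P & D \subset A) ->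
  waiter_wins H B W.
Proof.
move=> b0 PB /hall_pairs[r [rD dr]] HP.
have rH A : A \in H -> ~~ [disjoint A & W] \/ exists2 D, D \in P & r D \subset A.
  move=> /HP[|[D DP DA]]; [by left|right; exists D => //].
  by have [rDD _] := rD D DP; apply: subset_trans DA.
have rB D : D \in P -> r D \subset B.
  by move=> DP; have [rDD _] := rD D DP; rewrite (subset_trans rDD) ?PB.
have {}rD D : D \in P -> #|r D| = 2 by move=> /rD[].
move: {PB HP} rH rB rD dr.
have [m] := ubnP #|P|; elim: m P B W => // m IHm P B W leP rH rB rD dr.
have [P0|[D DP]] := set_0Vmem P.
  by apply: waiter_done => A /rH[//|[D]]; rewrite P0 inE.
apply: (@waiter_offer _ _ _ (r D)); rewrite ?rB ?rD // => v vD.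
have sP E : E \in P :\ D -> E \in P /\ [disjoint r E & r D].
  by rewrite !inE => /andP[ED EP]; rewrite EP dr.
apply: (IHm (P :\ D)).
- by move: leP; rewrite (cardsD1 D) DP; lia.
- move=> A /rH[dA|[E EP EA]].
    left; apply: contraNN dA => dA.
    by rewrite disjoint_sym (disjointWl _ (_ : [disjoint W :|: (r D :\ v) & A])) ?subsetUl // disjoint_sym.
  have [ED|ED] := eqVneq E D; last by right; exists E => //; rewrite !inE ED.
  left; subst E; have : 0 < #|r D :\ v| by have := rD D DP; rewrite (cardsD1 v) vD; lia.
  rewrite card_gt0 => /set0Pn[z zD]; apply/pred0Pn; exists z => /=.
  by rewrite inE zD orbT andbT (subsetP EA) //; move: zD; rewrite inE => /andP[].
- move=> E /sP[EP dE]; apply/subsetP => z zE; rewrite inE (subsetP (rB E EP)) // andbT.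
  by rewrite (disjointFr dE).
- by move=> E /sP[EP _]; apply: rD.
- by move=> E F /sP[EP _] /sP[FP _]; apply: dr.
Qed.

End WaiterWins.

(** Inductive positions forget the fuel, Client's vertices and everything outside [B]. The
    disjointness hypotheses keep Waiter's vertices out of Client's reach. *)
Lemma waiter_wins_client_loses (h n b fuel : nat) (EH : {set {set 'I_h}})
    (EG : {set {set 'I_n}}) (H : {set {set 'I_n}}) (B W C U : {set 'I_n}) :
  (forall C' : {set 'I_n}, has_copy EH EG C' -> exists2 A, A \in H & A \subset C') ->
  waiter_wins b H B W -> B \subset U -> [disjoint W & C :|: U] -> [disjoint C & U] -> #|U| <= fuel ->
  client_wins b EH EG fuel C U = false.
Proof.
move=> copyH wH; elim: wH fuel C U => {B W} [B W dn|B W S SB S01 _ IH] fuel C U BU.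
  have lost (C' : {set 'I_n}) : [disjoint W & C'] -> has_copy EH EG C' = false.
    move=> dW; case hc: (has_copy _ _ _) => //; have [A AH AC] := copyH _ hc; have /negP[] := dn A AH.
    by rewrite (disjointWl AC) // disjoint_sym.
  elim: fuel C U {BU} => [|fuel IHf] C U dW dC leU /=.
    by apply: lost; move: leU; rewrite leqn0 cards_eq0 => /eqP U0; rewrite -(setU0 C) -{1}U0.
  case: (set_0Vmem U) => [U0|[v vU]].
    by rewrite U0 eqxx lost //; move: dW; rewrite U0 setU0.
  have /negPf-> : U != set0 by apply/set0Pn; exists v.
  (* With nothing left to achieve, Waiter offers single vertices until the board is exhausted. *)
  apply/forallP => /(_ [set v]); rewrite sub1set vU cards1 /= => /existsP[w].
  rewrite inE => /andP[/eqP-> /=]; rewrite IHf //.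
    rewrite (disjointWr _ dW) // !subUset sub1set !inE vU orbT subsetUl /=.
    by rewrite (subset_trans (subsetDl _ _)) ?subsetUr.
    rewrite disjoints_subset; apply/subsetP => z; rewrite !inE negb_and => /predU1P[->|zC].
      by rewrite eqxx.
    by rewrite (disjointFr dC zC) orbT.
  by move: leU; rewrite (cardsD1 v U) vU; lia.
move=> dW dC; have S0 : S != set0 by rewrite -card_gt0; case/andP: S01.
have SU : S \subset U := subset_trans SB BU.
case: fuel => [|fuel] leU /=.
  by case/negP: S0; rewrite -subset0 (subset_trans SU) // subset0 -cards_eq0 -leqn0.
have /negPf-> : U != set0 by apply: contraNN S0 => /eqP U0; rewrite -subset0 -U0.
apply/forallP => /(_ S); rewrite SU S01 /= => /existsP[v /andP[vS]].
rewrite (IH v vS) //; first exact: setSD.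
  rewrite disjoints_subset; apply/subsetP => z; rewrite !inE !negb_or.
  have vU : v \in C :|: U by rewrite inE (subsetP SU) ?orbT.
  case/orP => [zW|/andP[zv zS]]; last first.
    rewrite zv zS andbT /=. by have := disjointFl dC (subsetP SU _ zS) => ->.
  have := disjointFr dW zW; rewrite inE => /norP[-> /negPf->]; rewrite andbF !andbT.
  by apply: contraTneq zW => ->; rewrite (disjointFl dW).
  rewrite disjoints_subset; apply/subsetP => z; rewrite !inE negb_and => /predU1P[->|zC].
    by rewrite vS.
  by rewrite (disjointFr dC zC) orbT.
by have := subset_leq_card SU; have := cardsID S U; rewrite (setIidPr SU); lia.
Qed.

(** * Pairing strategies *)

(* [lia] gets lost in contexts full of statements about sets. *)
Ltac card_lia :=
  repeat match goal with
  | H : is_true (leq _ _) |- _ => generalize H; clear H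
  | H : @eq nat _ _ |- _ => generalize H; clear H
  | H : _ \/ _ |- _ => generalize H; clear H
  end; clear;
  rewrite /reverse_coercion /=; intros;
  repeat match goal with
  | H : context [card ?A] |- _ => let c := fresh "c" in set (c := card A) in *; clearbody c
  | |- context [card ?A] => let c := fresh "c" in set (c := card A) in *; clearbody c
  end; lia.

Lemma bigcup_seqP (I : eqType) (T : finType) (r : seq I) (P : pred I) (F : I -> {set T}) x :
  reflect (exists2 i, (i \in r) && P i & x \in F i) (x \in \bigcup_(i <- r | P i) F i).
Proof.
elim: r => [|i r IH]; first by rewrite big_nil inE; constructor=> -[].
rewrite big_cons; case: ifP => Pi; rewrite ?inE; last first.
  apply: (iffP IH) => -[j /andP[jr Pj] xj]; exists j; rewrite ?inE ?jr ?orbT //.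
  by move: jr; rewrite inE => /predU1P[ji|->//]; rewrite ji Pi in Pj.
apply: (iffP orP) => [[xi|/IH[j /andP[jr Pj] xj]]|[j /andP[]]].
- by exists i; rewrite ?inE ?eqxx.
- by exists j; rewrite ?inE ?jr ?orbT.
rewrite inE => /predU1P[->|jr] Pj xj; [by left|by right; apply/IH; exists j; rewrite ?jr].
Qed.

Section Demands.
Variable T : finType.
Implicit Types (V N D : {set T}) (L : seq ({set T} * {set T})).

(* A pair [(N, D)] records a step of an exploration: [N] is the set of vertices
   discovered at that step and [D], which contains [N], is a set of discovered
   vertices in which Waiter wants to own a private pair. *)
Fixpoint demands V L : Prop :=
  if L is (N, D) :: L' then
    exists V', [/\ demands V' L', V' \subset V, [disjoint N & V'], N \subset D & D \subset V]
  else True.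

Lemma demands_mono V V' L : V \subset V' -> demands V L -> demands V' L.
Proof.
case: L => // -[N D] L VV /= [V0 [dL V0V dN ND DV]].
by exists V0; split=> //; [exact: subset_trans VV|exact: subset_trans VV].
Qed.

Lemma demands_filter V L (P : pred ({set T} * {set T})) :
  demands V L -> demands V (filter P L).
Proof.
elim: L V => // -[N D] L IH V /= [V' [dL VV dN ND DV]].
by case: ifP => _ /=; [exists V'; split=> //; apply: IH|apply: demands_mono VV _; apply: IH].
Qed.

Lemma demands_sub V L d : demands V L -> d \in L -> d.1 \subset d.2 /\ d.2 \subset V.
Proof.
elim: L V => // -[N D] L IH V /= [V' [dL VV dN ND DV]].
rewrite inE => /predU1P[->//|/(IH _ dL)[? dV']]; split=> //.
exact: subset_trans VV.
Qed.

Lemma demands_cover_sub V L : demands V L -> \bigcup_(d <- L) d.2 \subset V.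
Proof.
move=> dL; apply/subsetP => z; rewrite bigcup_seq => /bigcupP[d dinL zd].
by have [_ /subsetP->] := demands_sub dL dinL.
Qed.

(** The sets [N] are disjoint from everything discovered earlier, so their sizes add up. The
    earliest step, last in the list, can moreover contribute its whole [D]. *)
Lemma demands_card V d L : demands V (d :: L) ->
  \sum_(e <- d :: L) #|e.1| + (#|(last d L).2| - #|(last d L).1|) <=
    #|\bigcup_(e <- d :: L) e.2|.
Proof.
elim: L d V => [|d' L IH] [N D] V.
  rewrite !big_seq1 /= => -[V' [_ _ _ ND _]].
  by rewrite subnKC // subset_leq_card.
move=> [V' [dL VV dN ND DV]]; rewrite big_cons -addnA.
have -> : \bigcup_(e <- [:: (N, D), d' & L]) e.2 = D :|: \bigcup_(e <- d' :: L) e.2.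
  by rewrite big_cons.
have := IH d' V' dL; set A := \bigcup_(e <- _) _ => leA.
have dA : [disjoint N & A] by apply: disjointWr dN; apply: (@demands_cover_sub V' (d' :: L)).
rewrite (leq_trans (leq_add (leqnn _) leA)) //.
rewrite -cardsUI (disjoint_setI0 dA) cards0 addn0 /= subset_leq_card //.
by rewrite setSU.
Qed.
End Demands.

(** Allows Hall's condition to be checked by counting steps; repeated sets only strengthen the
    hypothesis. *)
Lemma hall_seq (A T : finType) (L : seq A) (g : A -> {set T}) :
  (forall P : pred A, 2 * count P L <= #|\bigcup_(a <- L | P a) g a|) ->
  forall Q : {set {set T}}, Q \subset [set g a | a in L] -> 2 * #|Q| <= #|cover Q|.
Proof.
move=> hL Q QL; pose P := [pred a | g a \in Q].
apply: leq_trans (leq_trans (hL P) _).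
  rewrite leq_mul2l /= -size_filter -(size_map g).
  rewrite (leq_trans _ (card_size _)) // subset_leq_card //.
  apply/subsetP => D DQ; have /imsetP[a aL Da] := subsetP QL D DQ.
  by apply/mapP; exists a; rewrite // mem_filter aL /= andbT -Da.
apply: subset_leq_card; rewrite -big_filter bigcup_seq.
apply/bigcupsP => a; rewrite mem_filter /= => /andP[aQ _].
by rewrite /cover (bigcup_max (g a)).
Qed.

Section PairingStrategy.
Variables (T : finType) (b k : nat).
Implicit Types (V O A : {set T}) (L : seq ({set T} * {set T})) (H : {set {set T}}).
Hypotheses (k4 : 4 <= k) (b0 : 0 < b).

(** A step that discovers fewer than [k.-1] vertices must offer two vertices beyond [N] instead of
    one. This is just what saves Hall's condition for two steps when [k = 4]. *)
Definition admissible (d : {set T} * {set T}) : bool :=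
  (#|d.1| <= k.-1) && (#|d.1| + 1 + (#|d.1| < k.-1) <= #|d.2|).

(** The sum is the total shortfall from [k.-1] new vertices per step. As [k.-1 >= 3], three or more
    steps absorb a shortfall of [k]; one or two steps need the surplus of the earliest [D]. The
    strict version leaves room for the loss of one vertex to Client. *)
Lemma admissible_card V L : demands V L -> all admissible L -> L != [::] ->
  (\sum_(d <- L) (k.-1 - #|d.1|) <= k -> 2 * size L <= #|\bigcup_(d <- L) d.2|) /\
  (\sum_(d <- L) (k.-1 - #|d.1|) <= k - 2 -> 2 * size L < #|\bigcup_(d <- L) d.2|).
Proof.
case: L => // d L dL adm _; have leC := demands_card dL.
set C := #|\bigcup_(_ <- _) _| in leC *.
have sz : k.-1 * size (d :: L) = \sum_(e <- d :: L) #|e.1| + \sum_(e <- d :: L) (k.-1 - #|e.1|).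
  rewrite mulnC -sum1_size big_distrl -big_split big_seq [RHS]big_seq.
  apply: eq_bigr => e eL; rewrite /= mul1n subnKC //.
  by have /andP[] := allP adm e eL.
have : admissible (last d L) by apply: (allP adm); rewrite mem_last.
have : admissible d by apply: (allP adm); rewrite mem_head.
clearbody C; move: leC sz; case: L {dL adm} => [|e L].
  by rewrite !big_seq1 /admissible /= => leC sz /andP[d1 d2] _; split; lia.
case: L => [|e' L].
  rewrite !big_cons !big_nil /admissible /= => leC sz /andP[d1 d2] /andP[e1 e2].
  by split; lia.
set S := \sum_(_ <- _) _; set S' := \sum_(_ <- _) _; rewrite /admissible /= => leC sz _ /andP[_ l].
set m := size L in sz *.
have : k.-1 * m.+3 = 3 * k.-1 + k.-1 * m by lia.
have : 3 * m <= k.-1 * m by rewrite leq_mul2r; lia.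
by split; lia.
Qed.

Lemma admissible_hall V L (P : pred ({set T} * {set T})) : demands V L -> all admissible L ->
  (\sum_(d <- L) (k.-1 - #|d.1|) <= k ->
     2 * count P L <= #|\bigcup_(d <- L | P d) d.2|) /\
  (\sum_(d <- L) (k.-1 - #|d.1|) <= k - 2 -> has P L ->
     2 * count P L < #|\bigcup_(d <- L | P d) d.2|).
Proof.
move=> dL adm; have := @admissible_card V (filter P L) (demands_filter _ dL).
rewrite !big_filter size_filter -has_filter.
have leS : \sum_(e <- L | P e) (k.-1 - #|e.1|) <= \sum_(e <- L) (k.-1 - #|e.1|).
  by rewrite big_mkcond leq_sum // => e _; case: ifP.
have adm' : all admissible (filter P L).
  by apply/allP => e; rewrite mem_filter => /andP[_ /(allP adm)].
move=> /(_ adm'); have [_ /(_ isT)[h1 h2]|noP _] := boolP (has P L); last first.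
  by split=> // _; move: noP; rewrite has_count -leqNgt leqn0 => /eqP->.
by split=> [|leS2 _]; [move=> leS1; apply: h1|apply: h2]; lia.
Qed.

Lemma waiter_wins_offer_pairs H V O : 0 < #|O| <= b.+1 -> O \subset V ->
  (forall x, x \in O -> exists P : {set {set T}},
     [/\ forall D, D \in P -> D \subset V :\: O,
         forall Q : {set {set T}}, Q \subset P -> 2 * #|Q| <= #|cover Q| &
         forall A, A \in H -> [disjoint A & O :\ x] -> exists2 D, D \in P & D \subset A]) ->
  waiter_wins b H V set0.
Proof.
move=> O01 OV hO; apply: (@waiter_offer _ _ _ _ _ O) => // x xO; rewrite set0U.
have [P [PV hallP HP]] := hO x xO; apply: (waiter_wins_pairs b0 PV hallP) => A AH.
by have [/(HP A AH)|] := boolP [disjoint A & O :\ x]; [right|left].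
Qed.

Lemma waiter_wins_demands H V L O :
  demands V L -> all admissible L -> O \subset V ->
  (O == set0) && (\sum_(d <- L) (k.-1 - #|d.1|) <= k) ||
    (#|O| == 2) && (\sum_(d <- L) (k.-1 - #|d.1|) <= k - 2) ->
  (forall A, A \in H -> (O != set0) && (O \subset A) \/ exists2 d, d \in L & d.2 \subset A) ->
  waiter_wins b H V set0.
Proof.
move=> dL adm OV /orP[/andP[/eqP-> leS] hA|/andP[/eqP O2 leS] hA].
  apply: (@waiter_wins_pairs _ _ _ [set d.2 | d in L]) => //.
  - by move=> D /imsetP[d dinL ->]; have [] := demands_sub dL dinL.
  - by apply: hall_seq => P; have [h _] := admissible_hall P dL adm; apply: h.
  - move=> A /hA[|[d dinL dA]]; first by rewrite eqxx.
    by right; exists d.2 => //; apply: imset_f.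
have O0 : O != set0 by rewrite -card_gt0 O2.
rewrite O0 /= in hA; apply: (@waiter_wins_offer_pairs _ _ O); rewrite ?O2 // => x xO.
(* Demands meeting [O :\ x] are already satisfied by Waiter's share of the offer. The others lose at
   most the vertex [x], which the strict form of Hall's condition allows. *)
pose L' := [seq d : {set T} * {set T} <- L | [disjoint d.2 & O :\ x]].
exists [set d.2 :\ x | d in L']; split.
- move=> D /imsetP[d]; rewrite mem_filter => /andP[dO dinL] ->.
  have [_ dV] := demands_sub dL dinL.
  apply/subsetP => z; rewrite !inE => /andP[zx zd]; rewrite (subsetP dV) // andbT.
  by have := disjointFr dO zd; rewrite !inE zx /= => ->.
- apply: hall_seq => P; pose P' := [pred d : {set T} * {set T} | P d && [disjoint d.2 & O :\ x]].
  rewrite count_filter (@eq_count _ _ P') // big_filter_cond (eq_bigl P') => [|d]; last by rewrite andbC.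
  have [_ /(_ leS) h] := admissible_hall P' dL adm.
  case: (boolP (has P' L)) => [/h|noP]; last first.
    by move: noP; rewrite has_count -leqNgt leqn0 => /eqP eq0; rewrite eq0.
  set C := \bigcup_(_ <- _ | _) _; set D := \bigcup_(_ <- _ | _) _ => ltC.
  have /subset_leq_card : C :\ x \subset D.
    apply/subsetP => z; rewrite in_setD1 => /andP[zx /bigcup_seqP[d dinL zd]].
    by apply/bigcup_seqP; exists d; rewrite // in_setD1 zx.
  by have := cardsD1 x C; case: (x \in C) => /=; lia.
- move=> A /hA[OA|[d dinL dA] dO].
    have : 0 < #|O :\ x| by have := cardsD1 x O; rewrite O2 xO; lia.
    case/card_gt0P => z zO /disjointFl/(_ zO); rewrite (subsetP OA) //.
    by move: zO; rewrite inE => /andP[].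
  exists (d.2 :\ x); last by rewrite (subset_trans _ dA) ?subsetDl.
  by apply/imset_f; rewrite mem_filter dinL (disjointWl dA).
Qed.
End PairingStrategy.

(** * Unions of copies *)

Section Copies.
Variables (k : nat) (T : finType) (EK : {set {set 'I_k}}).
Implicit Types (f g : {ffun 'I_k -> T}) (V : {set T}) (F : {set {set T}}) (A M : {set 'I_k}).

Definition touch A : {set {set 'I_k}} := [set e in EK | ~~ [disjoint e & A]].
Definition vset f : {set T} := f @: setT.
Definition eset f : {set {set T}} := [set f @: (e : {set 'I_k}) | e in EK].

Hypothesis EK2 : forall e, e \in EK -> #|e| = 2.

Lemma touch_sub A : touch A \subset EK.
Proof. by apply/subsetP => e; rewrite inE => /andP[]. Qed.

Lemma touchS A M : A \subset M -> touch A \subset touch M.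
Proof.
move=> AM; apply/subsetP => e; rewrite !inE => /andP[-> /=].
by apply: contraNN => dM; apply: disjointWr dM.
Qed.

Lemma touchP e A : reflect (e \in EK /\ exists2 i, i \in e & i \in A) (e \in touch A).
Proof.
rewrite inE; apply: (iffP andP) => -[eE].
  by case/pred0Pn => i /= /andP[ie iA]; split=> //; exists i.
by case=> i ie iA; split=> //; apply/pred0Pn; exists i; rewrite /= ie.
Qed.

Lemma card_vset f : injective f -> #|vset f| = k.
Proof. by move=> fi; rewrite card_imset // cardsT card_ord. Qed.

Lemma card_eset f : injective f -> #|eset f| = #|EK|.
Proof. by move=> fi; rewrite card_imset //; apply: imset_inj. Qed.

Lemma eset_sub f e : e \in eset f -> e \subset vset f.
Proof. by case/imsetP => d _ ->; apply: imsetS; apply: subsetT. Qed.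

Lemma eset_card2 f e : injective f -> e \in eset f -> #|e| = 2.
Proof. by move=> fi /imsetP[d dE ->]; rewrite card_imset ?EK2. Qed.

(** Starting from a single vertex makes the first copy an ordinary step, with [k.-1] new
    vertices. *)
Inductive built : {set T} -> {set {set T}} -> Prop :=
| built_root r : built [set r] set0
| built_step V F f : built V F -> injective f -> ~~ [disjoint vset f & V] ->
    ~~ (eset f \subset F) -> built (V :|: vset f) (F :|: eset f).

Lemma built_edge V F e : built V F -> e \in F -> e \subset V /\ #|e| = 2.
Proof.
move=> bVF; elim: bVF e => {V F} [r e|V F f _ IH fi _ _ e]; first by rewrite inE.
rewrite inE => /orP[/IH[eV e2]|ef]; split=> //; rewrite ?(eset_card2 fi) //.
  by rewrite (subset_trans eV) ?subsetUl.
by rewrite (subset_trans (eset_sub ef)) ?subsetUr.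
Qed.

Lemma built_step_card V F f : built V F ->
  #|V :|: vset f| = #|V| + #|vset f :\: V| /\ #|F :|: eset f| = #|F| + #|eset f :\: F|.
Proof.
have cardU (S : finType) (X Y : {set S}) : #|X :|: Y| = #|X| + #|Y :\: X|.
  by have := cardsUI X Y; have := cardsID X Y; rewrite setIC; lia.
by rewrite !cardU.
Qed.

Section Step.
Variables (V : {set T}) (F : {set {set T}}) (f : {ffun 'I_k -> T}).
Hypotheses (FV : forall e, e \in F -> e \subset V) (fi : injective f).

Definition fresh : {set 'I_k} := [set i | f i \notin V].

Lemma freshE : vset f :\: V = f @: fresh.
Proof.
apply/setP => z; apply/setDP/imsetP => [[/imsetP[i _ ->] fV]|[i]].
  by exists i => //; rewrite inE.
by rewrite inE => fV ->; rewrite imset_f ?inE.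
Qed.

Lemma card_fresh : #|vset f :\: V| = #|fresh|.
Proof. by rewrite freshE card_imset. Qed.

Lemma card_old : #|vset f :&: V| + #|fresh| = k.
Proof. by rewrite -card_fresh cardsID card_vset. Qed.

Lemma touch_fresh_new : [set f @: (e : {set 'I_k}) | e in touch fresh] \subset eset f :\: F.
Proof.
apply/subsetP => z /imsetP[e /touchP[eE [i ie]]]; rewrite inE => fV ->.
rewrite inE [f @: e \in eset f]imset_f // andbT.
by apply: contraNN fV => /FV/subsetP->; rewrite ?imset_f.
Qed.

Lemma leq_touch_fresh : #|touch fresh| <= #|eset f :\: F|.
Proof.
have /subset_leq_card := touch_fresh_new.
by rewrite card_imset //; apply: imset_inj.
Qed.

Lemma fresh_proper : ~~ [disjoint vset f & V] -> #|fresh| < k.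
Proof. by rewrite -setI_eq0 -card_gt0 => ?; have := card_old; lia. Qed.

(* In a regular pattern, a freshly discovered vertex has no room for edges other
   than those of [f], so every copy through it uses all of them. *)
Lemma fresh_star g d i : 0 < d -> (forall j, #|touch [set j]| = d) ->
  injective g -> eset g \subset F :|: eset f -> i \in fresh -> f i \in vset g ->
  forall e, e \in EK -> i \in e -> f @: e \in eset g.
Proof.
move=> d0 reg gi gF; rewrite inE => fV /imsetP[a _ fia] e eE ie.
pose Sf := [set f @: (e : {set 'I_k}) | e in touch [set i]].
pose Sg := [set g @: (e : {set 'I_k}) | e in touch [set a]].
have sub : Sg \subset Sf.
  apply/subsetP => z /imsetP[c /touchP[cE [j jc]]]; rewrite inE => /eqP ja ->; subst j.
  have gac : f i \in g @: c by rewrite fia imset_f.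
  have := subsetP gF (g @: c); rewrite imset_f // inE => /(_ isT)/orP[/FV/subsetP/(_ _ gac)|].
    by rewrite (negPf fV).
  case/imsetP => c' c'E cc'; rewrite cc'; apply: imset_f; apply/touchP; split=> //.
  by exists i; rewrite ?inE // -(mem_imset c' i fi) -cc'.
have eqS : Sg = Sf.
  have [ffi ggi] := (imset_inj fi, imset_inj gi).
  by apply/eqP; rewrite eqEcard sub /= (card_imset _ ffi) (card_imset _ ggi) !reg.
have : f @: e \in Sf by apply: imset_f; apply/touchP; split=> //; exists i; rewrite ?inE.
rewrite -eqS => /imsetP[c /touchP[cE _] ->]; exact: imset_f.
Qed.

End Step.

Lemma edge_in_star g v d : 0 < d -> (forall j, #|touch [set j]| = d) ->
  v \in vset g -> exists2 e, e \in eset g & v \in e.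
Proof.
move=> d0 reg /imsetP[a _ ->]; have : 0 < #|touch [set a]| by rewrite reg.
case/card_gt0P => e /touchP[eE [j je]]; rewrite inE => /eqP ja; subst j.
by exists (g @: e); rewrite imset_f.
Qed.

End Copies.

(** * Cycles *)

Definition cycle_edges k : {set {set 'I_k}} := [set [set i; ordS i] | i : 'I_k].

Section CyclePattern.
Variable k : nat.
Hypothesis k3 : 3 <= k.
Notation edge := (fun i : 'I_k => [set i; ordS i]).

Lemma ordS_neq (i : 'I_k) : ordS i != i.
Proof.
apply/eqP => /(congr1 val) /=; have ik := ltn_ord i.
case: (ltnP i.+1 k) => ik'; first by rewrite modn_small //; lia.
have -> : i.+1 = k by lia.
by rewrite modnn; lia.
Qed.

Lemma ordSS_neq (i : 'I_k) : ordS (ordS i) != i.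
Proof.
apply/eqP => /(congr1 val) /=; have ik := ltn_ord i; rewrite -addn1 modnDml addn1.
case: (ltnP i.+2 k) => ik'; first by rewrite modn_small //; lia.
have -> : i.+2 = (i.+2 - k) + k by lia.
by rewrite modnDr modn_small; lia.
Qed.

Lemma cycle_edge_inj : injective edge.
Proof.
move=> i j eij; have : i \in edge j by rewrite -eij !inE eqxx.
rewrite !inE => /orP[/eqP//|/eqP ij].
have : ordS i \in edge j by rewrite -eij !inE eqxx orbT.
by rewrite ij !inE (negPf (ordSS_neq j)) (negPf (ordS_neq (ordS j))).
Qed.

Lemma cycle_edges2 e : e \in cycle_edges k -> #|e| = 2.
Proof. by case/imsetP => i _ ->; rewrite cards2 eq_sym ordS_neq. Qed.

Lemma card_cycle_edges : #|cycle_edges k| = k.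
Proof. by rewrite card_imset ?card_ord //; apply: cycle_edge_inj. Qed.

Lemma cycle_touch1 (i : 'I_k) : #|touch (cycle_edges k) [set i]| = 2.
Proof.
have -> : touch (cycle_edges k) [set i] = [set edge i; edge (ord_pred i)].
  apply/setP => e; rewrite in_set2; apply/touchP/orP.
    case=> /imsetP[j _ ->] [l]; rewrite !inE => /orP[]/eqP-> /eqP <-; first by left.
    by rewrite ordSK; right.
  case=> /eqP->; split; try by apply: imset_f.
    by exists i; rewrite !inE eqxx.
  by exists i; rewrite !inE ?ord_predK eqxx ?orbT.
rewrite cards2 (inj_eq cycle_edge_inj).
suff -> : i != ord_pred i by [].
by rewrite -{1}[i]ord_predK ordS_neq.
Qed.

Lemma iter_ordS (i : 'I_k) m : (iter m (@ordS k) i : nat) = (i + m) %% k.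
Proof.
elim: m => [|m IH]; first by rewrite addn0 modn_small.
by rewrite iterS /= IH -[in LHS]addn1 modnDml addn1 addnS.
Qed.

(** Besides the edges leaving each vertex of [A] in the direction of [ordS], some edge enters [A]
    from outside. *)
Lemma cycle_expand (A : {set 'I_k}) : A != set0 -> A != setT -> #|A| < #|touch (cycle_edges k) A|.
Proof.
move=> /set0Pn[j jA] AT; have [i0 i0A] : exists i, i \notin A.
  by apply/existsP; rewrite -negb_forall; apply: contraNN AT => /forallP h; apply/eqP/setP => z; rewrite h inE.
have [i iA iSA] : exists2 i : 'I_k, i \notin A & ordS i \in A.
  have : iter (j + k - i0) (@ordS k) i0 \in A.
    suff -> : iter (j + k - i0) (@ordS k) i0 = j by [].
    apply: val_inj; rewrite /= iter_ordS; have i0k := ltn_ord i0.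
    by rewrite subnKC ?modnDr ?modn_small //; lia.
  elim: (j + k - i0) => [|m IH] /=; first by rewrite (negPf i0A).
  by case: (boolP (iter m (@ordS k) i0 \in A)) => [/IH|mA mSA]; last exists (iter m (@ordS k) i0).
have <- : #|[set edge l | l in i |: A]| = #|A|.+1.
  by rewrite card_imset ?cardsU1 ?iA //; apply: cycle_edge_inj.
apply: subset_leq_card; apply/subsetP => e /imsetP[l]; rewrite in_setU1 => li ->.
apply/touchP; split; first exact: imset_f.
by case/predU1P: li => [->|lA]; [exists (ordS i)|exists l]; rewrite ?inE ?eqxx ?orbT.
Qed.

(** If no edge touched both sets, [cycle_expand] would give at least |A| + 1 + |M| + 1 > k edges. *)
Lemma cycle_link (A M : {set 'I_k}) : A != set0 -> M != set0 -> [disjoint A & M] ->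
  k <= #|A| + #|M| + 1 -> exists2 e, e \in touch (cycle_edges k) A & e \in touch (cycle_edges k) M.
Proof.
move=> A0 M0 dAM leK.
have [d|] := boolP [disjoint touch (cycle_edges k) A & touch (cycle_edges k) M]; last first.
  by case/pred0Pn => e /= /andP[eA eM]; exists e.
have neqT (X Y : {set 'I_k}) : Y != set0 -> [disjoint X & Y] -> X != setT.
  by case/set0Pn => y yY dXY; apply/eqP => XT; have := disjointFl dXY yY; rewrite XT inE.
have /eqP MT : M != setT by apply: (neqT M A) => //; rewrite disjoint_sym.
have /eqP AT := neqT _ _ M0 dAM.
have hA := cycle_expand A0 (introN eqP AT); have hM := cycle_expand M0 (introN eqP MT).
have : #|touch (cycle_edges k) A :|: touch (cycle_edges k) M| <= k.
  by rewrite -[leqRHS]card_cycle_edges subset_leq_card // subUset !touch_sub.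
by rewrite cardsU disjoint_setI0 // cards0; lia.
Qed.

End CyclePattern.

Section CycleStep.
Variables (k : nat) (T : finType).
Hypothesis k4 : 4 <= k.
Let k3 : 3 <= k. Proof. exact: ltnW. Qed.
Notation EK := (cycle_edges k).
Notation eset := (eset (cycle_edges k)).
Variables (V : {set T}) (F : {set {set T}}) (f : {ffun 'I_k -> T}).
Hypotheses (FV : forall e, e \in F -> e \subset V) (fi : injective f).
Hypotheses (fV : ~~ [disjoint vset f & V]) (fF : ~~ (eset f \subset F)).
Notation N := (vset f :\: V).
Notation X := (eset f :\: F).
Notation new := (fun g : {ffun 'I_k -> T} =>
  [/\ injective g, eset g \subset F :|: eset f & ~~ (eset g \subset F)]).

Lemma cycle_step_card : #|N| < k /\ #|N| < #|X| <= k.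
Proof.
have ltN := fresh_proper fi fV; rewrite card_fresh //.
split=> //; apply/andP; split; last first.
  by rewrite -[leqRHS](card_cycle_edges k3) -(card_eset _ fi) subset_leq_card ?subsetDl.
have [f0|f0] := eqVneq (fresh V f) set0.
  rewrite f0 cards0 card_gt0; apply: contraNN fF; rewrite setD_eq0.
  by [].
apply: leq_trans (leq_touch_fresh EK FV fi); apply: cycle_expand => //.
by apply: contraTneq ltN => ->; rewrite cardsT card_ord ltnn.
Qed.

Lemma new_edge (g : {ffun 'I_k -> T}) : new g -> exists2 e, e \in X & e \subset vset g.
Proof.
case=> gi gF /subsetPn[e eg eF]; exists e; last exact: eset_sub eg.
by rewrite inE eF; have := subsetP gF e eg; rewrite inE (negPf eF).
Qed.

Lemma new_edge_fresh e (g : {ffun 'I_k -> T}) : e \in X -> e \subset vset g -> ~~ (e \subset V) ->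
  exists2 i, i \in fresh V f & f i \in vset g.
Proof.
rewrite inE => /andP[_ ef] eg /subsetPn[z ze zV].
have /imsetP[i _ zi] := subsetP (eset_sub ef) z ze.
by exists i; rewrite ?inE -?zi // (subsetP eg).
Qed.

Lemma cycle_star (g : {ffun 'I_k -> T}) i e : new g -> i \in fresh V f -> f i \in vset g -> e \in EK -> i \in e ->
  f @: e \subset vset g.
Proof.
case=> gi gF _ iN ig eE ie.
by apply: eset_sub (fresh_star FV fi _ (@cycle_touch1 k k3) gi gF iN ig eE ie).
Qed.

(** The bound makes [cycle_expand] tight, so the only new edges are those touching the fresh
    vertices, and a new copy must use all of them. [D] consists of their ends. Without fresh
    vertices, [D] is the single new edge. *)
Lemma cycle_step_demand : #|X| <= #|N|.+1 ->
  exists D : {set T}, [/\ N \subset D, D \subset vset f, #|N| + 1 + (#|N| < k.-1) <= #|D| &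
                forall g, new g -> D \subset vset g].
Proof.
move=> leX; have [ltN /andP[ltX _]] := cycle_step_card.
have cN : #|N| = #|fresh V f| by rewrite card_fresh.
have [N0|N0] := eqVneq (fresh V f) set0.
  have /eqP/cards1P[e Xe] : #|X| = 1 by rewrite cN N0 cards0 in leX ltX; lia.
  have eX : e \in X by rewrite Xe set11.
  have ef : e \in eset f by move: eX; rewrite inE => /andP[].
  exists e; split; first by rewrite freshE N0 imset0 sub0set.
  - exact: eset_sub ef.
  - by rewrite cN N0 cards0 (eset_card2 (@cycle_edges2 k k3) fi ef); case: (0 < _).
  - by move=> g /new_edge[e']; rewrite Xe inE => /eqP->.
have NT : fresh V f != setT.
  by apply: contraTneq ltN; rewrite cN => ->; rewrite cardsT card_ord ltnn.
have exN := cycle_expand k3 N0 NT.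
have leT := leq_touch_fresh EK FV fi.
have ctN : #|touch EK (fresh V f)| = #|fresh V f|.+1 by lia.
have eqX : X = [set f @: (e : {set 'I_k}) | e in touch EK (fresh V f)].
  apply/esym/eqP; rewrite eqEcard touch_fresh_new //= (card_imset _ (imset_inj fi)).
  by rewrite ctN -cN.
pose D' := \bigcup_(e in touch EK (fresh V f)) e.
have ND' : fresh V f \subset D'.
  apply/subsetP => i iN; have : 0 < #|touch EK [set i]| by rewrite cycle_touch1.
  case/card_gt0P => e /touchP[eE [j je]]; rewrite inE => /eqP ji; subst j.
  by apply/bigcupP; exists e => //; apply/touchP; split=> //; exists i.
exists (f @: D'); split; first by rewrite freshE imsetS.
- by rewrite imsetS ?subsetT.
(* No edge touches both the fresh vertices and the complement of [D']. If that complement is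
   nonempty, both sets expand, and together they need |N| + |~: D'| + 2 of the k edges, so |D'| >=
   |N| + 2. *)
- rewrite card_imset // cN; have cD := cardsC D'; rewrite card_ord in cD.
  have [M0|M0] := eqVneq (~: D') set0; first by rewrite M0 cards0 addn0 in cD; rewrite -cN cD; case: (ltnP #|N| k.-1) => /=; lia.
  have MT : ~: D' != setT.
    by apply: contraNneq N0 => MT; rewrite -subset0 -setCT -MT setCK.
  have exM := cycle_expand k3 M0 MT.
  have d : [disjoint touch EK (fresh V f) & touch EK (~: D')].
    rewrite disjoints_subset; apply/subsetP => e eN; rewrite inE; apply/touchP => -[_ [j je]].
    by rewrite inE => /bigcupP[]; exists e.
  have : #|touch EK (fresh V f) :|: touch EK (~: D')| <= k.
    by rewrite -[leqRHS](card_cycle_edges k3) subset_leq_card // subUset !touch_sub.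
  rewrite cardsU disjoint_setI0 // cards0 subn0 => h; move: exM ctN cD h cN.
  move: (#|~: D'|) (#|D'|) => x y; clear; case: (ltnP _ k.-1) => ? /=; lia.
(* [A] turns out to be all of [fresh V f]: by [cycle_star] no edge touches both [A] and the rest,
   and if the rest were nonempty, two expansions would require one edge more than there are. *)
move=> g ng; pose A := [set i in fresh V f | f i \in vset g].
have A0 : A != set0.
  have [e] := new_edge ng; rewrite eqX => /imsetP[c /touchP[cE [i ic iN]] ->] cg.
  by apply/set0Pn; exists i; rewrite inE iN (subsetP cg) ?imset_f.
have starA e : e \in touch EK A -> f @: e \subset vset g.
  by case/touchP=> eE [i ie]; rewrite inE => /andP[iN ig]; apply: cycle_star ig eE ie.
have AN : A = fresh V f.
  apply/eqP; rewrite eqEsubset; apply/andP; split; first by apply/subsetP => i; rewrite inE => /andP[].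
  rewrite -setD_eq0; apply/negPn/negP => B0; set B := _ :\: _ in B0.
  have BT : B != setT.
    by apply: contraNneq NT => BT; rewrite -subTset -BT subsetDl.
  have AT : A != setT.
    by apply: contraNneq NT => AT; rewrite -subTset -AT; apply/subsetP => i; rewrite inE => /andP[].
  have d : [disjoint touch EK A & touch EK B].
    rewrite disjoints_subset; apply/subsetP => e eA; rewrite inE; apply/touchP => -[_ [j je]].
    rewrite !inE => /andP[]; rewrite negb_and => /orP[/negP//|/negP[]].
    by rewrite (subsetP (starA e eA)) ?imset_f.
  have cAB : #|A| + #|B| = #|fresh V f|.
    rewrite -(cardsID A (fresh V f)) -/B (setIidPr _) //.
    by apply/subsetP => i; rewrite inE => /andP[].
  have : #|touch EK A :|: touch EK B| <= #|touch EK (fresh V f)|.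
    rewrite subset_leq_card // subUset !touchS ?subsetDl //.
    by apply/subsetP => i; rewrite inE => /andP[].
  rewrite cardsU disjoint_setI0 // cards0.
  by have := cycle_expand k3 A0 AT; have := cycle_expand k3 B0 BT; lia.
apply/subsetP => z /imsetP[i /bigcupP[e eN ie] ->].
by rewrite (subsetP (starA e _)) ?imset_f // AN.
Qed.

(** The arithmetic leaves one case, costing the whole budget [k]: two old vertices and no old edge.
    These two vertices lie in every new copy, so they can serve as an initial offer. *)
Lemma cycle_step_special : k.-1 * #|X| <= k * #|N| + k -> #|N|.+1 < #|X| ->
  [/\ #|N| = k - 2, #|X| = k, #|vset f :&: V| = 2 & forall g, new g -> vset f :&: V \subset vset g].
Proof.
move=> leX ltX; have [ltN /andP[_ leXk]] := cycle_step_card.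
have cN : #|N| = #|fresh V f| by rewrite card_fresh.
have old := card_old V fi.
have eqN : #|N| = k - 2.
  have : k.-1 * #|N|.+2 <= k.-1 * #|X| by rewrite leq_mul2l ltX orbT.
  have : k.-1 * #|N|.+2 = k * #|N| + 2 * k.-1 - #|N| by nia.
  by lia.
split=> //; try lia.
move=> g ng; have [e eX eg] := new_edge ng.
have [eV|eV] := boolP (e \subset V).
  have ef : e \in eset f by move: eX; rewrite inE => /andP[].
  suff <- : e = vset f :&: V by [].
  apply/eqP; rewrite eqEcard subsetI (eset_sub ef) eV /=.
  by rewrite (eset_card2 (@cycle_edges2 k k3) fi ef); lia.
have [i iN ig] := new_edge_fresh eX eg eV.
apply/subsetP => z zO; apply/negPn/negP => zg.
have /imsetP[j _ zj] : z \in vset f by move: zO; rewrite inE => /andP[].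
(* Suppose [g] misses the old vertex [f j]. Then [A] and [M] contain all pattern vertices but the
   other old one, so some edge touches both, and [cycle_star] puts its end in [M] on [g]. *)
pose A := [set i in fresh V f | f i \in vset g].
pose M := [set i in fresh V f | f i \notin vset g] :|: [set j].
have cAM : #|A| + #|M| = #|fresh V f| + 1.
  rewrite /M setUC cardsU1 inE [f j \in vset g](_ : _ = false) ?andbT; last first.
    by rewrite -zj (negPf zg).
  have -> : j \in fresh V f = false by rewrite inE -zj; move: zO; rewrite inE => /andP[_ ->].
  rewrite /= addnCA addnC; congr (_ + _).
  rewrite -(cardsID [set i | f i \in vset g] (fresh V f)); congr (_ + _); apply: eq_card => l;
    by rewrite !inE // andbC.
have [||||c cA /touchP[_ [l lc lM]]] := @cycle_link k k3 A M.
- by apply/set0Pn; exists i; rewrite inE iN.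
- by apply/set0Pn; exists j; rewrite !inE eqxx orbT.
- rewrite disjoints_subset; apply/subsetP => l; rewrite !inE negb_or => /andP[lV lg].
  by rewrite lg lV /=; apply: contraNneq lV => ->; rewrite -zj; move: zO; rewrite inE => /andP[].
- by lia.
case/touchP: cA => cE [l' l'c]; rewrite inE => /andP[l'N l'g].
have lg : f l \in vset g by rewrite (subsetP (cycle_star ng l'N l'g cE l'c)) ?imset_f.
by move: lM; rewrite !inE lg andbF /= => /eqP lj; rewrite zj -lj lg in zg.
Qed.

End CycleStep.

Section CycleSolve.
Variables (k b : nat) (T : finType).
Hypotheses (k4 : 4 <= k) (b0 : 0 < b).
Let k3 : 3 <= k. Proof. exact: ltnW. Qed.
Notation EK := (cycle_edges k).
Notation eset := (eset (cycle_edges k)).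

(** With |EK| = k the excess is (k-1)|F| + k - k|V|, at most k by hypothesis. A step with |N| + 1
    new edges raises it by exactly its shortfall k-1-|N|. The only other possible step consumes the
    whole budget at once, so it leaves total shortfall 0 and excess k; afterwards only steps without
    shortfall occur. *)
Lemma built_cycle_demands (V : {set T}) (F : {set {set T}}) :
  built EK V F -> k.-1 * #|F| <= k * #|V| ->
  exists L (O : {set T}), [/\ demands V L, all (admissible k) L, O \subset V,
    (O == set0) && (\sum_(d <- L) (k.-1 - #|d.1|) + k * #|V| <= k.-1 * #|F| + k) ||
    [&& #|O| == 2, \sum_(d <- L) (k.-1 - #|d.1|) == 0 & k * #|V| <= k.-1 * #|F|] &
    forall g : {ffun 'I_k -> T}, injective g -> eset g \subset F ->
      (O != set0) && (O \subset vset g) \/ exists2 d, d \in L & d.2 \subset vset g].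
Proof.
elim=> {V F} [r|V F f bVF IH fi fV fF] leF.
  exists [::], set0; split; rewrite ?sub0set // ?eqxx ?big_nil ?cards1 ?cards0 ?muln1 ?muln0 ?leqnn //.
  move=> g gi; rewrite subset0 => /eqP g0; have := card_eset (cycle_edges k) gi.
  by rewrite g0 cards0 card_cycle_edges //; card_lia.
have FV e : e \in F -> e \subset V by move=> /(built_edge (@cycle_edges2 k k3) bVF)[].
have [cV cF] := built_step_card f bVF.
have [ltN /andP[ltX leX]] := cycle_step_card k4 FV fi fV fF.
rewrite cV cF in leF *.
set N := vset f :\: V in cV ltN ltX leF *; set X := eset f :\: F in cF ltX leX leF *.
have mono : k * #|N| <= k.-1 * #|X|.
  have : k.-1 * #|N|.+1 <= k.-1 * #|X| by rewrite leq_mul2l ltX orbT.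
  by nia.
have [|L [O [dL adm OV hO hg]]] := IH; first by rewrite !mulnDr in leF; card_lia.
have OVf : O \subset V :|: vset f by rewrite (subset_trans OV) ?subsetUl.
case: (leqP #|X| #|N|.+1) => [leXN|ltXN].
  have [D [ND Df cD hD]] := cycle_step_demand k4 FV fi fV fF leXN.
  exists ((N, D) :: L), O; split=> //.
  - exists V; split=> //; first by rewrite subsetUl.
      by rewrite disjoints_subset /N setDE subsetIr.
    by rewrite (subset_trans Df) ?subsetUr.
  - by rewrite /= adm andbT /admissible /= cD andbT; card_lia.
  - have eqX : #|X| = #|N|.+1 by card_lia.
    rewrite big_cons /= eqX; case/orP: hO => [/andP[-> hS]|/and3P[-> /eqP hS hV]]; apply/orP.
      left; rewrite /= !mulnDr; move: hS; move: (\sum_(_ <- _) _) => S hS.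
      have : k.-1 * #|N|.+1 + #|N| = k * #|N| + k.-1 by nia.
      by card_lia.
    right; rewrite hS addn0 /= !mulnDr eqX in leF *.
    have : k.-1 * #|N|.+1 + #|N| = k * #|N| + k.-1 by nia.
    by card_lia.
  - move=> g gi gF; have [gF0|gF0] := boolP (eset g \subset F).
      by have [|[d dL' dg]] := hg g gi gF0; [left|right; exists d; rewrite // inE dL' orbT].
    by right; exists (N, D); rewrite ?mem_head //; apply: hD.
case/orP: hO => [/andP[O0 hS]|/and3P[_ _ hV]]; last first.
  have : k.-1 * #|N|.+2 <= k.-1 * #|X| by rewrite leq_mul2l ltXN orbT.
  have : k.-1 * #|N|.+2 + #|N| = k * #|N| + 2 * k.-1 by nia.
  by rewrite !mulnDr in leF; card_lia.
have [|cN cX cO hg'] := cycle_step_special k4 FV fi fV fF _ ltXN; rewrite -/N -/X.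
  by rewrite !mulnDr in leF; card_lia.
have kk : k.-1 * #|X| = k * #|N| + k by rewrite cN cX; nia.
exists L, (vset f :&: V); split.
- by apply: demands_mono dL; rewrite subsetUl.
- by [].
- by rewrite (subset_trans (subsetIr _ _)) ?subsetUl.
- rewrite cO eqxx /= !mulnDr in leF *; apply/orP; right; apply/andP; split; last by card_lia.
  by rewrite -leqn0; card_lia.
- move=> g gi gF; have [gF0|gF0] := boolP (eset g \subset F).
    by have [|[d dL' dg]] := hg g gi gF0; [rewrite O0|right; exists d].
  by left; rewrite -card_gt0 cO /= hg'.
Qed.

Lemma built_cycle_waiter (V : {set T}) (F : {set {set T}}) (H : {set {set T}}) :
  built EK V F -> k.-1 * #|F| <= k * #|V| ->
  (forall A, A \in H -> exists g : {ffun 'I_k -> T}, [/\ injective g, eset g \subset F & A = vset g]) ->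
  waiter_wins b H V set0.
Proof.
move=> bVF leF HF; have [L [O [dL adm OV hO hg]]] := built_cycle_demands bVF leF.
apply: (waiter_wins_demands k4 b0 dL adm OV).
  case/orP: hO => [/andP[-> hS]|/and3P[-> /eqP-> _]]; last by rewrite orbT.
  by apply/orP; left => /=; card_lia.
by move=> A /HF[g [gi gF ->]]; apply: hg.
Qed.
End CycleSolve.

(** * Cliques *)

Definition pairs_of (T : finType) (A : {set T}) : {set {set T}} :=
  [set e : {set T} | (e \subset A) && (#|e| == 2)].

Definition clique_edges k : {set {set 'I_k}} := pairs_of setT.

Lemma bin2_double n : 2 * 'C(n, 2) = n * n.-1.
Proof. by elim: n => // n IH; rewrite binS bin1 mulnDr IH; case: n {IH} => // n /=; lia. Qed.

Lemma card_pairs_of (T : finType) (A : {set T}) : 2 * #|pairs_of A| = #|A| * #|A|.-1.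
Proof. by rewrite cards_draws bin2_double. Qed.

Section CliquePattern.
Variable k : nat.

Lemma clique_edgesP (e : {set 'I_k}) : (e \in clique_edges k) = (#|e| == 2).
Proof. by rewrite inE subsetT. Qed.

Lemma clique_edges2 e : e \in clique_edges k -> #|e| = 2.
Proof. by rewrite clique_edgesP => /eqP. Qed.

Lemma card_clique_edges : 2 * #|clique_edges k| = k * k.-1.
Proof. by rewrite card_pairs_of cardsT card_ord. Qed.

(** The edges not touching [A] are the pairs of its complement. Edge counts of cliques are doubled
    throughout to avoid halves. *)
Lemma clique_touch (A : {set 'I_k}) :
  2 * #|touch (clique_edges k) A| + #|~: A| * #|~: A|.-1 = k * k.-1.
Proof.
rewrite -card_pairs_of -card_clique_edges -mulnDr; congr (2 * _).
rewrite -cardsUI (_ : _ :&: _ = set0) ?cards0 ?addn0; last first.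
  apply/setP => e; rewrite in_setI in_set0; apply/andP => -[/touchP[_ [i ie iA]]].
  by rewrite inE => /andP[/subsetP/(_ i ie)]; rewrite inE iA.
congr #|pred_of_set _|; apply/setP => e; rewrite in_setU clique_edgesP.
rewrite /touch !inE subsetT /=; case: (#|e| == 2); rewrite ?andbF //= andbT.
by rewrite -disjoints_subset orNb.
Qed.

Lemma clique_touch1 (i : 'I_k) : #|touch (clique_edges k) [set i]| = k.-1.
Proof.
have := clique_touch [set i]; rewrite cardsC1 card_ord.
have k0 : 0 < k by apply: leq_ltn_trans (ltn_ord i).
by move: (#|touch _ _|) k0; clear; case: k => // -[|k'] /=; nia.
Qed.
End CliquePattern.

Section CliqueStep.
Variables (k : nat) (T : finType).
Hypothesis k3 : 3 <= k.
Notation EK := (clique_edges k).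
Notation eset := (eset (clique_edges k)).
Variables (V : {set T}) (F : {set {set T}}) (f : {ffun 'I_k -> T}).
Hypotheses (FV : forall e, e \in F -> e \subset V) (fi : injective f).
Hypotheses (fV : ~~ [disjoint vset f & V]) (fF : ~~ (eset f \subset F)).
Notation N := (vset f :\: V).
Notation X := (eset f :\: F).
Notation new := (fun g : {ffun 'I_k -> T} =>
  [/\ injective g, eset g \subset F :|: eset f & ~~ (eset g \subset F)]).

Definition chords : {set {set T}} := [set e in X | e \subset V].

Lemma clique_eset (g : {ffun 'I_k -> T}) : injective g -> eset g = pairs_of (vset g).
Proof.
move=> gi; apply/setP => e; rewrite inE; apply/idP/andP => [eg|[/subsetP eg e2]].
  by rewrite (eset_sub eg) (eset_card2 (@clique_edges2 k) gi eg).
have ee : e = g @: (g @^-1: e).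
  apply/setP => z; apply/idP/imsetP => [ze|[i]]; last by rewrite inE => ? ->.
  by have /imsetP[i _ zi] := eg z ze; exists i; rewrite // inE -zi.
by rewrite ee imset_f // clique_edgesP -(card_imset _ gi) -ee.
Qed.

Lemma chord_edge e : e \in chords -> e \subset vset f :&: V /\ #|e| = 2.
Proof.
rewrite !inE => /andP[/andP[_ ef] eV]; rewrite subsetI eV (eset_sub ef).
by rewrite (eset_card2 (@clique_edges2 k) fi ef).
Qed.

(** New edges either touch a fresh vertex or are chords. In the growth of 2|F| - k|V|, each fresh
    vertex counts once for every old vertex beyond the first, and each chord counts twice. *)
Lemma clique_step_card :
  [/\ 0 < #|vset f :&: V|, #|vset f :&: V| + #|N| = k, 0 < #|X| &
      2 * #|X| = k * #|N| + #|vset f :&: V|.-1 * #|N| + 2 * #|chords|].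
Proof.
have j0 : 0 < #|vset f :&: V| by rewrite card_gt0 setI_eq0.
have jN : #|vset f :&: V| + #|N| = k by rewrite cardsID card_vset.
split=> //; first by rewrite card_gt0 setD_eq0.
have cX : #|X| = #|touch EK (fresh V f)| + #|chords|.
  rewrite -(card_imset _ (imset_inj fi)) -cardsUI (_ : _ :&: _ = set0) ?cards0 ?addn0; last first.
    apply/setP => e; rewrite in_setI in_set0; apply/andP => -[/imsetP[c /touchP[cE [i ic iV]] ->]].
    rewrite !inE => /andP[_ /subsetP/(_ (f i))]; rewrite imset_f // => /(_ isT).
    by move: iV; rewrite inE => /negPf->.
  congr #|pred_of_set _|; apply/eqP; rewrite eqEsubset subUset touch_fresh_new // andbC.
  apply/andP; split; first by apply/subsetP => e; rewrite inE => /andP[].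
  apply/subsetP => e eX; rewrite in_setU; case: (boolP (e \subset V)) => eV.
    by rewrite [e \in chords]inE eX eV orbT.
  have := eX; rewrite inE => /andP[eF /imsetP[c cE ec]].
  have /subsetPn[z ze zV] := eV; rewrite ec in ze; have /imsetP[i ic zi] := ze.
  by rewrite ec imset_f //; apply/touchP; split=> //; exists i; rewrite // inE -zi.
have := clique_touch (fresh V f); rewrite cX mulnDr.
have := cardsC (fresh V f); rewrite card_ord -(card_fresh V fi).
by move: (#|_|) (#|_|) (#|_|) (#|_|) (#|_|) jN j0 => a c d e g; nia.
Qed.

(** A new copy through a fresh vertex uses all edges of [f] there by [fresh_star], and in a clique
    these reach every vertex of [f]. Otherwise its new edge is a chord. *)
Lemma clique_new g : new g -> (vset f \subset vset g) \/ exists2 e, e \in chords & e \subset vset g.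
Proof.
case=> gi gF /subsetPn[e eg eF]; have ef : e \in eset f.
  by have := subsetP gF e eg; rewrite inE (negPf eF).
have esg := eset_sub eg; have [eV|/subsetPn[z ze zV]] := boolP (e \subset V).
  by right; exists e; rewrite // !inE eF ef.
left; have /imsetP[i _ zi] := subsetP (eset_sub ef) z ze.
have iN : i \in fresh V f by rewrite inE -zi.
have ig : f i \in vset g by rewrite -zi (subsetP esg).
have d0 : 0 < k.-1 by card_lia.
have star := fresh_star FV fi d0 (@clique_touch1 k) gi gF iN ig.
apply/subsetP => w /imsetP[l _ ->]; have [->//|li] := eqVneq l i.
have lE : [set i; l] \in EK by rewrite clique_edgesP cards2 (eq_sym i l) li.
have /eset_sub/subsetP := star _ lE (set21 _ _).
by apply; rewrite imset_f ?set22.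
Qed.

End CliqueStep.

Section CliqueSolve.
Variables (k b : nat) (T : finType).
Hypotheses (k4 : 4 <= k) (b0 : 0 < b).
Let k3 : 3 <= k. Proof. exact: ltnW. Qed.
Notation EK := (clique_edges k).
Notation eset := (eset (clique_edges k)).

Definition missing (F : {set {set T}}) (J : {set T}) : {set {set T}} := pairs_of J :\: F.

(* Holds when distinct copies share at most one vertex, in a tree-like way: then
   a set of vertices is either contained in one copy or far from complete. *)
Definition tree_like (V : {set T}) (F : {set {set T}}) : Prop :=
  forall J : {set T}, J \subset V -> missing F J = set0 \/ #|J| <= #|missing F J| + 2.

Lemma card_cross (A B : {set T}) : [disjoint A & B] ->
  #|[set [set x.1; x.2] | x in setX A B]| = #|A| * #|B|.
Proof.
move=> dAB; rewrite card_in_imset ?cardsX // => -[a c] [a' c']; rewrite !inE /=.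
move=> /andP[aA cB] /andP[a'A c'B] /setP eq.
have aN x y : x \in A -> y \in B -> x != y.
  by move=> xA yB; apply: contraTneq xA => ->; rewrite (disjointFl dAB).
have := eq a; have := eq c; rewrite !inE !eqxx orbT /=.
rewrite (negPf (aN a c' aA c'B)) orbF [c == a']eq_sym (negPf (aN a' c a'A cB)) /=.
by move=> /esym/eqP-> /esym/eqP->.
Qed.

(** Every pair joining the new part [A] of [J] to the part [B] outside [f] is missing. If both are
    nonempty, |A||B| >= |A| + |B| - 1, and at most one vertex of [J] lies in neither. *)
Lemma tree_like_step (V : {set T}) (F : {set {set T}}) (f : {ffun 'I_k -> T}) :
  (forall e, e \in F -> e \subset V) -> injective f ->
  #|vset f :&: V| = 1 -> tree_like V F -> tree_like (V :|: vset f) (F :|: eset f).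
Proof.
move=> FV fi c1 tVF J JV; pose A := J :&: (vset f :\: V); pose B := J :\: vset f.
have [A0|A0] := eqVneq A set0.
  have JV' : J \subset V.
    apply/subsetP => z zJ; have := subsetP JV z zJ; rewrite inE => /orP[//|zf].
    by apply/negPn/negP => zV; have := in_set0 z; rewrite -A0 !inE zJ zf zV.
  suff -> : missing (F :|: eset f) J = missing F J by apply: tVF.
  apply/setP => e; rewrite !inE negb_or; case: (boolP (e \in F)) => //= eF.
  case: (boolP (e \in eset f)) => //= ef; apply/esym/andP => -[eJ /eqP e2].
  have /subset_leq_card : e \subset vset f :&: V by rewrite subsetI (eset_sub ef) (subset_trans eJ).
  by rewrite c1 e2.
have [B0|B0] := eqVneq B set0.
  left; apply/eqP; rewrite setD_eq0; apply/subsetP => e; rewrite inE => /andP[eJ e2].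
  rewrite inE (clique_eset fi) [e \in pairs_of _]inE e2 andbT orbC (subset_trans eJ) //.
  by rewrite -setD_eq0 -/B B0.
right; have dAB : [disjoint A & B].
  by rewrite disjoints_subset; apply/subsetP => z; rewrite !inE => /andP[_ /andP[_ ->]].
have : [set [set x.1; x.2] | x in setX A B] \subset missing (F :|: eset f) J.
  apply/subsetP => e /imsetP[[a c]]; rewrite in_setX /= => /andP[aA cB] ->.
  have := aA; rewrite !inE => /and3P[aJ aV af]; have := cB; rewrite !inE => /andP[cf cJ].
  rewrite negb_or subUset !sub1set aJ cJ cards2 /=; apply/andP; split; last first.
    by rewrite (_ : a != c) //; apply: contraTneq aA => ->; rewrite (disjointFl dAB).
  apply/andP; split; [apply: contraNN aV => /FV|apply: contraNN cf => /eset_sub];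
    by rewrite subUset !sub1set => /andP[].
move=> /subset_leq_card; rewrite card_cross //.
have : J \subset A :|: B :|: (vset f :&: V).
  apply/subsetP => z zJ; have := subsetP JV z zJ; rewrite !inE zJ /=.
  by case: (z \in V); case: (z \in vset f).
move=> /subset_leq_card leJ leM; have {leJ} leJ : #|J| <= #|A| + #|B| + 1.
  apply: leq_trans leJ _; rewrite -c1 (leq_trans (leq_card_setU _ _)) //.
  by rewrite leq_add2r leq_card_setU.
rewrite -!card_gt0 in A0 B0; apply: leq_trans leJ _; apply: leq_trans (leq_add leM (leqnn 2)).
by move: (#|A|) (#|B|) A0 B0 => a c; nia.
Qed.

(** The budget is 2|F| + k - k|V| <= k. With j old vertices, a step without chords raises it by
    (j-1)|N|, enough for its shortfall j-1. If j >= 2 the rise is at least k-2, so until then the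
    union is tree-like and afterwards at most 2 is left. A step with chords exhausts the budget, and
    one of its chords becomes the offer [O]. *)
Lemma built_clique_demands (V : {set T}) (F : {set {set T}}) :
  built EK V F -> 2 * #|F| <= k * #|V| ->
  exists L (O : {set T}), [/\ demands V L, all (admissible k) L, O \subset V,
    [/\ O = set0, \sum_(d <- L) (k.-1 - #|d.1|) + k * #|V| <= 2 * #|F| + k &
        tree_like V F \/ k * #|V| <= 2 * #|F| + 2] \/
    [/\ #|O| = 2, \sum_(d <- L) (k.-1 - #|d.1|) <= k - 2 & k * #|V| <= 2 * #|F|] &
    forall g : {ffun 'I_k -> T}, injective g -> eset g \subset F ->
      (O != set0) && (O \subset vset g) \/ exists2 d, d \in L & d.2 \subset vset g].
Proof.
elim=> {V F} [r|V F f bVF IH fi fV fF] leF.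
  exists [::], set0; split; rewrite ?sub0set //.
    left; split=> //; first by rewrite big_nil cards1 cards0; lia.
    left=> J Jr; left; apply/eqP; rewrite setD_eq0; apply/subsetP => e.
    rewrite inE => /andP[eJ /eqP e2]; have := subset_leq_card (subset_trans eJ Jr).
    by rewrite cards1 e2.
  move=> g gi; rewrite subset0 => /eqP g0; have := card_eset (clique_edges k) gi.
  by have := card_clique_edges k; rewrite g0 cards0; nia.
have FV e : e \in F -> e \subset V by move=> /(built_edge (@clique_edges2 k) bVF)[].
have [cV cF] := built_step_card f bVF.
have [j0 jN X0 eqX] := clique_step_card k3 FV fi fV fF.
rewrite cV cF !mulnDr in leF *.
have [q [{}eqX f1 f2]] : exists q, [/\ 2 * #|eset f :\: F| = k * #|vset f :\: V| + q + 2 * #|chords V F f|,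
    #|vset f :\: V| = 0 /\ q = 0 \/ 0 < #|vset f :\: V| /\ #|vset f :&: V|.-1 <= q &
    #|vset f :\: V| = 0 \/ #|vset f :&: V| = 1 \/ k <= q + 2].
  exists (#|vset f :&: V|.-1 * #|vset f :\: V|); split=> //.
    by case: #|vset f :\: V| => [|m]; [left; rewrite muln0|right; rewrite leq_pmulr].
  case: #|vset f :\: V| jN => [|m] jN; first by left.
  by case: #|vset f :&: V| j0 jN => [|[|j]] // _ <-; right; [left|right => /=; nia].
have leF0 : 2 * #|F| <= k * #|V| by card_lia.
have [L [O [dL adm OV hO hg]]] := IH leF0.
have OVf : O \subset V :|: vset f by rewrite (subset_trans OV) ?subsetUl.
have dNV : [disjoint vset f :\: V & V] by rewrite disjoints_subset setDE subsetIr.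
have [Y0|Y0] := eqVneq (chords V F f) set0.
  rewrite Y0 cards0 muln0 addn0 in eqX.
  have N0 : 0 < #|vset f :\: V| by case: f1 eqX => [[-> ->]|[//]]; rewrite muln0; card_lia.
  have {}f1 : #|vset f :&: V|.-1 <= q by case: f1 => -[//]; card_lia.
  exists ((vset f :\: V, vset f) :: L), O; split=> //.
  - exists V; split=> //; rewrite ?subsetUl ?subsetUr ?subsetDl //.
  - rewrite /= adm andbT /admissible /= (card_vset fi).
    by case: (ltnP _ k.-1) => /= ?; card_lia.
  - rewrite big_cons /=; case: hO => [[O0 hS tr]|[O2 hS hV]]; [left|right]; split=> //.
    + move: (\sum_(_ <- _) _) hS => S hS; card_lia.
    + case: tr => [tr|hV]; last by right; card_lia.
      have [j1|j1] := eqVneq #|vset f :&: V| 1; first by left; apply: tree_like_step.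
      by right; case: f2 => [|[f2|]]; [card_lia|rewrite f2 in j1|card_lia].
    + by move: (\sum_(_ <- _) _) hS => S hS; card_lia.
    + by card_lia.
  - move=> g gi gF; have [gF0|gF0] := boolP (eset g \subset F).
      by have [|[d dL' dg]] := hg g gi gF0; [left|right; exists d; rewrite // inE dL' orbT].
    right; exists (vset f :\: V, vset f); rewrite ?mem_head //=.
    by have [//|[e]] := clique_new k3 FV fi (And3 gi gF gF0); rewrite Y0 inE.
have [o oY] := set0Pn _ Y0; have [oV o2] := chord_edge fi oY.
rewrite -card_gt0 in Y0; have j2 : 2 <= #|vset f :&: V| by rewrite -o2 subset_leq_card.
case: hO => [[O0 hS tr]|[_ _ hV]]; last by card_lia.
(* The chords are exactly the pairs missing among the old vertices of [f], so in a tree-like union a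
   copy with j old vertices and a chord has at least j-2 chords. *)
have missf : tree_like V F -> #|vset f :&: V| <= #|chords V F f| + 2.
  move=> /(_ _ (subsetIr (vset f) V)); have sub : chords V F f \subset missing F (vset f :&: V).
    apply/subsetP => e eY; have [eV e2] := chord_edge fi eY; rewrite !inE eV e2 eqxx.
    by move: eY; rewrite !inE => /andP[/andP[->]].
  have sub2 : missing F (vset f :&: V) \subset chords V F f.
    apply/subsetP => e; rewrite !inE subsetI => /and3P[eF /andP[ef eV] e2].
    by rewrite eF eV (clique_eset fi) inE ef e2.
  have -> : missing F (vset f :&: V) = chords V F f by apply/eqP; rewrite eqEsubset sub sub2.
  by case=> [Y00|//]; rewrite Y00 cards0 in Y0.
have hV' : k * (#|V| + #|vset f :\: V|) <= 2 * (#|F| + #|eset f :\: F|).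
  by case: tr => [/missf|]; card_lia.
exists L, o; split=> //.
- by apply: demands_mono dL; rewrite subsetUl.
- by rewrite (subset_trans oV) // (subset_trans (subsetIr _ _)) ?subsetUl.
- by right; split=> //; card_lia.
move=> g gi gF; have [gF0|gF0] := boolP (eset g \subset F).
  by have [|[d dL' dg]] := hg g gi gF0; [rewrite O0 eqxx|right; exists d].
left; rewrite -card_gt0 o2 /=.
have ofs : o \subset vset f by rewrite (subset_trans oV) ?subsetIl.
have [fg|[e eY eg]] := clique_new k3 FV fi (And3 gi gF gF0); first exact: subset_trans fg.
have [Y1|Y1] := leqP #|chords V F f| 1.
  have /cards1P[y Yy] : #|chords V F f| == 1 by rewrite eqn_leq Y1.
  by move: oY eY; rewrite Yy !inE => /eqP-> /eqP <-.
case: tr => [tr|]; last by card_lia.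
have lef := missf tr.
(* Several chords fit into the budget only for k = 4, no fresh vertex and two chords. A new copy [g]
   then lies in [V], and being tree-like forces it to miss at least two pairs of [F], hence both
   chords, among them [o]. *)
have [cN0 k44] : #|vset f :\: V| = 0 /\ #|chords V F f| + 2 <= k.
  by split; card_lia.
have gV : vset g \subset V.
  have /eqP f0 : vset f :\: V == set0 by rewrite -cards_eq0 cN0.
  have fV' : vset f \subset V by rewrite -setD_eq0 f0.
  apply/subsetP => z zg; have k10 : 0 < k.-1 by card_lia.
  have [c cg zc] := edge_in_star k10 (@clique_touch1 k) zg.
  have := subsetP gF c cg; rewrite inE => /orP[/FV/subsetP->//|/eset_sub/subsetP/(_ z zc)].
  by move/(subsetP fV').
have sub : missing F (vset g) \subset chords V F f.
  apply/subsetP => c; rewrite 2!inE => /and3P[cF' cg c2].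
  have cg' : c \in eset g by rewrite (clique_eset gi) inE cg.
  have := subsetP gF c cg'; rewrite !inE cF' (negPf cF') /= => ->.
  by rewrite (subset_trans cg).
have /eqP eqm : missing F (vset g) == chords V F f.
  rewrite eqEcard sub /=; case: (tr _ gV) => [m0|].
    case/negP: gF0; rewrite (clique_eset gi) -setD_eq0 -/(missing F (vset g)) m0 eqxx //.
  by rewrite (card_vset gi); card_lia.
by move: oY; rewrite -eqm !inE => /and3P[].
Qed.

Lemma built_clique_waiter (V : {set T}) (F : {set {set T}}) (H : {set {set T}}) :
  built EK V F -> 2 * #|F| <= k * #|V| ->
  (forall A, A \in H -> exists g : {ffun 'I_k -> T}, [/\ injective g, eset g \subset F & A = vset g]) ->
  waiter_wins b H V set0.
Proof.
move=> bVF leF HF; have [L [O [dL adm OV hO hg]]] := built_clique_demands bVF leF.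
apply: (waiter_wins_demands k4 b0 dL adm OV).
  case: hO => [[-> hS _]|[-> -> _]]; last by rewrite orbT.
  by apply/orP; left; rewrite eqxx /=; lia.
by move=> A /HF[g [gi gF ->]]; apply: hg.
Qed.
End CliqueSolve.

(** * Triangles *)

Section TriangleSolve.
Variables (b : nat) (T : finType).
Hypothesis b2 : 2 <= b.
Notation EK := (clique_edges 3).
Notation eset := (eset (clique_edges 3)).
Implicit Types (L : seq ({set T} * {set T})) (V O : {set T}) (F : {set {set T}}).

Definition single (d : {set T} * {set T}) : bool := #|d.1| == 1.
Definition double (d : {set T} * {set T}) : bool := #|d.1| == 2.

(* A vertex of [danger L O] is either an end of the only edge ever found between
   two already discovered vertices, or the only new vertex of its triangle. *)
Definition danger L O : {set T} := O :|: \bigcup_(d <- L | single d) d.1.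

(** Needed for the old edge [d.2 :\: d.1] of a triangle with one new vertex: if it avoids [danger],
    it lies in a triangle with two new vertices, and one pair can serve both triangles. *)
Definition covered L O (e : {set T}) : Prop :=
  (exists2 d, (d \in L) && double d & e \subset d.2) \/ ~~ [disjoint e & danger L O].

Lemma danger_cons L O d : danger L O \subset danger (d :: L) O.
Proof. by rewrite /danger big_cons; case: ifP => // _; rewrite setUS ?subsetUr. Qed.

Lemma covered_mono L L' O O' e : {subset L <= L'} -> danger L O \subset danger L' O' ->
  covered L O e -> covered L' O' e.
Proof.
move=> LL dd [[d /andP[/LL dL d2] ed]|de]; [left; exists d; rewrite ?dL ?d2 //|right].
by apply: contraNN de; apply: disjointWr.
Qed.

(** The budget is 2|F| + 3 - 3|V| <= 3. A triangle with one new vertex and no chord costs 1 and a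
    chord costs 2, so at most one chord ever occurs, and its two ends count like two such
    triangles. *)
Lemma built_triangle_demands V F :
  built EK V F -> 2 * #|F| <= 3 * #|V| ->
  exists L O, [/\ demands V L /\ all (fun d => (single d || double d) && (#|d.2| == 3)) L,
    O \subset V /\ (O == set0) || (#|O| == 2),
    count single L + #|O| + 3 * #|V| <= 2 * #|F| + 3,
    (forall e, e \in F -> covered L O e) /\
    (forall d, d \in L -> single d -> covered L O (d.2 :\: d.1)) &
    forall g : {ffun 'I_3 -> T}, injective g -> eset g \subset F ->
      (O != set0) && (O \subset vset g) \/ exists2 d, d \in L & d.2 \subset vset g].
Proof.
elim=> {V F} [r|V F f bVF IH fi fV fF] leF.
  exists [::], set0; split; rewrite ?sub0set ?eqxx ?cards0 ?cards1 //.
    by split=> // e; rewrite inE.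
  move=> g gi; rewrite subset0 => /eqP g0; have := card_eset (clique_edges 3) gi.
  by have := card_clique_edges 3; rewrite g0 cards0; lia.
have FV e : e \in F -> e \subset V by move=> /(built_edge (@clique_edges2 3) bVF)[].
have [cV cF] := built_step_card f bVF.
have [j0 jN X0 eqX] := clique_step_card (isT : 2 < 3) FV fi fV fF.
have {}eqX : 2 * #|eset f :\: F| = 3 * #|vset f :\: V| + (#|vset f :\: V| == 1) + 2 * #|chords V F f|.
  rewrite eqX; congr (_ + _ + _).
  by move: jN j0; case: #|vset f :\: V| => [|[|[|m]]] /=; case: #|vset f :&: V| => [|[|[|j]]] //=; lia.
rewrite cV cF in leF *.
have leF0 : 2 * #|F| <= 3 * #|V| by card_lia.
have [L [O [[dL adm] [OV O02] cnt [cE cI] hg]]] := IH leF0.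
have dNV : [disjoint vset f :\: V & V] by rewrite disjoints_subset setDE subsetIr.
have cf := card_vset fi.
have [Y0|Y0] := eqVneq (chords V F f) set0.
  rewrite Y0 cards0 muln0 addn0 in eqX.
  have N0 : 0 < #|vset f :\: V|.
    by case: posnP eqX => // ->; move: X0; clear; card_lia.
  pose d0 := (vset f :\: V, vset f).
  have mono e : covered L O e -> covered (d0 :: L) O e.
    by apply: covered_mono; [move=> d; rewrite inE orbC => ->|apply: danger_cons].
  have cE' e : e \in F :|: eset f -> covered (d0 :: L) O e.
    rewrite inE => /orP[/cE/mono//|ef]; have [/cE/mono//|eF] := boolP (e \in F).
    have [d2|d2] := boolP (double d0).
      by left; exists d0; rewrite ?mem_head ?d2 // (eset_sub ef).
    have d1 : single d0.
      by move: d2 N0 jN j0; rewrite /single /double /=; case: #|_ :\: _| => [|[|[|m]]] //; clear; card_lia.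
    have /subsetPn[z ze zV] : ~~ (e \subset V).
      by apply/negP => eV; have := in_set0 e; rewrite -Y0 !inE eF ef eV.
    right; apply/pred0Pn; exists z; rewrite /= ze /= /danger big_cons d1 !inE zV /=.
    by rewrite (subsetP (eset_sub ef)) ?orbT.
  exists (d0 :: L), O; split.
  - split; first by exists V; split=> //; rewrite ?subsetUl ?subsetUr ?subsetDl.
    rewrite /= adm cf eqxx !andbT /single /double /=.
    by move: N0 jN j0; case: #|_ :\: _| => [|[|[|m]]] //; clear; card_lia.
  - by split=> //; rewrite (subset_trans OV) ?subsetUl.
  - rewrite /= {1}/single /=; move: eqX cnt; case: (_ == 1) => /=; clear; card_lia.
  - split=> // d; rewrite inE => /predU1P[->|dinL d1]; last exact/mono/cI.
    rewrite /single /= => d1; apply: cE'.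
    have -> : vset f :\: (vset f :\: V) = vset f :&: V.
      by rewrite setDDr setDv set0U.
    rewrite inE; apply/orP; right; rewrite (clique_eset fi) inE subsetIl /=.
    by move: d1 jN => /eqP ->; clear; case: #|_ :&: _| => [|[|[|j]]] //; lia.
  - move=> g gi gF; have [gF0|gF0] := boolP (eset g \subset F).
      by have [|[d dL' dg]] := hg g gi gF0; [left|right; exists d; rewrite // inE dL' orbT].
    right; exists d0; rewrite ?mem_head //=.
    by have [//|[e]] := clique_new (isT : 2 < 3) FV fi (And3 gi gF gF0); rewrite Y0 inE.
have [o oY] := set0Pn _ Y0; have [oV o2] := chord_edge fi oY.
have j2 : 2 <= #|vset f :&: V| by have := subset_leq_card oV; rewrite o2.
rewrite -card_gt0 in Y0.
have Y1 : #|chords V F f| = 1.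
  by move: eqX cnt leF Y0; case: (_ == 1) => /=; clear; card_lia.
have Yo : chords V F f = [set o].
  by move/eqP: Y1 oY => /cards1P[y ->]; rewrite inE => /eqP->.
have O0 : O = set0.
  apply/eqP; case/orP: O02 => // /eqP O2; move: eqX cnt leF; rewrite O2 Y1.
  by case: (_ == 1) => /=; clear; card_lia.
have mono e : covered L O e -> covered L o e.
  by apply: covered_mono => //; rewrite /danger O0 set0U subsetUr.
have dgo : o \subset danger L o by rewrite subsetUl.
exists L, o; split.
- by split=> //; apply: demands_mono dL; rewrite subsetUl.
- by rewrite o2 eqxx orbT (subset_trans oV) // (subset_trans (subsetIr _ _)) ?subsetUl.
- by rewrite o2; move: eqX cnt; rewrite O0 cards0 Y1; case: (_ == 1) => /=; clear; card_lia.
- split=> [e|d dinL d1]; last by apply/mono/cI.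
  rewrite inE => /orP[/cE/mono//|ef]; have [/cE/mono//|eF] := boolP (e \in F).
  right; have e2 := eset_card2 (@clique_edges2 3) fi ef.
  have [eV|/subsetPn[z ze zV]] := boolP (e \subset V).
    have : e \in chords V F f by rewrite !inE eF ef.
    rewrite Yo inE => /eqP->; have /card_gt0P[w wo] : 0 < #|o| by rewrite o2.
    by apply/pred0Pn; exists w; rewrite /= wo (subsetP dgo).
  have zf : z \in vset f by rewrite (subsetP (eset_sub ef)).
  have N1 : #|vset f :\: V| = 1.
    have : 0 < #|vset f :\: V| by apply/card_gt0P; exists z; rewrite inE zV.
    by move: jN j2; clear; card_lia.
  have oE : o = vset f :&: V.
    by apply/eqP; rewrite eqEcard oV o2; move: jN; rewrite N1; clear; card_lia.
  have /card_gt0P[w] : 0 < #|e :\ z| by move: e2; rewrite (cardsD1 z) ze; clear; card_lia.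
  rewrite !inE => /andP[wz we]; have wf := subsetP (eset_sub ef) w we.
  apply/pred0Pn; exists w; rewrite /= we (subsetP dgo) // oE inE wf /=.
  apply/negPn/negP => wV; have /cards1P[y Ny] : #|vset f :\: V| == 1 by rewrite N1.
  have : z \in vset f :\: V by rewrite inE zV.
  have : w \in vset f :\: V by rewrite inE wV.
  by rewrite Ny !inE => /eqP wy /eqP zy; rewrite wy zy eqxx in wz.
move=> g gi gF; have [gF0|gF0] := boolP (eset g \subset F).
  by have [|[d dL' dg]] := hg g gi gF0; [rewrite O0 eqxx|right; exists d].
left; rewrite -card_gt0 o2 /=.
have [fg|[e eY eg]] := clique_new (isT : 2 < 3) FV fi (And3 gi gF gF0).
  by rewrite (subset_trans oV) // (subset_trans (subsetIl _ _)).
by move: eY; rewrite Yo inE => /eqP <-.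
Qed.

Lemma demands_fst_inj V L d d' x : demands V L -> d \in L -> d' \in L ->
  x \in d.1 -> x \in d'.1 -> d = d'.
Proof.
elim: L V => // -[N D] L IH V [V' [dL VV dN ND DV]].
have old c : c \in L -> x \in c.1 -> x \in N -> False.
  move=> cL xc xN; have [c12 cV] := demands_sub dL cL.
  by have := disjointFr dN xN; rewrite (subsetP cV) // (subsetP c12).
rewrite !inE => /predU1P[->|dinL] /predU1P[->|d'inL] //= xd xd'.
- by case: (old d').
- by case: (old d).
- exact: IH dL dinL d'inL xd xd'.
Qed.

Lemma triangle_demands_card V L (P : pred ({set T} * {set T})) :
  demands V L -> all (fun d => (single d || double d) && (#|d.2| == 3)) L -> has P L ->
  \sum_(d <- L | P d) #|d.1| < #|\bigcup_(d <- L | P d) d.2|.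
Proof.
move=> dL adm; have := demands_filter P dL; rewrite has_filter -[\sum_(d <- L | P d) _]big_filter -[\bigcup_(d <- L | P d) _]big_filter.
have : all (fun d => (single d || double d) && (#|d.2| == 3)) (filter P L).
  by apply/allP => d; rewrite mem_filter => /andP[_ /(allP adm)].
case: (filter P L) => // d L' adm' dL' _; apply: leq_trans (demands_card dL').
rewrite -addn1 leq_add2l subn_gt0.
by have := allP adm' (last d L') (mem_last _ _); rewrite /single /double; lia.
Qed.

(** If [danger] is empty, every triangle has two new vertices and the pairs exist. Otherwise Waiter
    offers all of [danger], at most three vertices and so allowed by [2 <= b]; only triangles
    avoiding his share of it still need a pair. *)
Lemma built_triangle_waiter V F (H : {set {set T}}) :
  built EK V F -> 2 * #|F| <= 3 * #|V| ->
  (forall A, A \in H -> exists g : {ffun 'I_3 -> T}, [/\ injective g, eset g \subset F & A = vset g]) ->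
  waiter_wins b H V set0.
Proof.
move=> bVF leF HF.
have [L [O [[dL adm] [OV O02] cnt [_ cI] hg]]] := built_triangle_demands bVF leF.
have b0 : 0 < b by apply: ltnW.
have dbl d : d \in L -> single d = ~~ double d.
  by move=> /(allP adm) /andP[]; rewrite /single /double; case: #|d.1| => [|[|[|m]]].
have d23 d : d \in L -> #|d.2| = 3 by move=> /(allP adm)/andP[_ /eqP].
have sumP (P : pred ({set T} * {set T})) : (forall d, P d -> double d) ->
    \sum_(d <- L | P d) #|d.1| = 2 * count P L.
  move=> PD; rewrite -sum1_count big_distrr /=; apply: eq_bigr => d /PD.
  by rewrite muln1 => /eqP.
have hallD (P : pred ({set T} * {set T})) : (forall d, P d -> double d) -> has P L ->
    2 * count P L < #|\bigcup_(d <- L | P d) d.2|.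
  by move=> PD hP; rewrite -sumP //; apply: triangle_demands_card dL adm hP.
have singW d : d \in L -> single d -> d.1 \subset danger L O.
  move=> dinL d1; rewrite /danger; apply/subsetP => z zd; rewrite inE; apply/orP; right.
  by apply/bigcup_seqP; exists d; rewrite ?dinL.
have [D0|D0] := eqVneq (danger L O) set0.
  have O0 : O = set0 by apply/eqP; rewrite -subset0 -D0 subsetUl.
  have nosing d : d \in L -> double d.
    move=> dinL; apply/negPn/negP; rewrite -dbl // => d1.
    by have := singW d dinL d1; rewrite D0 subset0 -cards_eq0 (eqP d1).
  apply: (@waiter_wins_pairs _ _ _ [set d.2 | d in L]) => //.
  - by move=> D /imsetP[d dinL ->]; have [] := demands_sub dL dinL.
  - apply: hall_seq => P; pose P' := [pred d | P d && double d].
    have eqP' : {in L, P =1 P'} by move=> d /nosing /= ->; rewrite andbT.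
    rewrite (eq_in_count eqP') big_seq_cond (eq_bigl (fun d => (d \in L) && P' d)); last first.
      by move=> d; case: (boolP (d \in L)) => //= /eqP'.
    rewrite -big_seq_cond; have [hP|noP] := boolP (has P' L).
      by apply/ltnW/hallD => // d /andP[].
    by move: noP; rewrite has_count -leqNgt leqn0 => /eqP->.
  - move=> A /HF[g [gi gF ->]]; have [|[d dinL dg]] := hg g gi gF; first by rewrite O0 eqxx.
    by right; exists d.2 => //; apply: imset_f.
have leD : #|danger L O| <= 3.
  have leW : #|\bigcup_(d <- L | single d) d.1| <= count single L.
    elim: (L) => [|d L' IHL]; first by rewrite big_nil cards0.
    rewrite big_cons /=; case: ifP => //= d1; rewrite (leq_trans (leq_card_setU _ _)) //.
    by rewrite leq_add // (eqP d1).
  by rewrite (leq_trans (leq_card_setU _ _)) //; move: cnt leF leW; clear; card_lia.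
have DV : danger L O \subset V.
  rewrite subUset OV; apply/subsetP => z /bigcup_seqP[d /andP[dinL _] zd].
  by have [d12 /subsetP->] := demands_sub dL dinL; rewrite // (subsetP d12).
apply: (@waiter_wins_offer_pairs _ _ b0 _ _ (danger L O)) => //.
  by rewrite card_gt0 D0 (leq_trans leD).
move=> x xD; pose alive (d : {set T} * {set T}) := [disjoint d.2 & danger L O :\ x].
pose g (d : {set T} * {set T}) := d.2 :\ x.
have aliveV d : d \in L -> alive d -> g d \subset V :\: danger L O.
  move=> dinL ad; have [_ dV] := demands_sub dL dinL.
  apply/subsetP => z; rewrite in_setD1 => /andP[zx zd]; rewrite in_setD (subsetP dV) // andbT.
  by have := disjointFr ad zd; rewrite in_setD1 zx /= => ->.
have cupg (r : seq ({set T} * {set T})) P : #|\bigcup_(d <- r | P d) d.2| <= #|\bigcup_(d <- r | P d) g d| + 1.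
  rewrite addnC -(cards1 x) (leq_trans _ (leq_card_setU _ _)) // subset_leq_card //.
  apply/subsetP => z /bigcup_seqP[d dinr zd]; rewrite in_setU in_set1.
  have [//|zx] := eqVneq z x; apply/bigcup_seqP; exists d => //; by rewrite in_setD1 zx.
have hallg (P : pred ({set T} * {set T})) : (forall d, P d -> double d) ->
    2 * count P L <= #|\bigcup_(d <- L | P d) g d|.
  move=> PD; have [hP|noP] := boolP (has P L).
    by have := hallD P PD hP; have := cupg L P; clear; card_lia.
  by move: noP; rewrite has_count -leqNgt leqn0 => /eqP->.
have aliveA A : A \in H -> [disjoint A & danger L O :\ x] ->
    exists2 d, (d \in L) && alive d & d.2 \subset A.
  move=> /HF[h [hi hF ->]] dA; have [/andP[O0 Oh]|[d dinL dg]] := hg h hi hF; last first.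
    by exists d => //; rewrite dinL /alive (disjointWl dg).
  have : 0 < #|O :\ x|.
    case/orP: O02 => [/eqP O00|/eqP]; first by rewrite O00 eqxx in O0.
    by rewrite (cardsD1 x); case: (x \in O); clear; card_lia.
  case/card_gt0P => z; rewrite in_setD1 => /andP[zx zO].
  by have := disjointFr dA (subsetP Oh z zO); rewrite in_setD1 zx inE zO.
have single_x d : d \in L -> alive d -> single d -> d.1 = [set x].
  move=> dinL ad d1; have [d12 _] := demands_sub dL dinL.
  have /cards1P[y dy] := d1; rewrite dy; congr [set _].
  have yd : y \in d.1 by rewrite dy set11.
  have := disjointFr ad (subsetP d12 y yd).
  by rewrite in_setD1 (subsetP (singW d dinL d1)) // andbT => /negbFE/eqP.
have [/hasP[d0 d0L /andP[ad0 s0]]|nosing] := boolP (has (predI alive single) L); last first.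
  pose L2 := [seq d <- L | double d && alive d].
  exists [set g d | d in L2]; split.
  - by move=> D /imsetP[d]; rewrite mem_filter => /andP[/andP[_ ad] dinL] ->; apply: aliveV.
  - apply: hall_seq => P; pose P' := [pred d | P d && (double d && alive d)].
    rewrite count_filter (@eq_count _ _ P') // big_filter_cond (eq_bigl P') => [|d]; last by rewrite andbC.
    by apply: hallg => d /andP[_ /andP[]].
  - move=> A AH /(aliveA A AH)[d /andP[dinL ad] dA]; exists (g d).
      apply: imset_f; rewrite mem_filter dinL ad !andbT; apply/negPn; rewrite -dbl //.
      by apply: contraNN nosing => d1; apply/hasP; exists d; rewrite //= ad.
    by rewrite (subset_trans (subsetDl _ _)).
have d0x := single_x d0 d0L ad0 s0.
pose e0 := d0.2 :\: d0.1; have ge0 : g d0 = e0 by rewrite /g /e0 d0x.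
have [d012 _] := demands_sub dL d0L.
have ce0 : #|e0| = 2.
  by have := cardsID d0.1 d0.2; rewrite (setIidPr d012) (eqP s0) (d23 d0 d0L) -/e0; clear; card_lia.
(* [d0] is alive and [e0] omits [x], so [e0] avoids [danger] and the invariant places it inside a
   triangle [d'] with two new vertices. *)
have [[d' /andP[d'L dd'] e0d']|] := cI d0 d0L s0; last first.
  case/pred0Pn => z /= /andP[]; rewrite in_setD d0x in_set1 => /andP[zx zd] zD.
  by have := disjointFr ad0 zd; rewrite in_setD1 zx zD.
have nd0 : double d0 = false by apply/negbTE; rewrite -dbl.
(* Triangles containing [e0] are blocked by the pair given to [d0]; [R] keeps the remaining ones. *)
pose R := [pred d | [&& double d, alive d & ~~ (e0 \subset d.2)]].
exists [set g d | d in d0 :: filter R L]; split.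
- move=> D /imsetP[d]; rewrite inE mem_filter => /predU1P[->|/andP[/and3P[_ ad _] dinL]] ->;
    exact: aliveV.
- apply: hall_seq => P; pose PR := [pred d | P d && R d].
  rewrite /= big_cons count_filter (@eq_count _ _ PR) // big_filter_cond (eq_bigl PR) => [|d]; last by rewrite andbC.
  have PRd d : PR d -> double d by case/andP => _ /and3P[].
  case: ifP => Pd0; rewrite ?add0n ?add1n; last exact: hallg.
  set c := count _ _; set U := \bigcup_(d <- L | _) _.
  (* Counting [d'] as well gives at least 2c + 3 new vertices, hence a union of at least 2c + 4.
     Removing [x] and the third vertex of [d'] leaves the 2c + 2 vertices needed by [d0] and the c
     others. *)
  pose Q := [pred d | [|| d == d0, d == d' | PR d]].
  have hQ : has Q L by apply/hasP; exists d0; rewrite //= eqxx.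
  have := triangle_demands_card dL adm hQ.
  have leS : 2 * c + 3 <= \sum_(d <- L | Q d) #|d.1|.
    have : 2 * \sum_(d <- L) (PR d : nat) + \sum_(d <- L) (d == d0) + 2 * \sum_(d <- L) (d == d') <=
        \sum_(d <- L | Q d) #|d.1|.
      rewrite !big_distrr -!big_split /=.
      rewrite [leqRHS]big_mkcond /= big_seq [leqRHS]big_seq; apply: leq_sum => d dinL.
      have [->|dd0] := eqVneq d d0.
        have -> : (d0 == d') = false by apply/eqP => dd; rewrite -dd nd0 in dd'.
        by rewrite nd0 andbF (eqP s0).
      have [->|_] := eqVneq d d'; first by rewrite e0d' !andbF /= (eqP dd').
      have [hPR|/negPf hPR] := boolP (PR d); have := hPR => /= ->; rewrite //=.
      by rewrite (eqP (PRd d hPR)).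
    apply: leq_trans.
    have cnt1 (a : {set T} * {set T}) : a \in L -> 0 < \sum_(d <- L) (d == a).
      by move=> aL; rewrite (big_rem a aL) /= eqxx.
    have -> : \sum_(d <- L) (PR d : nat) = c.
      by rewrite /c -sum1_count [RHS]big_mkcond; apply: eq_bigr => d _; case: (PR d).
    move: (cnt1 d0 d0L) (cnt1 d' d'L); clearbody c.
    by move: (\sum_(d <- L) (d == d0)) (\sum_(d <- L) (d == d')) => u v; clear; lia.
  have : \bigcup_(d <- L | Q d) d.2 \subset (g d0 :|: U) :|: (x |: (d'.2 :\: e0)).
    apply/subsetP => z /bigcup_seqP[d /andP[dinL Qd] zd]; rewrite in_setU.
    have [->|zx] := eqVneq z x; first by rewrite setU11 orbT.
    case/or3P: Qd => [/eqP dd|/eqP dd|PRz].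
    + by rewrite -dd !in_setU in_setD1 zx zd.
    + rewrite -dd !in_setU in_setD zd andbT ge0; case: (z \in e0) => //=; by rewrite !orbT.
    + by rewrite in_setU; apply/orP; left; apply/orP; right; apply/bigcup_seqP; exists d;
        rewrite ?dinL // in_setD1 zx.
  move=> /subset_leq_card; have [+ _] := leq_card_setU (g d0 :|: U) (x |: (d'.2 :\: e0)).
  have : #|x |: (d'.2 :\: e0)| <= 2.
    rewrite (leq_trans (leq_card_setU _ _)) // cards1 cardsD (setIidPr e0d') (d23 d' d'L) ce0 //.
  move: leS; clearbody c; move: (\sum_(d <- L | Q d) #|d.1|) (#|\bigcup_(d <- L | Q d) d.2|) => u v.
  by clear; card_lia.
- move=> A AH /(aliveA A AH)[d /andP[dinL ad] dA].
  have [dd|] := boolP (double d); last first.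
    rewrite -dbl // => d1; exists (g d); last by rewrite (subset_trans (subsetDl _ _)).
    apply: imset_f; rewrite inE; apply/orP; left; apply/eqP.
    by apply: (demands_fst_inj dL dinL d0L (x := x)); rewrite ?(single_x d) ?d0x ?set11.
  have [e0d|e0d] := boolP (e0 \subset d.2).
    by exists e0; [rewrite -ge0; apply: imset_f; rewrite mem_head|apply: subset_trans dA].
  exists (g d); last by rewrite (subset_trans (subsetDl _ _)).
  by apply: imset_f; rewrite inE mem_filter /= dd ad e0d dinL orbT.
Qed.
End TriangleSolve.

(** * Exploration of a connected family of copies *)

Section Exploration.
Variables (k b : nat) (T : finType) (EK : {set {set 'I_k}}).
Notation copy := {ffun 'I_k -> T}.
Implicit Types (f g : copy) (s : seq copy) (C H : {set {set T}}).

Definition verts s : {set T} := \bigcup_(f <- s) vset f.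
Definition edges s : {set {set T}} := \bigcup_(f <- s) eset EK f.

Lemma verts_cons f s : verts (f :: s) = vset f :|: verts s.
Proof. exact: big_cons. Qed.

Lemma edges_cons f s : edges (f :: s) = eset EK f :|: edges s.
Proof. exact: big_cons. Qed.

Lemma edges_sub s e : e \in edges s -> e \subset verts s.
Proof.
elim: s => [|f s IH]; first by rewrite /edges big_nil inE.
rewrite edges_cons verts_cons inE => /orP[/eset_sub ef|/IH es].
  by rewrite (subset_trans ef) ?subsetUl.
by rewrite (subset_trans es) ?subsetUr.
Qed.

(* [path_step s f]: [f] continues the path whose last copy is the head of [s]. *)
Definition path_step s : pred copy :=
  [pred f : copy | [&& injectiveb f, #|vset f :&: verts s| == 1 &
             if s is g :: _ then vset f :&: verts s \subset vset g else false]].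

(* All explorations with [m] steps, at most [d] of which do not continue a path;
   the most recent copy comes first. *)
Fixpoint chains m d : seq (seq copy) :=
  if m is m'.+1 then
    [seq f :: s | s <- chains m' d, f <- enum (path_step s)] ++
    (if d is d'.+1 then [seq f :: s | s <- chains m' d', f <- enum [pred f : copy | injectiveb f]]
     else [::])
  else [:: [::]].

Lemma chains_path f s m d : s \in chains m d -> path_step s f -> f :: s \in chains m.+1 d.
Proof.
move=> sC fP; rewrite mem_cat; apply/orP; left; apply/allpairsPdep.
by exists s, f; rewrite mem_enum.
Qed.

Lemma chains_free f s m d : s \in chains m d -> injective f -> f :: s \in chains m.+1 d.+1.
Proof.
move=> sC fi; rewrite mem_cat; apply/orP; right; apply/allpairsPdep.
by exists s, f; rewrite mem_enum inE; split=> //; apply/injectiveP.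
Qed.

Lemma chains_mono m d d' : d <= d' -> {subset chains m d <= chains m d'}.
Proof.
elim: m d d' => [|m IH] d d' dd s //; rewrite !mem_cat => /orP[/allpairsPdep|].
  by move=> [s' [f [s'C fP ->]]]; apply/orP; left; apply/allpairsPdep; exists s', f; rewrite (IH d).
case: d dd => // d; case: d' => // d' dd /allpairsPdep[s' [f [s'C fP ->]]].
by apply/orP; right; apply/allpairsPdep; exists s', f; rewrite (IH d).
Qed.

Hypothesis k3 : 3 <= k.
Hypothesis EKstar : forall i : 'I_k, touch EK [set i] != set0.
Hypothesis EKdense : forall A : {set 'I_k}, A != setT ->
  #|EK| * #|A| + ((A != set0) && (#|A| + 2 <= k)) <= k.-1 * #|touch EK A|.
Hypothesis EKlink : forall A M : {set 'I_k}, A != set0 -> M != set0 -> [disjoint A & M] ->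
  k <= #|A| + #|M| + 1 -> exists2 e, e \in touch EK A & e \in touch EK M.
Hypothesis EKsolve : forall V (F : {set {set T}}) H, built EK V F -> k.-1 * #|F| <= #|EK| * #|V| ->
  (forall A, A \in H -> exists g, [/\ injective g, eset EK g \subset F & A = vset g]) ->
  waiter_wins b H V set0.

(** [st_free] gives [d <= 2 * excess + 2] while the excess is at most |EK|; one more step may push
    the excess beyond that. *)
Definition free_max := 2 * #|EK| + 3.

Lemma vset_edges g s : eset EK g \subset edges s -> vset g \subset verts s.
Proof.
move=> gs; apply/subsetP => z /imsetP[i _ ->].
have /set0Pn[e /touchP[eE [j je]]] := EKstar i; rewrite inE => /eqP ji; subst j.
have eg : g @: e \in edges s by rewrite (subsetP gs) ?imset_f.
by rewrite (subsetP (edges_sub eg)) ?imset_f.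
Qed.

(** Edges touching the fresh vertices pay for these by [EKdense]; if there is no fresh vertex, any
    new edge is pure gain. *)
Lemma step_cost g s : injective g -> ~~ [disjoint vset g & verts s] -> ~~ (eset EK g \subset edges s) ->
  #|EK| * #|vset g :\: verts s| + (1 < #|vset g :&: verts s|) <= k.-1 * #|eset EK g :\: edges s|.
Proof.
move=> gi gs gE; have FV e := @edges_sub s e.
have ltN := fresh_proper gi gs; have leT := leq_touch_fresh EK FV gi.
have old := card_old (verts s) gi; rewrite card_fresh //.
have [f0|f0] := eqVneq (fresh (verts s) g) set0.
  rewrite f0 cards0 muln0 add0n.
  have : 0 < #|eset EK g :\: edges s| by rewrite card_gt0 setD_eq0.
  case: #|eset EK g :\: edges s| => // m _; rewrite mulnS.
  by apply: leq_trans (leq_addr _ _); case: (1 < _) => //=; lia.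
have fT : fresh (verts s) g != setT.
  by apply: contraTneq ltN => ->; rewrite cardsT card_ord ltnn.
have := EKdense fT; rewrite f0 /= => dens.
apply: leq_trans (leq_trans dens _); last by rewrite leq_mul2l leT orbT.
rewrite leq_add2l; case: (ltnP 1 _) => //= lt1.
by rewrite (_ : #|fresh (verts s) g| + 2 <= k) //; lia.
Qed.

Section Core.
Variables (C : {set {set T}}) (cp : {set T} -> copy).
Hypothesis cpP : forall A, A \in C -> injective (cp A) /\ vset (cp A) = A.
Hypothesis C_conn : forall S : {set {set T}}, S \subset C -> S != set0 -> S != C ->
  exists A B, [/\ A \in S, B \in C :\: S & ~~ [disjoint A & B]].
Hypothesis C_twin : forall A x y, A \in C -> x \in A -> y \in A -> x != y ->
  exists B, [/\ B \in C, B != A & (x \in B) || (y \in B)].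

Definition unexplored s : {set {set T}} := [set A in C | ~~ (eset EK (cp A) \subset edges s)].

(* [excess] is the total cost of the steps; [hot] means that the last copy met the
   previous ones in at most one vertex, so that a path can be continued from it. *)
Record state (s : seq copy) (d : nat) (excess : nat) (hot : bool) : Prop := State {
  st_ne : s != [::];
  st_chain : s \in chains (size s) d;
  st_built : built EK (verts s) (edges s);
  st_core : {subset s <= [set cp A | A in C]};
  st_excess : k.-1 * #|edges s| + #|EK| = #|EK| * #|verts s| + excess;
  st_free : d <= 2 * excess + 1 + hot;
  st_size : size s + #|unexplored s| <= #|C|;
  st_hot : hot -> exists f s', s = f :: s' /\ #|vset f :&: verts s'| <= 1 }.

(** The coefficient 2 in [st_free] grants two free steps per unit of excess: one that leaves a path,
    which has at least two old vertices and so raises the excess, and one that starts the next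
    path. *)
Lemma explore_step s d u hot A : state s d u hot -> u <= #|EK| -> A \in unexplored s ->
  ~~ [disjoint A & verts s] ->
  let f := cp A in let hot' := #|vset f :&: verts s| <= 1 in
  exists d' u', [/\ d' = (if hot && path_step s f then d else d.+1), u <= u' & 
    (hot ==> ~~ hot' || path_step s f) -> state (f :: s) d' u' hot'].
Proof.
move=> [s0 sC sb sc se sf sz sh] leu; rewrite inE => /andP[AC Af] As f hot'.
have [fi fA] := cpP AC; rewrite -/f in fi fA Af; rewrite -fA in As.
have cost := step_cost fi As Af.
have [cV cF] := built_step_card f sb.
have := leq_trans (leq_addr _ _) cost.
rewrite -(leq_add2r (k.-1 * #|edges s| + #|EK|)) addnC {1}se => leu'.
pose u' := k.-1 * #|edges s :|: eset EK f| + #|EK| - #|EK| * #|verts s :|: vset f|.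
have ue : k.-1 * #|edges s :|: eset EK f| + #|EK| = #|EK| * #|verts s :|: vset f| + u' /\
          u + (1 < #|vset f :&: verts s|) <= u'.
  rewrite /u' cV cF !mulnDr; move: cost leu' se; clear.
  by move: (1 < _ : nat) => w; card_lia.
have [ue1 ue2] := ue.
exists (if hot && path_step s f then d else d.+1), u'; split=> //.
  by apply: leq_trans (leq_addr _ _) ue2.
move=> hotP; split=> //.
- by case: ifP => [/andP[_ fp]|_]; [apply: chains_path|apply: chains_free].
- by rewrite verts_cons edges_cons setUC [_ :|: edges s]setUC; apply: built_step.
- by move=> g; rewrite inE => /predU1P[->|/sc//]; apply: imset_f.
- by rewrite verts_cons edges_cons setUC [_ :|: verts s]setUC.
- move: sf ue2 hotP; rewrite /hot'; case: ifP => [/andP[-> /and3P[_ /eqP-> _]]|].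
    by rewrite addn0 /= => *; lia.
  case: (ltnP 1 #|_ :&: _|) => _ /=; first by case: (hot) => /= *; lia.
  by case: (hot) => /= [-> _ _ //|_ *]; lia.
- rewrite /= addSn -addnS (leq_trans _ sz) // leq_add2l.
  have : unexplored (f :: s) \subset unexplored s :\ A.
    apply/subsetP => B; rewrite in_setD1 inE => /andP[BC]; rewrite edges_cons => nB.
    apply/andP; split; first by apply: contraNneq nB => ->; rewrite subsetUl.
    by rewrite inE BC /=; apply: contraNN nB => Bs; rewrite (subset_trans Bs) ?subsetUr.
  by move=> /subset_leq_card; have := cardsD1 A (unexplored s); rewrite inE AC Af; clear; card_lia.
- by move=> h'; exists f, s.
Qed.

(** The last copy has two vertices new at its step, and by [C_twin] one of them lies in another
    copy. If that copy meets the explored vertices only there, it continues the path. *)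
Lemma explore_hot s d u : state s d u true -> exists A, [/\ A \in unexplored s,
  ~~ [disjoint A & verts s] & (1 < #|vset (cp A) :&: verts s|) || path_step s (cp A)].
Proof.
case=> s0 sC sb sc se sf sz /(_ isT)[f [s' [sE leo]]].
have /imsetP[A AC fA] : f \in [set cp A | A in C] by apply: sc; rewrite sE mem_head.
have [fi fvA] := cpP AC; rewrite -fA in fi fvA.
have cN : 1 < #|vset f :\: verts s'|.
  by have := cardsID (verts s') (vset f); rewrite (card_vset fi); move: leo k3; clear; card_lia.
have /card_gt1P[x [y [xN yN xy]]] := cN.
have NA z : z \in vset f :\: verts s' -> z \in A by rewrite -fvA inE => /andP[].
have [B [BC BA xyB]] := C_twin AC (NA x xN) (NA y yN) xy.
have [z zN zB] : exists2 z, z \in vset f :\: verts s' & z \in B.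
  by case/orP: xyB => ?; [exists x|exists y].
have [gi gvB] := cpP BC; set g := cp B in gi gvB *.
have zs : z \in vset g :&: verts s.
  by rewrite inE gvB zB sE verts_cons inE; move: zN; rewrite inE => /andP[_ ->].
exists B; split; last first.
- case: ltnP => //= le1; rewrite /path_step /= sE; apply/and3P; split.
  + exact/injectiveP.
  + by rewrite -sE eqn_leq le1 card_gt0; apply/set0Pn; exists z.
  + have /eqP/cards1P[w ew] : #|vset g :&: verts s| = 1.
      by apply/eqP; rewrite eqn_leq le1 card_gt0; apply/set0Pn; exists z.
    rewrite -sE ew sub1set; move: zs; rewrite ew inE => /eqP <-.
    by move: zN; rewrite inE => /andP[].
- by rewrite -gvB -setI_eq0; apply/set0Pn; exists z.
(* If [g] were explored, [EKlink] would provide an edge of [g] from a vertex new in [f] to a vertex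
   outside [f]. Such an edge lies neither in [f] nor among the earlier edges. *)
rewrite inE BC; apply/negP => gE.
pose A' : {set 'I_k} := [set i | g i \in vset f :\: verts s'].
pose M : {set 'I_k} := [set i | g i \notin vset f].
have A'0 : A' != set0.
  by move: zB; rewrite -gvB => /imsetP[i _ zi]; apply/set0Pn; exists i; rewrite inE -zi.
have dAM : [disjoint A' & M].
  by rewrite disjoints_subset; apply/subsetP => i; rewrite !inE => /andP[_ ->].
have cAM : k <= #|A'| + #|M| + 1.
  have <- : #|A' :|: M| = #|A'| + #|M| by rewrite cardsU disjoint_setI0 // cards0 subn0.
  have := cardsID (A' :|: M) [set: 'I_k]; rewrite setTI setTD cardsT card_ord => cT.
  rewrite -[leqLHS]cT leq_add2l.
  rewrite -(card_imset _ gi) (leq_trans _ leo) // subset_leq_card //.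
  apply/subsetP => w /imsetP[i]; rewrite !inE negb_or negb_and !negbK => /andP[h1 h2] ->.
  by rewrite h2 /=; case/orP: h1 => [//|]; rewrite h2.
have [M0|M0] := eqVneq M set0.
  case/negP: BA; rewrite -gvB -fvA eqEcard (card_vset fi) (card_vset gi) leqnn andbT.
  apply/subsetP => w /imsetP[i _ ->]; apply/negPn/negP => nf.
  by have := in_set0 i; rewrite -M0 inE nf.
have [e /touchP[eE [i ie iA]] /touchP[_ [j je jM]]] := EKlink A'0 M0 dAM cAM.
have := subsetP gE (g @: e); rewrite imset_f // sE edges_cons inE => /(_ isT)/orP[].
  move=> /eset_sub/subsetP/(_ (g j)); rewrite imset_f // => /(_ isT).
  by move: jM; rewrite inE => /negPf->.
move=> /edges_sub/subsetP/(_ (g i)); rewrite imset_f // => /(_ isT).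
by move: iA; rewrite !inE => /andP[/negPf->].
Qed.

(** If every copy meeting the explored vertices were explored, these copies would lie within them,
    and by [C_conn] some copy outside this set would meet one of its members. *)
Lemma explore_cold s d u hot : state s d u hot -> unexplored s != set0 ->
  exists2 A, A \in unexplored s & ~~ [disjoint A & verts s].
Proof.
case=> s0 sC sb sc se sf sz _ U0.
pose S := [set A in C | ~~ [disjoint A & verts s]].
have [/existsP[A /andP[AU As]]|noA] := boolP [exists A, (A \in unexplored s) && ~~ [disjoint A & verts s]].
  by exists A.
have Sexp A : A \in S -> A \subset verts s.
  rewrite inE => /andP[AC As]; have [_ vA] := cpP AC; rewrite -vA.
  apply: vset_edges; apply/negPn/negP => nA; case/negP: noA; apply/existsP; exists A.
  by rewrite inE AC nA.
have [SC|SC] := eqVneq S C.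
  have /set0Pn[A AU] := U0; have AC : A \in C by move: AU; rewrite inE => /andP[].
  exists A => //; move: AC; rewrite -SC inE => /andP[_].
  by [].
have S0 : S != set0.
  case: (s) s0 sc {Sexp SC noA} @S => // f s' _ sc S.
  have /imsetP[A AC fA] := sc f (mem_head _ _); have [fi fvA] := cpP AC.
  rewrite -fA in fi fvA; apply/set0Pn; exists A; rewrite inE AC /= verts_cons -fvA.
  have : 0 < #|vset f| by rewrite (card_vset fi); lia.
  by case/card_gt0P => z zf; apply/pred0Pn; exists z; rewrite /= !inE zf.
have SsubC : S \subset C by apply/subsetP => A; rewrite inE => /andP[].
have [A [B [AS]]] := C_conn SsubC S0 SC.
rewrite in_setD => /andP[BS BC] AB; case/negP: BS; rewrite inE BC.
by apply: contraNN AB => Bs; rewrite disjoint_sym (disjointWr (Sexp A AS)).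
Qed.

Lemma explore_all s d u hot : state s d u hot -> u <= #|EK| ->
  exists s' d' u' hot', state s' d' u' hot' /\ d' <= free_max /\
    (#|EK| < u' \/ u' <= #|EK| /\ unexplored s' = set0).
Proof.
have [m] := ubnP #|unexplored s|; elim: m s d u hot => // m IHm s d u hot leU st leu.
have ledm : d.+1 <= free_max.
  by have := st_free st; rewrite /free_max; move: leu; case: (hot) => /=; clear; card_lia.
have [U0|U0] := eqVneq (unexplored s) set0.
  by exists s, d, u, hot; split=> //; split; [apply: ltnW|right].
have [A [AU As hotP]] : exists A, [/\ A \in unexplored s, ~~ [disjoint A & verts s] &
    hot ==> ~~ (#|vset (cp A) :&: verts s| <= 1) || path_step s (cp A)].
  case: hot st => st; last by have [A AU As] := explore_cold st U0; exists A.
  by have [A [AU As hA]] := explore_hot st; exists A; rewrite -ltnNge.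
have [d' [u' [d'E leu' /(_ hotP) st']]] := explore_step st leu AU As.
have led' : d' <= free_max by rewrite d'E; case: ifP => // _; apply: ltnW.
have [leu2|ltu] := leqP u' #|EK|; last first.
  by exists (cp A :: s), d', u', (#|vset (cp A) :&: verts s| <= 1); split=> //; split=> //; left.
apply: (IHm _ _ _ _ _ st' leu2).
rewrite -ltnS; apply: leq_trans leU; rewrite ltnS; apply: proper_card; apply/properP; split.
  apply/subsetP => B; rewrite !inE => /andP[-> /=]; apply: contraNN => Bs.
  by rewrite edges_cons (subset_trans Bs) ?subsetUr.
by exists A => //; rewrite inE negb_and negbK edges_cons subsetUl orbT.
Qed.

Lemma explore_core A0 : A0 \in C ->
  (exists m s, [/\ m <= #|C|, s \in chains m free_max,
     {subset s <= [set cp A | A in C]} & #|EK| * #|verts s| < k.-1 * #|edges s|]) \/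
  waiter_wins b C (cover C) set0.
Proof.
move=> A0C; have [fi fA] := cpP A0C; set f := cp A0 in fi fA.
have /card_gt0P[r rf] : 0 < #|vset f| by rewrite (card_vset fi); lia.
have EK0 : EK != set0.
  have /imsetP[i _ _] := rf; have /set0Pn[e /touchP[eE _]] := EKstar i.
  by apply/set0Pn; exists e.
have st : state [:: f] 1 0 true.
  have v1 : verts [:: f] = vset f by rewrite /verts big_seq1.
  have e1 : edges [:: f] = eset EK f by rewrite /edges big_seq1.
  split=> //.
  - by apply: (@chains_free f [::] 0 0).
  (* The first copy is attached to one of its own vertices, since [built] starts from a vertex. *)
  - rewrite v1 e1; have -> : vset f = [set r] :|: vset f by apply/esym/setUidPr; rewrite sub1set.
    have -> : eset EK f = set0 :|: eset EK f by rewrite set0U.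
    apply: built_step => //; first exact: built_root.
      by apply/pred0Pn; exists r; rewrite /= rf set11.
    by rewrite subset0 -card_gt0 card_eset // card_gt0.
  - by move=> g; rewrite inE => /eqP->; apply: imset_f.
  - by rewrite v1 e1 card_vset // card_eset // addn0 addnC -mulSn mulnC prednK // (leq_trans _ k3).
  - have : unexplored [:: f] \subset C :\ A0.
      apply/subsetP => B; rewrite in_setD1 inE e1 => /andP[-> nB]; rewrite andbT.
      by apply: contraNneq nB => ->.
    by move=> /subset_leq_card; have := cardsD1 A0 C; rewrite A0C /=; clear; card_lia.
  - by move=> _; exists f, [::]; split=> //; rewrite /verts big_nil setI0 cards0.
have [s [d [u [hot [{}st [led]]]]]] := explore_all st (leq0n _).
have [ss sC sb sc se sf sz _] := st; case=> [ltu|[leu U0]]; [left|right].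
  exists (size s), s; split=> //; first by apply: leq_trans sz; apply: leq_addr.
    exact: chains_mono led _ sC.
  by move: se ltu; clear; card_lia.
apply: (waiter_wins_mono (EKsolve (H := C) sb _ _)) => //.
- by move: se leu; clear; card_lia.
- move=> A AC; have [gi gA] := cpP AC; exists (cp A); split=> //.
  by apply/negPn/negP => nA; have := in_set0 A; rewrite -U0 inE AC nA.
- apply/subsetP => z; rewrite /verts => /bigcup_seqP[g]; rewrite andbT => /sc/imsetP[A AC ->].
  by have [_ ->] := cpP AC => zA; apply/bigcupP; exists A.
- by move=> A; right.
Qed.

End Core.

(** The two reductions, by induction on |H|, leave exactly [C_conn] and [C_twin]. Copies are indexed
    by their vertex sets, so an exploration has at most #|{set T}| steps. *)
Lemma waiter_wins_sparse (G : {set {set T}}) H :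
  0 < b ->
  (forall A, A \in H -> exists g, [/\ injective g, eset EK g \subset G & A = vset g]) ->
  (forall m s, m <= #|{set T}| -> s \in chains m free_max -> edges s \subset G ->
     k.-1 * #|edges s| <= #|EK| * #|verts s|) ->
  waiter_wins b H (cover H) set0.
Proof.
move=> b0 HG sparse.
pose cpy A g := [&& injectiveb g, eset EK g \subset G & A == vset g].
have [H0|[A0 A0H]] := set_0Vmem H.
  by apply: waiter_done => A; rewrite H0 inE.
have [g0 _] := HG A0 A0H.
pose cp A := odflt g0 [pick g | cpy A g].
have {HG} cpP A : A \in H -> cpy A (cp A).
  move=> /HG[g [gi gG ->]]; rewrite /cp; case: pickP => [//|/(_ g)].
  by rewrite /cpy gG eqxx !andbT => /negP[]; apply/injectiveP.
have [m] := ubnP #|H|; elim: m H cpP {A0 A0H} => // m IHm H cpP ltH.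
have IH (S : {set {set T}}) : S \proper H -> waiter_wins b S (cover S) set0.
  move=> SH; apply: IHm; first by move=> A AS; apply: cpP; apply: (subsetP (proper_sub SH)).
  by rewrite -ltnS; apply: leq_trans ltH; rewrite ltnS proper_card.
have [/existsP[S /and4P[SH S0 SH' /forall_inP dS]]|conn] := boolP [exists S : {set {set T}},
    [&& S \subset H, S != set0, S != H &
        [forall A in S, [forall B in H :\: S, [disjoint (A : {set T}) & (B : {set T})]]]]].
  have SpH : S \proper H by rewrite properEneq SH' SH.
  have DpH : H :\: S \proper H.
    rewrite properEneq subsetDl andbT; apply: contraNneq S0 => HS; rewrite -subset0.
    by apply/subsetP => A AS; have := subsetP SH A AS; rewrite -HS inE AS.
  apply: (waiter_wins_mono (waiter_wins_cat (IH S SpH) (IH _ DpH) _)) => //.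
  - rewrite disjoints_subset; apply/subsetP => z /bigcupP[A AS zA]; rewrite inE.
    apply/bigcupP => -[B BH zB]; have := forall_inP (dS A AS) B BH.
    by move=> /disjointFr/(_ zA); rewrite zB.
  - rewrite subUset /cover; apply/andP; split; apply/bigcupsP => A AS; apply: bigcup_max AS _ || apply: (bigcup_max A) => //;
      first exact: (subsetP SH).
    by move: AS; rewrite inE => /andP[].
  - by move=> A AH; right; rewrite !inE AH andbT orbN.
have [/existsP[A /andP[AH /existsP[x /andP[xA /existsP[y /and3P[yA xy /forall_inP tw]]]]]]|twin] :=
  boolP [exists A, (A \in H) && [exists x, (x \in A) && [exists y,
    [&& y \in A, x != y & [forall B in H, (B != A) ==> (x \notin B) && (y \notin B)]]]]].
  have DpH : H :\ A \proper H by rewrite properD1.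
  have wA : waiter_wins b [set A] [set x; y] set0.
    apply: (@waiter_offer _ _ _ _ _ [set x; y]) => //; first by rewrite cards2 xy.
    move=> v vxy; apply: waiter_done => B; rewrite inE => /eqP->.
    apply/pred0Pn; case/set2P: vxy => ->; [exists y|exists x]; rewrite /= !inE eqxx ?orbT ?andbT ?yA ?xA //=.
    by rewrite eq_sym.
  apply: (waiter_wins_mono (waiter_wins_cat (IH _ DpH) wA _)) => //.
  - rewrite disjoints_subset; apply/subsetP => z /bigcupP[B]; rewrite in_setD1 => /andP[BA BH] zB.
    have /implyP/(_ BA)/andP[xB yB] := tw B BH.
    by rewrite !inE negb_or; apply/andP; split; [apply: contraNneq xB => <-|apply: contraNneq yB => <-].
  - rewrite subUset; apply/andP; split.
      by apply/bigcupsP => B; rewrite in_setD1 => /andP[_ BH]; apply: (bigcup_max B).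
    by apply/subsetP => z; rewrite !inE => /orP[]/eqP->; apply/bigcupP; exists A.
  - by move=> B BH; right; rewrite !inE BH andbT orNb.
have [H0|[A0 A0H]] := set_0Vmem H.
  by apply: waiter_done => A; rewrite H0 inE.
have [|||[m' [s [lem sC sub lt]]]|//] := @explore_core H cp _ _ _ A0 A0H.
- by move=> A /cpP/and3P[/injectiveP ? _ /eqP <-].
- move=> S SH S0 SH'; move: conn; rewrite negb_exists => /forallP/(_ S); rewrite SH S0 SH' /=.
  rewrite negb_forall => /existsP[A]; rewrite negb_imply => /andP[AS].
  rewrite negb_forall => /existsP[B]; rewrite negb_imply => /andP[BS AB].
  by exists A, B.
- move=> A x y AH xA yA xy; move: twin; rewrite negb_exists => /forallP/(_ A); rewrite AH /=.
  rewrite negb_exists => /forallP/(_ x); rewrite xA /= negb_exists => /forallP/(_ y).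
  rewrite yA xy /= negb_forall => /existsP[B]; rewrite !negb_imply negb_and !negbK.
  by case/and3P => BH BA xyB; exists B.
have sG : edges s \subset G.
  apply/subsetP => e /bigcup_seqP[f]; rewrite andbT => /sub/imsetP[A AH ->].
  by move: e; apply/subsetP; have /and3P[] := cpP A AH.
by have := sparse _ _ (leq_trans lem (max_card _)) sC sG; rewrite leqNgt lt.
Qed.
End Exploration.

(** * Elementary bounds for counting explorations *)

Lemma bin_le_exp2 n t : 'C(n, t) <= 2 ^ n.
Proof.
elim: n t => [|n IH] [|t]; rewrite ?bin0 ?expn_gt0 // binS expnS mul2n -addnn.
by rewrite leq_add.
Qed.

(** (m+1)^t is at most the falling factorial of m+t, that is t! times a binomial coefficient. It
    makes the polynomial cost of free steps at most a constant times 2^m. *)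
Lemma exp_le_exp2 m t : m.+1 ^ t <= t`! * 2 ^ t * 2 ^ m.
Proof.
have : m.+1 ^ t <= (m + t) ^_ t.
  elim: t => // t IH; rewrite expnS addnS ffactSS leq_mul //.
  by rewrite ltnS leq_addr.
move=> /leq_trans; apply; rewrite -bin_ffact mulnC -mulnA -expnD addnC.
by rewrite leq_mul2l [t + m]addnC bin_le_exp2 orbT.
Qed.

Lemma chains_size (k : nat) (T : finType) m d (s : seq {ffun 'I_k -> T}) : s \in chains k T m d ->
  size s = m /\ forall f, f \in s -> injective f.
Proof.
elim: m d s => [|m IH] d s; first by rewrite inE => /eqP->.
rewrite mem_cat => /orP[/allpairsPdep[s' [f [s'C]]]|].
  rewrite mem_enum => /and3P[/injectiveP fi _ _] ->; have [<- hs] := IH _ _ s'C.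
  by split=> // g; rewrite inE => /predU1P[->//|/hs].
case: d => // d /allpairsPdep[s' [f [s'C]]]; rewrite mem_enum => /injectiveP fi ->.
have [<- hs] := IH _ _ s'C.
by split=> // g; rewrite inE => /predU1P[->//|/hs].
Qed.

Lemma card_verts (k : nat) (T : finType) (s : seq {ffun 'I_k -> T}) : #|verts s| <= k * size s.
Proof.
elim: s => [|f s IH]; first by rewrite /verts big_nil cards0.
rewrite verts_cons (leq_trans (leq_card_setU _ _)) //= mulnS leq_add //.
by rewrite (leq_trans (leq_imset_card _ _)) // cardsT card_ord.
Qed.

(** * Strategies for both players *)

(** A round removes at most [b.+1] free vertices and gives Client one, so [b.+1 * #|C| + #|U|] never
    decreases, whatever he picks. *)
Lemma client_wins_everywhere (h n b fuel : nat) (EH : {set {set 'I_h}}) (EG : {set {set 'I_n}})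
    (C U : {set 'I_n}) :
  (forall C' : {set 'I_n}, n <= b.+1 * #|C'| -> has_copy EH EG C') ->
  [disjoint C & U] -> n <= b.+1 * #|C| + #|U| -> #|U| <= fuel ->
  client_wins b EH EG fuel C U.
Proof.
move=> copies; elim: fuel C U => [|fuel IH] C U dCU leC leU /=.
  by apply: copies; move: leU leC; rewrite leqn0 => /eqP->; rewrite addn0.
case: eqP => [U0|/eqP U0]; first by apply: copies; move: leC; rewrite U0 cards0 addn0.
apply/forallP => S; apply/implyP => /and3P[SU S0 Sb].
have /card_gt0P[v vS] := S0; apply/existsP; exists v; rewrite vS /=.
have cU := cardsID S U; rewrite (setIidPr SU) in cU.
have vC : v \notin C by apply: contraTN vS => vC; apply/negP => /(subsetP SU); rewrite (disjointFr dCU).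
apply: IH.
- rewrite disjoints_subset; apply/subsetP => z; rewrite !inE => /predU1P[->|zC]; first by rewrite vS.
  by rewrite (disjointFr dCU zC) andbF.
- by rewrite (leq_trans leC) // cardsU1 vC add1n mulnS -cU addnA leq_add2r addnC leq_add2r.
- by rewrite -ltnS (leq_trans _ leU) // -cU -add1n leq_add2r.
Qed.

(* [gp_dense] is what makes the excess of an exploration monotone: [A] is the set of
   vertices of the pattern sent to new vertices, so the strict gain occurs when a copy
   has at least two old vertices. *)
Record good_pattern (k b : nat) (EK : {set {set 'I_k}}) : Prop := GoodPattern {
  gp_card2 : forall e, e \in EK -> #|e| = 2;
  gp_star : forall i : 'I_k, touch EK [set i] != set0;
  gp_dense : forall A : {set 'I_k}, A != setT ->
    #|EK| * #|A| + ((A != set0) && (#|A| + 2 <= k)) <= k.-1 * #|touch EK A|;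
  gp_link : forall A M : {set 'I_k}, A != set0 -> M != set0 -> [disjoint A & M] ->
    k <= #|A| + #|M| + 1 -> exists2 e, e \in touch EK A & e \in touch EK M;
  gp_solve : forall (T : finType) V (F H : {set {set T}}), built EK V F ->
    k.-1 * #|F| <= #|EK| * #|V| ->
    (forall A, A \in H -> exists g : {ffun 'I_k -> T},
       [/\ injective g, eset EK g \subset F & A = vset g]) ->
    waiter_wins b H V set0 }.

Lemma cycle_good_pattern k b : 4 <= k -> 0 < b -> good_pattern b (cycle_edges k).
Proof.
move=> k4 b0; have k3 : 3 <= k := ltnW k4; split.
- exact: cycle_edges2.
- by move=> i; rewrite -card_gt0 cycle_touch1.
- move=> A AT; rewrite card_cycle_edges //; have [->|A0] := eqVneq A set0.
    by rewrite cards0 muln0.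
  have := cycle_expand k3 A0 AT; have : #|A| < k.
    by rewrite -[k in ltnRHS]card_ord -cardsT proper_card // properT.
  move: (#|A|) (#|touch _ _|) => a t; clear - k4 => ak lt; rewrite /=.
  have : k.-1 * a.+1 <= k.-1 * t by rewrite leq_mul2l lt orbT.
  have : k.-1 * a.+1 + a = k * a + k.-1 by nia.
  by case: (leqP (a + 2) k) => /=; lia.
- exact: cycle_link.
- move=> T V F H bVF; rewrite card_cycle_edges //; exact: built_cycle_waiter.
Qed.

Lemma clique_good_pattern k b : 0 < b -> 4 <= k \/ k = 3 /\ 2 <= b -> good_pattern b (clique_edges k).
Proof.
move=> b0 kb; have k3 : 3 <= k by case: kb => [/ltnW|[->]].
have cE := card_clique_edges k; split.
- exact: clique_edges2.
- by move=> i; rewrite -card_gt0 clique_touch1; lia.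
- move=> A AT; have := clique_touch A; have := cardsC A; rewrite card_ord.
  have : 0 < #|~: A| by rewrite card_gt0; apply: contraNneq AT => A0; rewrite -[A]setCK A0 setC0.
  have [->|A0] := eqVneq A set0; first by rewrite cards0 muln0.
  move: A0; rewrite -card_gt0; move: cE.
  move: (#|A|) (#|~: A|) (#|touch _ _|) (#|clique_edges k|) => a c t e; clear - k3.
  move=> cE a0 c0 ac ht; rewrite /= -(@leq_pmul2l 2) // mulnDr mulnA cE mulnCA.
  have -> : 2 * t = a * (k + c.-1) by nia.
  rewrite -ac; case: c c0 ac {ht} => // c _ ac /=.
  have -> : a + c.+1 = k by [].
  have -> : k.-1 = a + c by lia.
  case: leqP => /= h; nia.
- move=> A M /set0Pn[a aA] /set0Pn[m mM] dAM _.
  have am : a != m by apply: contraTneq aA => ->; rewrite (disjointFl dAM).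
  have eE : [set a; m] \in clique_edges k by rewrite clique_edgesP cards2 am.
  by exists [set a; m]; apply/touchP; split=> //; [exists a|exists m]; rewrite ?set21 ?set22.
- move=> T V F H bVF leF; have {}leF : 2 * #|F| <= k * #|V|.
    have k10 : 0 < k.-1 by rewrite -subn1 subn_gt0 (leq_trans _ k3).
    by rewrite -(leq_pmul2l k10) mulnCA [leqRHS]mulnA [k.-1 * k]mulnC -cE -[leqRHS]mulnA leq_pmul2l.
  case: kb => [k4|[k33 b2]]; first exact: built_clique_waiter.
  subst k; exact: built_triangle_waiter.
Qed.

(** * The pattern inside the given graph *)

Section Copies.
Variables (h k : nat) (EH : {set {set 'I_h}}).

Lemma clique_embedding (W : {set 'I_h}) (F : {set {set 'I_h}}) : is_clique k W F -> F \subset EH ->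
  exists2 phi : 'I_k -> 'I_h, injective phi & forall e, e \in clique_edges k -> phi @: e \in EH.
Proof.
case=> cW FE FH; subst k; exists (fun i => enum_val i); first exact: enum_val_inj.
move=> e; rewrite clique_edgesP => e2; apply: (subsetP FH); rewrite FE inE.
rewrite card_imset; last exact: enum_val_inj.
by rewrite e2 andbT; apply/subsetP => z /imsetP[i _ ->]; apply: enum_valP.
Qed.

Lemma cycle_embedding (W : {set 'I_h}) (F : {set {set 'I_h}}) : is_cycle k W F -> F \subset EH ->
  exists2 phi : 'I_k -> 'I_h, injective phi & forall e, e \in cycle_edges k -> phi @: e \in EH.
Proof.
case=> f [fi [_ FE]] FH; exists f => // e /imsetP[i _ ->]; apply: (subsetP FH).
by rewrite imsetU1 imset_set1 FE; apply: imset_f.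
Qed.

Lemma card_clique (W : {set 'I_h}) (F : {set {set 'I_h}}) : is_clique k W F ->
  #|W| = k /\ #|F| = #|clique_edges k|.
Proof.
case=> cW ->; split=> //.
have := card_pairs_of W; have := card_clique_edges k; rewrite cW => <-.
by move=> /eqP; rewrite eqn_pmul2l // => /eqP.
Qed.

Lemma card_cycle (W : {set 'I_h}) (F : {set {set 'I_h}}) : 3 <= k -> is_cycle k W F ->
  #|W| = k /\ #|F| = #|cycle_edges k|.
Proof.
move=> k3 [f [fi [-> ->]]]; rewrite card_imset // cardsT card_ord; split=> //.
have -> : [set [set f i; f (ordS i)] | i : 'I_k] = [set f @: (e : {set 'I_k}) | e in cycle_edges k].
  apply/setP => e; apply/imsetP/imsetP => [[i _ ->]|[c /imsetP[i _ ->] ->]].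
    by exists [set i; ordS i]; [apply: imset_f|rewrite imsetU1 imset_set1].
  by exists i; rewrite // imsetU1 imset_set1.
by rewrite card_imset //; apply: imset_inj.
Qed.
End Copies.

Lemma cycle3_clique : cycle_edges 3 = clique_edges 3.
Proof.
apply/eqP; rewrite eqEcard; apply/andP; split.
  by apply/subsetP => e /(cycle_edges2 (isT : 2 < 3)) e2; rewrite clique_edgesP e2.
by rewrite card_cycle_edges //; have := card_clique_edges 3; lia.
Qed.

Lemma waiter_beats_sparse (h n k b : nat) (EH : {set {set 'I_h}}) (EK : {set {set 'I_k}})
    (EG : {set {set 'I_n}}) (phi : 'I_k -> 'I_h) :
  3 <= k -> 0 < b -> good_pattern b EK -> injective phi ->
  (forall e, e \in EK -> phi @: e \in EH) ->
  (forall m s, m <= #|{set 'I_n}| -> s \in chains k 'I_n m (free_max EK) ->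
     edges EK s \subset EG -> k.-1 * #|edges EK s| <= #|EK| * #|verts s|) ->
  is_client_win b EH EG = false.
Proof.
move=> k3 b0 [EK2 EKs EKd EKl EKsol] phii phiE sparse.
pose H := [set vset g | g : {ffun 'I_k -> 'I_n} & injectiveb g && (eset EK g \subset EG)].
have HP A : A \in H -> exists g : {ffun 'I_k -> 'I_n}, [/\ injective g, eset EK g \subset EG & A = vset g].
  by case/imsetP => g; rewrite inE => /andP[/injectiveP gi gE] ->; exists g.
have wH := waiter_wins_sparse k3 EKs EKd EKl (EKsol 'I_n) b0 HP sparse.
apply: (waiter_wins_client_loses _ wH); rewrite ?subsetT //.
- move=> C /existsP[f /and3P[/injectiveP fi /forallP fC /forall_inP fE]].
  pose g := [ffun i => f (phi i)].
  have gi : injective g by move=> i j; rewrite !ffunE => /fi/phii.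
  exists (vset g); last by apply/subsetP => z /imsetP[i _ ->]; rewrite ffunE.
  apply/imsetP; exists g => //; rewrite inE; apply/andP; split; first exact/injectiveP.
  apply/subsetP => z /imsetP[e eE ->].
  have -> : g @: e = f @: (phi @: e).
    by rewrite -imset_comp; apply: eq_imset => i; rewrite /= ffunE.
  by apply: fE; apply: phiE.
- by rewrite disjoints_subset sub0set.
- by rewrite disjoints_subset sub0set.
- by rewrite cardsT card_ord.
Qed.

Lemma pattern_of_subgraph (h k b : nat) (EH : {set {set 'I_h}}) (W : {set 'I_h}) (F : {set {set 'I_h}}) :
  0 < b -> 4 <= k \/ k = 3 /\ 2 <= b -> is_subgraph EH W F -> is_clique k W F \/ is_cycle k W F ->
  exists (EK : {set {set 'I_k}}) (phi : 'I_k -> 'I_h),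
    [/\ good_pattern b EK, injective phi, forall e, e \in EK -> phi @: e \in EH & #|W| = k /\ #|F| = #|EK|].
Proof.
move=> b0 kb /andP[FH _]; have k3 : 3 <= k by case: kb => [/ltnW|[->]].
case=> [cl|cy].
  have [phi phii phiE] := clique_embedding cl FH; exists (clique_edges k), phi.
  by split=> //; [apply: clique_good_pattern|apply: card_clique].
have [phi phii phiE] := cycle_embedding cy FH.
case: (kb) => [k4|[k33 _]].
  by exists (cycle_edges k), phi; split=> //; [apply: cycle_good_pattern|apply: card_cycle].
(* A triangle counts as a clique here: the cycle strategy requires [4 <= k]. *)
subst k; rewrite cycle3_clique in phiE; exists (clique_edges 3), phi.
split=> //; [exact: clique_good_pattern|].
by have [cW cF] := card_cycle k3 cy; rewrite cF cycle3_clique.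
Qed.

(** * Random subsets and Janson's inequality *)

Import Order.TTheory GRing.Theory Num.Theory.
Local Open Scope ring_scope.

Section RandomSubset.
Variables (R : realFieldType) (T : finType) (p : R).
Implicit Types (A B S : {set T}) (f g : {set T} -> R).

Definition expect A f : R :=
  \sum_(S in powerset A) p ^+ #|S| * (1 - p) ^+ (#|A| - #|S|) * f S.

Lemma expect_set0 f : expect set0 f = f set0.
Proof.
by rewrite /expect powerset0 big_set1 cards0 subnn !expr0 !mul1r.
Qed.

Lemma expect_setU1 a A f : a \notin A ->
  expect (a |: A) f = p * expect A (fun S => f (a |: S)) + (1 - p) * expect A f.
Proof.
move=> aA; rewrite /expect (bigID (fun S : {set T} => a \in S)) /=.
have cA : #|a |: A| = #|A|.+1 by rewrite cardsU1 aA.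
congr (_ + _); rewrite big_distrr /=.
  rewrite (reindex_onto (fun S => a |: S) (fun S => S :\ a)) /=; last first.
    by move=> S /andP[_ aS]; rewrite setD1K.
  apply: eq_big => [S|S].
    rewrite !inE eqxx orTb andbT; apply/andP/idP => [[SA /eqP eqS]|SA].
      apply/subsetP => z zS; have := zS; rewrite -eqS !inE => /andP[za _].
      by have := subsetP SA z; rewrite !inE zS orbT (negPf za) => /(_ isT).
    by rewrite setUS // setU1K //; apply: contraNN aA; apply: (subsetP SA).
  rewrite inE => /andP[/andP[SA _] /eqP eqS].
  have aS : a \notin S by rewrite -eqS !inE eqxx.
  by rewrite cardsU1 aS cA add1n subSS exprS; ring.
apply: eq_big => [S|S /andP[SA aS]].
  rewrite !inE; apply/andP/idP => [[SA aS]|SA]; last first.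
    by rewrite (subset_trans SA) ?subsetUr //; split=> //; apply: contraNN aA; apply: (subsetP SA).
  by apply/subsetP => z zS; have := subsetP SA z zS; rewrite !inE => /predU1P[za|//]; rewrite -za zS in aS.
have SA' : S \subset A.
  move: SA; rewrite inE => SA.
  by apply/subsetP => z zS; have := subsetP SA z zS; rewrite !inE => /predU1P[za|//]; rewrite -za zS in aS.
by rewrite cA subSn ?subset_leq_card // exprS; ring.
Qed.

Lemma expectD A f g : expect A (fun S => f S + g S) = expect A f + expect A g.
Proof. by rewrite /expect -big_split /=; apply: eq_bigr => S _; rewrite mulrDr. Qed.

Lemma expectZ A c f : expect A (fun S => c * f S) = c * expect A f.
Proof. by rewrite /expect big_distrr /=; apply: eq_bigr => S _; ring. Qed.

Lemma eq_expect A f g : (forall S, S \subset A -> f S = g S) -> expect A f = expect A g.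
Proof. by move=> fg; apply: eq_bigr => S; rewrite inE => /fg->. Qed.

Lemma expectB A f g : expect A (fun S => f S - g S) = expect A f - expect A g.
Proof.
rewrite (@eq_expect A _ (fun S => f S + -1 * g S)) => [|S _]; last by rewrite mulN1r.
by rewrite expectD expectZ mulN1r.
Qed.

Lemma expect_sum (I : Type) (r : seq I) (P : pred I) A (F : I -> {set T} -> R) :
  expect A (fun S => \sum_(i <- r | P i) F i S) = \sum_(i <- r | P i) expect A (F i).
Proof.
rewrite /expect exchange_big /=; apply: eq_bigr => S _.
by rewrite big_distrr.
Qed.

Lemma expect_cst A c : expect A (fun=> c) = c.
Proof.
have [m] := ubnP #|A|; elim: m A => // m IH A.
have [->|[a aA]] := set_0Vmem A; first by rewrite expect_set0.
rewrite -(setD1K aA) cardsU1 !inE eqxx /= add1n ltnS => ltA.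
by rewrite expect_setU1 ?inE ?eqxx // !IH //; ring.
Qed.

Lemma expect_in b A f : b \in A ->
  expect A (fun S => (b \in S)%:R * f S) = p * expect A (fun S => f (b |: S)).
Proof.
move=> bA; rewrite -(setD1K bA) !expect_setU1 ?inE ?eqxx //.
rewrite (@eq_expect _ (fun S => _ * f (b |: S)) (fun S => f (b |: S))) => [|S _]; last first.
  by rewrite setU11 mul1r.
rewrite (@eq_expect _ (fun S => (b \in S)%:R * f S) (fun=> 0)) => [|S SA]; last first.
  suff /negPf-> : b \notin S by rewrite mul0r.
  by apply/negP => /(subsetP SA); rewrite !inE eqxx.
rewrite expect_cst (@eq_expect _ (fun S => f (b |: (b |: S))) (fun S => f (b |: S))) => [|S _].
  by ring.
by rewrite setUA setUid.
Qed.

Lemma expect_sub B A f : B \subset A ->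
  expect A (fun S => (B \subset S)%:R * f S) = p ^+ #|B| * expect A (fun S => f (B :|: S)).
Proof.
have [m] := ubnP #|B|; elim: m B f => // m IH B f.
have [->|[b bB]] := set_0Vmem B.
  move=> _ _; rewrite cards0 expr0 mul1r; apply: eq_expect => S _.
  by rewrite sub0set mul1r set0U.
rewrite -(setD1K bB); set B' := B :\ b; have bB' : b \notin B' by rewrite !inE eqxx.
rewrite cardsU1 bB' add1n ltnS => ltB; rewrite subUset sub1set => /andP[bA B'A].
rewrite (@eq_expect A _ (fun S => (b \in S)%:R * ((B' \subset S)%:R * f S))) => [|S _]; last first.
  by rewrite subUset sub1set mulrA -natrM mulnb.
rewrite expect_in // exprS -mulrA; congr (_ * _).
rewrite (@eq_expect A _ (fun S => (B' \subset S)%:R * f (b |: S))) => [|S _]; last first.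
  congr (_%:R * _); congr (nat_of_bool _); apply/idP/idP => [sB|sB].
    apply/subsetP => z zB; have := subsetP sB z zB; rewrite !inE => /predU1P[zb|//].
    by rewrite -zb zB in bB'.
  by rewrite (subset_trans sB) ?subsetUr.
rewrite (IH B' (fun S => f (b |: S))) //.
by congr (_ * _); apply: eq_expect => S _; rewrite setUA.
Qed.

Hypothesis p01 : 0 <= p <= 1.

Lemma expect_le A f g : (forall S, S \subset A -> f S <= g S) -> expect A f <= expect A g.
Proof.
move=> fg; apply: ler_sum => S; rewrite inE => SA; apply: ler_wpM2l (fg S SA).
by case/andP: p01 => p0 p1; rewrite mulr_ge0 ?exprn_ge0 ?subr_ge0.
Qed.

Lemma expect_ge0 A f : (forall S, S \subset A -> 0 <= f S) -> 0 <= expect A f.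
Proof. by move=> f0; rewrite -(expect_cst A 0); apply: expect_le. Qed.

Lemma expect_attained A f : exists2 S : {set T}, S \subset A & expect A f <= f S.
Proof.
have [/existsP[S /andP[SA le]]|] := boolP [exists S : {set T}, (S \subset A) && (expect A f <= f S)].
  by exists S.
rewrite negb_exists => /forallP no; exfalso.
have lt (S : {set T}) : S \subset A -> f S < expect A f.
  by move=> SA; have := no S; rewrite SA -ltNge.
pose S0 := [arg min_(S < set0 | S \subset A) (expect A f - f S)]%O.
have [] : S0 \subset A /\ forall S : {set T}, S \subset A -> expect A f - f S0 <= expect A f - f S.
  by rewrite /S0; case: arg_minP => [|S SA le]; rewrite ?sub0set.
move=> S0A S0min; have := lt S0 S0A.
have : expect A f <= expect A (fun=> f S0).
  by apply: expect_le => S SA; have := S0min S SA; lra.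
by rewrite expect_cst; lra.
Qed.
End RandomSubset.

Section Janson.
Variables (R : realFieldType) (T : finType) (p : R) (A : {set T}).
Variables (I : finType) (B : I -> {set T}) (exp : R -> R).
Hypotheses (p01 : 0 <= p <= 1) (BA : forall i, B i \subset A).
Hypotheses (exp0 : exp 0 = 1) (expD : forall x y, exp (x + y) = exp x * exp y).
Hypothesis exp_ge : forall x, 1 + x <= exp x.
Implicit Types (S : {set T}) (r : seq I).

(** These properties of the exponential suffice for Janson's inequality over any [realFieldType];
    the real exponential is substituted only in the limit statements. *)
Lemma exp_ge0 x : 0 <= exp x.
Proof. by rewrite (_ : x = x / 2 + x / 2) ?expD -?expr2 ?sqr_ge0 //; lra. Qed.

Lemma exp_mono x y : x <= y -> exp x <= exp y.
Proof.
move=> xy; rewrite (_ : y = x + (y - x)); last by lra.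
rewrite expD ler_peMr ?exp_ge0 //; apply: le_trans (exp_ge _); lra.
Qed.

Definition avoids r S : bool := all (fun i => ~~ (B i \subset S)) r.

Definition overlap (i j : I) : R := (~~ [disjoint B i & B j])%:R * p ^+ #|B i :|: B j|.

(* Conditionally on avoiding the sets of [r], the set [B i] still appears with the
   probability [p ^+ #|B i|], minus the contribution of the sets of [r] meeting it. *)
Lemma janson_step i r :
  expect p A (fun S => (avoids (i :: r) S)%:R) <=
    (1 - (p ^+ #|B i| - \sum_(j <- r) overlap i j)) * expect p A (fun S => (avoids r S)%:R).
Proof.
(* Avoiding the sets disjoint from [B i] is independent of the event that [B i] appears. *)
pose far := [seq j <- r | [disjoint B i & B j]].
set beta := _ - \sum_(_ <- _) _; set er := expect p A (fun S => (avoids r S)%:R).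
have far_ge S : (avoids r S)%:R <= (avoids far S)%:R :> R.
  rewrite ler_nat /avoids all_filter; case: (boolP (all _ r)) => // av.
  by rewrite (_ : all _ _ = true) //; apply: sub_all av => j /= ->; rewrite implybT.
have far_mono S S' : S \subset S' -> (avoids far S')%:R <= (avoids far S)%:R :> R.
  move=> SS; rewrite ler_nat; case: (boolP (avoids far S')) => // av.
  rewrite (_ : avoids far S = true) //; apply: sub_all av => j; apply: contraNN => BS.
  exact: subset_trans SS.
have far_indep S : avoids far (B i :|: S) = avoids far S.
  apply: eq_in_all => j; rewrite mem_filter => /andP[dij _]; congr (~~ _).
  apply/idP/idP => [/subsetP h|h]; last by rewrite (subset_trans h) ?subsetUr.
  apply/subsetP => z zj; have := h z zj; rewrite inE => /orP[zi|//].
  by have := disjointFr dij zi; rewrite zj.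
have er0 : 0 <= er by apply: expect_ge0 => // S _; rewrite ler0n.
have pB j : 0 <= p ^+ j by case/andP: p01 => p0 _; rewrite exprn_ge0.
have split_i : expect p A (fun S => (avoids (i :: r) S)%:R) =
    er - expect p A (fun S => (B i \subset S)%:R * (avoids r S)%:R).
  rewrite -expectB; apply: eq_expect => S _; rewrite /avoids /=.
  by case: (B i \subset S); case: (all _ r) => /=; rewrite ?mul0r ?mul1r ?mulr0 ?subr0 ?subrr.
suff le_beta : beta * er <= expect p A (fun S => (B i \subset S)%:R * (avoids r S)%:R).
  by rewrite split_i mulrBl mul1r lerB.
pose ef := expect p A (fun S => (avoids far S)%:R).
have ler_ef : er <= ef by apply: expect_le => // S _; apply: far_ge.
have le_ef : beta * ef <= expect p A (fun S => (B i \subset S)%:R * (avoids r S)%:R).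
  have pw S : (B i \subset S)%:R * (avoids far S)%:R -
      \sum_(j <- r | ~~ [disjoint B i & B j]) (B i :|: B j \subset S)%:R * (avoids far S)%:R <=
      (B i \subset S)%:R * (avoids r S)%:R :> R.
    rewrite lerBlDr; case: (boolP (B i \subset S)) => BiS; last first.
      by rewrite !mul0r add0r sumr_ge0 // => j _; rewrite -natrM ler0n.
    rewrite !mul1r; have [av|] := boolP (avoids r S).
      rewrite ler_wpDr ?lern1 ?leq_b1 //.
      by rewrite sumr_ge0 // => j _; rewrite -natrM ler0n.
    case/allPn => j jr; rewrite negbK => BjS; rewrite add0r.
    have [avf|] := boolP (avoids far S); last first.
      by move=> _; rewrite sumr_ge0 // => l _; rewrite mulr0.
    have nd : ~~ [disjoint B i & B j].
      apply/negP => dij; have := allP avf j; rewrite mem_filter dij jr => /(_ isT).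
      by rewrite BjS.
    rewrite (big_rem j jr) /= nd subUset BiS BjS mul1r ler_wpDr // sumr_ge0 // => l _.
    by rewrite mulr1 ler0n.
  apply: le_trans (expect_le p01 (fun S _ => pw S)).
  rewrite expectB expect_sum expect_sub // mulrBl lerB //.
    by rewrite (@eq_expect _ _ _ _ (fun S => (avoids far (B i :|: S))%:R)
       (fun S => (avoids far S)%:R)) // => S _; rewrite far_indep.
  rewrite mulr_suml [leRHS](bigID (fun j => ~~ [disjoint B i & B j])) /=.
  rewrite [X in _ <= _ + X]big1 ?addr0 => [|j]; last first.
    by rewrite negbK => dij; rewrite /overlap dij mulr0n !mul0r.
  (* Forcing [B i :|: B j] into the random set only makes avoidance less likely. This monotonicity
     takes the place of Harris's inequality. *)
  apply: ler_sum => j nd; rewrite expect_sub ?subUset ?BA // /overlap nd mul1r.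
  apply: ler_wpM2l => //; apply: expect_le => // S _; apply: far_mono; exact: subsetUr.
(* Replacing [ef] by the smaller [er] requires [beta] nonnegative; otherwise the left side is at
   most 0. *)
have [b0|b0] := lerP 0 beta.
  by apply: le_trans le_ef; apply: ler_wpM2l.
apply: (@le_trans _ _ 0); first by rewrite mulr_le0_ge0 // ltW.
by apply: expect_ge0 => // S _; rewrite -natrM ler0n.
Qed.

Lemma janson_seq r : uniq r ->
  expect p A (fun S => (avoids r S)%:R) <=
    exp (- (\sum_(i <- r) p ^+ #|B i| - \sum_(i <- r) \sum_(j <- r | j != i) overlap i j)).
Proof.
elim: r => [|i r IH] /= => [_|/andP[ir ur]].
  rewrite !big_nil subrr oppr0 exp0.
  by rewrite (@eq_expect _ _ _ _ _ (fun=> 1)) ?expect_cst.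
have ov0 l j : 0 <= overlap l j.
  by case/andP: p01 => p0 _; rewrite mulr_ge0 ?ler0n ?exprn_ge0.
apply: le_trans (janson_step i r) _.
set beta := _ - \sum_(_ <- _) _; set er := expect p A _ in IH *.
have er0 : 0 <= er by apply: expect_ge0 => // S _; rewrite ler0n.
apply: (@le_trans _ _ (exp (- beta) * er)).
  by apply: ler_wpM2r => //; apply: exp_ge.
apply: le_trans (ler_wpM2l (exp_ge0 _) (IH ur)) _.
rewrite -expD; apply: exp_mono; rewrite -opprD lerN2.
rewrite !big_cons eqxx /= /beta.
have ij : \sum_(j <- r | j != i) overlap i j = \sum_(j <- r) overlap i j.
  rewrite big_seq_cond [RHS]big_seq; apply: eq_bigl => j.
  by case: (boolP (j \in r)) => //= jr; apply: contraNneq ir => <-.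
rewrite ij.
have : \sum_(l <- r) \sum_(j <- r | j != l) overlap l j <=
       \sum_(l <- r) \sum_(j <- i :: r | j != l) overlap l j.
  apply: ler_sum => l _; rewrite big_cons; case: ifP => // _.
  by rewrite lerDr.
set X := \sum_(l <- r) \sum_(j <- r | _) _; set Y := \sum_(l <- r) \sum_(j <- _ :: _ | _) _.
set Z := \sum_(j <- r) overlap i j; set W := \sum_(j <- r) p ^+ _.
by lra.
Qed.

(* Keeping each set of the family with probability [q] multiplies the first sum by [q]
   and the second by [q ^+ 2]; some subfamily is at least as good as the average. *)
Lemma janson (q : R) (J : {set I}) : 0 <= q <= 1 ->
  expect p A (fun S => (~~ [exists i in J, B i \subset S])%:R) <=
    exp (- (q * \sum_(i in J) p ^+ #|B i| -
            q ^+ 2 * \sum_(i in J) \sum_(j in J | j != i) overlap i j)).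
Proof.
move=> q01.
pose val (K : {set I}) : R := \sum_(i in J) (i \in K)%:R * p ^+ #|B i| -
   \sum_(i in J) \sum_(j in J | j != i) ([set i; j] \subset K)%:R * overlap i j.
have [K KJ leK] := expect_attained q01 J val.
have eval : expect q J val = q * \sum_(i in J) p ^+ #|B i| -
            q ^+ 2 * \sum_(i in J) \sum_(j in J | j != i) overlap i j.
  rewrite /val expectB; congr (_ - _).
    rewrite expect_sum big_distrr /=; apply: eq_bigr => i iJ.
    by rewrite expect_in // expect_cst.
  rewrite expect_sum big_distrr /=; apply: eq_bigr => i iJ.
  rewrite expect_sum big_distrr /=; apply: eq_bigr => j /andP[jJ ji].
  rewrite (@expect_sub _ _ _ _ _ (fun=> overlap i j)) ?subUset ?sub1set ?iJ //.
  by rewrite expect_cst cards2 eq_sym ji.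
have vK : val K = \sum_(i <- enum K) p ^+ #|B i| -
   \sum_(i <- enum K) \sum_(j <- enum K | j != i) overlap i j.
  rewrite /val !big_enum /=; congr (_ - _).
    rewrite [LHS](bigID (fun i => i \in K)) /= [X in _ + X]big1 ?addr0 => [|i /andP[_ /negPf->]]; last by rewrite mul0r.
    apply: eq_big => i; last by case/andP => _ ->; rewrite mul1r.
    by apply/andP/idP => [[]//|iK]; rewrite iK (subsetP KJ).
  rewrite [LHS](bigID (fun i => i \in K)) /= [X in _ + X]big1 ?addr0; last first.
    by move=> i /andP[_ iK]; apply: big1 => j _; rewrite subUset sub1set (negPf iK) mul0r.
  apply: eq_big => [i|i /andP[_ iK]].
    by apply/andP/idP => [[]//|iK]; rewrite iK (subsetP KJ).
  rewrite big_enum_cond /= [LHS](bigID (fun j => j \in K)) /= [X in _ + X]big1 ?addr0; last first.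
    by move=> j /andP[_ jK]; rewrite subUset !sub1set (negPf jK) andbF mul0r.
  apply: eq_big => [j|j /andP[_ jK]]; last by rewrite subUset !sub1set iK jK mul1r.
  by apply/andP/andP => [[/andP[jJ ji] jK]|[jK ji]]; rewrite ?jK ?ji // (subsetP KJ).
apply: (@le_trans _ _ (expect p A (fun S => (avoids (enum K) S)%:R))).
  apply: expect_le => // S _; rewrite ler_nat.
  case: (boolP [exists i in J, _]) => // /existsPn no; rewrite (_ : avoids _ _ = true) //.
  apply/allP => i; rewrite mem_enum => /(subsetP KJ) iJ.
  by have := no i; rewrite iJ.
apply: le_trans (janson_seq (enum_uniq _)) _; apply: exp_mono.
by rewrite lerN2 -vK -eval.
Qed.

End Janson.

(** * Copies in every large set of vertices *)

Lemma sum_ffun_weight (R : comNzRingType) (h : nat) (T : finType) (w : T -> R) :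
  \sum_(f : {ffun 'I_h -> T}) \prod_i w (f i) = (\sum_y w y) ^+ h.
Proof. by rewrite -(bigA_distr_bigA (fun _ : 'I_h => w)) prodr_const card_ord. Qed.

Lemma sum_in_weight (R : comNzRingType) (T : finType) (V : {set T}) (a : R) :
  \sum_(y : T) (if y \in V then a else 1) = #|V|%:R * a + (#|T| - #|V|)%:R.
Proof.
rewrite (bigID (fun y => y \in V)) /= (eq_bigr (fun=> a)) => [|y ->//].
rewrite [X in _ + X](eq_bigr (fun=> 1)) => [|y /negPf->//].
rewrite !sumr_const mulr_natl; congr (_ + _%:R).
by rewrite -(cardC (mem V)) addKn; apply: eq_card => y; rewrite !inE.
Qed.

Section CopiesEverywhere.
Variables (R : realFieldType) (exp : R -> R).
Hypotheses (exp0 : exp 0 = 1) (expD : forall x y, exp (x + y) = exp x * exp y).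
Hypothesis exp_ge : forall x, 1 + x <= exp x.
Variables (h n : nat) (EH : {set {set 'I_h}}) (p : R).
Hypotheses (EH2 : forall e, e \in EH -> #|e| = 2) (n0 : (0 < n)%N).
Hypotheses (p0 : 0 < p) (p1 : p <= 1).
Notation copy := {ffun 'I_h -> 'I_n}.
Let N : R := n%:R.

Definition inner (J : {set 'I_h}) : {set {set 'I_h}} := [set e in EH | e \subset J].

Variable c : R.
Hypothesis dens : forall J, inner J != set0 -> c <= N ^+ #|J|.-1 * p ^+ #|inner J|.
Hypothesis c0 : 0 < c.
Hypothesis EH0 : EH != set0.

Let N0 : 0 < N. Proof. by rewrite ltr0n. Qed.

Definition common (f g : copy) : {set 'I_h} := [set i | f i \in vset g].

(** Shared edges lie on the common vertices J, so there are at most e(J) of them; [dens] trades the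
    missing factor p^e(J) for N^(|J|-1) / c. *)
Lemma overlap_le (f g : copy) : injective f -> injective g ->
  overlap p (eset EH) f g <= p ^+ (2 * #|EH|) * N ^+ #|common f g| / (c * N).
Proof.
move=> fi gi; rewrite /overlap; case: (boolP [disjoint _ & _]) => [_|nd].
  by rewrite mulr0n mul0r mulr_ge0 ?mulr_ge0 ?invr_ge0 ?mulr_ge0 ?exprn_ge0 // ltW.
rewrite mul1r; set J := common f g.
have subI : eset EH f :&: eset EH g \subset [set f @: (e : {set 'I_h}) | e in inner J].
  apply/subsetP => z; rewrite inE => /andP[/imsetP[e eE ->] eg]; apply: imset_f.
  rewrite inE eE; apply/subsetP => i ie; rewrite inE (subsetP (eset_sub eg)) //.
  exact: imset_f.
have leI : (#|eset EH f :&: eset EH g| <= #|inner J|)%N.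
  by rewrite (leq_trans (subset_leq_card subI)) ?leq_imset_card.
have in0 : inner J != set0.
  rewrite -card_gt0 (leq_trans _ leI) // card_gt0 setI_eq0 //.
have J0 : (0 < #|J|)%N.
  have /set0Pn[e] := in0; rewrite inE => /andP[eE eJ].
  by rewrite (leq_trans _ (subset_leq_card eJ)) // EH2.
have leE : (#|inner J| <= #|EH|)%N.
  by apply: subset_leq_card; apply/subsetP => e; rewrite inE => /andP[].
have cU : #|eset EH f :|: eset EH g| = (2 * #|EH| - #|eset EH f :&: eset EH g|)%N.
  by rewrite cardsU !card_eset // mul2n addnn.
rewrite cU; apply: (@le_trans _ _ (p ^+ (2 * #|EH| - #|inner J|))).
  by apply: ler_wiXn2l; rewrite ?leq_sub2l // ltW.
rewrite ler_pdivlMr ?mulr_gt0 // mulrCA.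
have -> : p ^+ (2 * #|EH|) * N ^+ #|J| =
    (p ^+ (2 * #|EH| - #|inner J|) * N) * (N ^+ #|J|.-1 * p ^+ #|inner J|).
  have -> : N ^+ #|J| = N * N ^+ #|J|.-1 by rewrite -exprS prednK.
  have -> : p ^+ (2 * #|EH|) = p ^+ (2 * #|EH| - #|inner J|) * p ^+ #|inner J|.
    by rewrite -exprD subnK // (leq_trans leE) // leq_pmull.
  by rewrite mulrACA [X in _ * X]mulrC.
rewrite [leLHS]mulrC.
by apply: ler_wpM2l; [rewrite mulr_ge0 ?exprn_ge0 // ltW|apply: dens].
Qed.

(** The summand is a product over the vertices of [f], each of weight N on the h vertices of [g] and
    1 elsewhere. *)
Lemma sum_common (g : copy) : injective g ->
  \sum_(f : copy) N ^+ #|common f g| <= ((h.+1)%:R * N) ^+ h.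
Proof.
move=> gi; rewrite (eq_bigr (fun f : copy => \prod_i (if f i \in vset g then N else 1))); last first.
  move=> f _; rewrite -big_mkcond prodr_const; congr (_ ^+ _).
  by apply: eq_card => i; rewrite inE.
rewrite (sum_ffun_weight h (fun y => if y \in vset g then N else 1)) sum_in_weight.
rewrite card_vset // card_ord; apply: lerXn2r.
- by rewrite nnegrE addr_ge0 ?mulr_ge0 ?ler0n // ltW.
- by rewrite nnegrE mulr_ge0 ?ler0n // ltW.
rewrite -natr1 mulrDl mul1r lerD2l /N ler_nat; exact: leq_subr.
Qed.

(** Janson's inequality for the labelled copies in [C], with mean [mu] and overlap sum at most [D],
    gives the exponent mu^2 / (4D). The powers of p cancel, leaving a constant times N. *)
Lemma no_copy_prob (C : {set 'I_n}) (a : R) : 0 <= a -> a * N ^+ h <= (#|C| ^_ h)%:R ->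
  expect p (all_edges n) (fun EG => (~~ has_copy EH EG C)%:R) <=
    exp (- (a ^+ 2 * c / (4 * (h.+1)%:R ^+ h) * N)).
Proof.
move=> a0 leA; pose K : {set copy} := [set f in ffun_on (mem C) | injectiveb f].
have Ki (f : copy) : f \in K -> injective f by rewrite inE => /andP[_ /injectiveP].
have cK : #|K| = (#|C| ^_ h)%N by rewrite card_inj_ffuns_on card_ord.
have p01 : 0 <= p <= 1 by rewrite p1 ltW.
have BA (f : copy) : f \in K -> eset EH f \subset all_edges n.
  by move=> /Ki fi; apply/subsetP => e ef; rewrite inE (eset_card2 EH2 fi ef).
pose B (f : copy) := if f \in K then eset EH f else set0.
have BA' f : B f \subset all_edges n by rewrite /B; case: ifP => [/BA//|_]; rewrite sub0set.
have -> : expect p (all_edges n) (fun EG => (~~ has_copy EH EG C)%:R) =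
    expect p (all_edges n) (fun EG => (~~ [exists f in K, B f \subset EG])%:R).
  apply: eq_expect => EG _; congr ((~~ _)%:R); apply/existsP/existsP => -[f].
    case/and3P => fi /forallP fC /forall_inP fE; exists f.
    have fK : f \in K by rewrite inE fi andbT; apply/ffun_onP.
    by rewrite fK /B fK; apply/subsetP => e /imsetP[d dE ->]; apply: fE.
  case/andP => fK; rewrite /B fK => /subsetP fE; exists f; move: fK; rewrite inE => /andP[/ffun_onP fC fi].
  rewrite fi /=; apply/andP; split; first by apply/forallP.
  by apply/forall_inP => e eE; apply: fE; apply: imset_f.
have hh0 : 0 < (h.+1)%:R ^+ h :> R by rewrite exprn_gt0 ?ltr0n.
pose D := (h.+1)%:R ^+ h * N ^+ (2 * h) * p ^+ (2 * #|EH|) / (c * N).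
pose mu : R := #|K|%:R * p ^+ #|EH|.
have mu0 : 0 <= mu by rewrite mulr_ge0 ?ler0n ?exprn_ge0 // ltW.
have cN : 0 < c * N by rewrite mulr_gt0.
have D0 : 0 < D by rewrite divr_gt0 // !mulr_gt0 ?exprn_gt0.
have leKn : #|K|%:R <= N ^+ h.
  rewrite /N -natrX ler_nat (leq_trans (max_card _)) // card_ffun !card_ord //.
have leK2 : N ^+ h * p ^+ #|EH| <= D.
  have iT : inner setT = EH by apply/setP => e; rewrite inE subsetT andbT.
  have := dens (J := setT); rewrite iT cardsT card_ord => /(_ EH0) leC.
  have h0 : (0 < h)%N.
    have /set0Pn[e /EH2 e2] := EH0.
    by have := max_card (mem e); rewrite e2 card_ord => /ltnW.
  rewrite ler_pdivlMr //; apply: (@le_trans _ _ (N ^+ (2 * h) * p ^+ (2 * #|EH|))); last first.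
    rewrite -[_ * N ^+ _ * _]mulrA ler_peMl ?mulr_ge0 ?exprn_ge0 1?ltW //.
    by rewrite -natrX ltr1n -[1%N](exp1n h) ltn_exp2r.
  have -> : N ^+ (2 * h) * p ^+ (2 * #|EH|) =
      N ^+ h * p ^+ #|EH| * ((N ^+ h.-1 * p ^+ #|EH|) * N).
    have eN : N * N ^+ h.-1 = N ^+ h by rewrite -exprS prednK.
    have -> : N ^+ h.-1 * p ^+ #|EH| * N = N ^+ h * p ^+ #|EH| by rewrite mulrAC [_ * N]mulrC eN.
    by rewrite !mul2n -!addnn !exprD mulrACA.
  by apply: ler_wpM2l; [rewrite mulr_ge0 ?exprn_ge0 // ltW|rewrite ler_pM2r].
have leMuD : mu <= D by apply: le_trans leK2; rewrite ler_wpM2r ?exprn_ge0 // ltW.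
(* The maximizer of [q * mu - q ^+ 2 * D]. It is at most 1 because [dens] for the whole vertex set
   yields [mu <= D]. *)
pose q := mu / (2 * D).
have q01 : 0 <= q <= 1.
  have D20 : 0 < 2 * D by rewrite mulr_gt0.
  rewrite /q; apply/andP; split; first by rewrite divr_ge0 // ltW.
  rewrite (ler_pdivrMr _ _ D20); apply: (le_trans leMuD).
  by rewrite mul1r; apply: ler_peMl; rewrite ?ler1n // ltW.
apply: le_trans (@janson R _ p _ _ B exp p01 BA' exp0 expD exp_ge q K q01) _.
apply: (exp_mono expD exp_ge); rewrite lerN2.
have sum1 : \sum_(f in K) p ^+ #|B f| = mu.
  rewrite (eq_bigr (fun=> p ^+ #|EH|)) => [|f fK]; last first.
    by rewrite /B fK card_eset //; apply: Ki.
  by rewrite sumr_const /mu mulr_natl.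
have sum2 : \sum_(f in K) \sum_(g in K | g != f) overlap p B f g <= D.
  have ov f g : f \in K -> g \in K -> overlap p B f g = overlap p (eset EH) f g.
    by move=> fK gK; rewrite /overlap /B fK gK.
  pose F (f g : copy) := p ^+ (2 * #|EH|) * N ^+ #|common f g| / (c * N).
  have F0 f g : 0 <= F f g by rewrite divr_ge0 ?mulr_ge0 ?exprn_ge0 ?ltW.
  apply: (@le_trans _ _ (\sum_(f in K) \sum_(g in K) F f g)).
    apply: ler_sum => f fK; rewrite [leRHS](bigID (fun g => g != f)) /= ler_wpDr //.
      by rewrite sumr_ge0.
    by apply: ler_sum => g /andP[gK _]; rewrite ov //; apply: overlap_le; apply: Ki.
  rewrite exchange_big /=; apply: (@le_trans _ _ (\sum_(g in K) (D / N ^+ h))).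
    apply: ler_sum => g gK; apply: (@le_trans _ _ (\sum_(f : copy) F f g)).
      by rewrite [leRHS](bigID (fun f => f \in K)) /= lerDl sumr_ge0.
    rewrite /F -big_distrl -big_distrr /= /D.
    have := sum_common (Ki g gK); rewrite exprMn => leS.
    have -> : (h.+1)%:R ^+ h * N ^+ (2 * h) * p ^+ (2 * #|EH|) / (c * N) / N ^+ h =
        p ^+ (2 * #|EH|) * ((h.+1)%:R ^+ h * N ^+ h) / (c * N).
      have : N ^+ h != 0 by rewrite expf_neq0 // lt0r_neq0.
      rewrite mul2n -addnn exprD; move: (N ^+ h) (p ^+ _) ((h.+1)%:R ^+ h) => x y z x0.
      by field; rewrite x0 !lt0r_neq0.
    by rewrite ler_pM2r ?invr_gt0 // ler_pM2l ?exprn_gt0.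
  rewrite sumr_const -mulr_natl mulrCA -[leRHS]mulr1 ler_pM2l //.
  by rewrite ler_pdivrMr ?mul1r ?exprn_gt0.
rewrite sum1.
apply: (@le_trans _ _ (q * mu - q ^+ 2 * D)); last first.
  by rewrite lerB // ler_wpM2l ?exprn_ge0 //; case/andP: q01.
have -> : q * mu - q ^+ 2 * D = mu ^+ 2 / (4 * D).
  by rewrite /q; field; rewrite lt0r_neq0.
have D40 : 0 < 4 * D by apply: mulr_gt0.
rewrite (ler_pdivlMr _ _ D40).
have -> : a ^+ 2 * c / (4 * (h.+1)%:R ^+ h) * N * (4 * D) = (a * N ^+ h * p ^+ #|EH|) ^+ 2.
  rewrite /D ![(2 * _)%N]mulnC !exprM; move: hh0.
  move: (N ^+ h) (p ^+ _) ((h.+1)%:R ^+ h) => x y z z0.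
  by field; rewrite !lt0r_neq0.
have pe0 : 0 <= p ^+ #|EH| by rewrite exprn_ge0 // ltW.
apply: lerXn2r.
- by rewrite nnegrE !mulr_ge0 // exprn_ge0 // ltW.
- by rewrite nnegrE.
by rewrite /mu cK; apply: ler_wpM2r.
Qed.

End CopiesEverywhere.

(** * Dense explorations are unlikely *)

Section ChainWeight.
Variables (R : realFieldType) (k n : nat) (EK : {set {set 'I_k}}) (rho : R).
Hypothesis EK2 : forall e, e \in EK -> #|e| = 2.
Hypotheses (EK0 : EK != set0) (n0 : (0 < n)%N) (k0 : (0 < k)%N).
Hypotheses (rho0 : 0 <= rho) (rho1 : (k ^ 2)%:R * rho <= 4^-1).
Notation copy := {ffun 'I_k -> 'I_n}.
Let N : R := n%:R.

Let N0 : 0 < N. Proof. by rewrite ltr0n. Qed.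

Let rho_le1 : rho <= 1.
Proof.
apply: le_trans (_ : (k ^ 2)%:R * rho <= _); last by apply: le_trans rho1 _; lra.
by rewrite ler_peMl // ler1n expn_gt0 k0.
Qed.

(** For n = y^e and p = rho * y^-(k-1), all edges of [s] appear with probability rho^|F| *
    y^-((k-1)|F|), which is at most [weight s / y] for dense [s]. *)
Definition weight (s : seq copy) : R := rho ^+ #|edges EK s| * N ^- #|verts s|.

Lemma weight_ge0 s : 0 <= weight s.
Proof. by rewrite mulr_ge0 ?exprn_ge0 // invr_ge0 exprn_ge0 // ltW. Qed.

Lemma card_ffun_in (i : 'I_k) (V : {set 'I_n}) :
  #|[set f : copy | f i \in V]|%:R = #|V|%:R * N ^+ k.-1 :> R.
Proof.
rewrite -sum1_card natr_sum big_mkcond /=.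
pose w (j : 'I_k) (y : 'I_n) : R := if j == i then (y \in V)%:R else 1.
rewrite (eq_bigr (fun f : copy => \prod_j w j (f j))) => [|f _]; last first.
  rewrite (bigD1 i) //= big1 ?mulr1 => [|j /negPf ji]; last by rewrite /w ji.
  by rewrite /w eqxx inE; case: (f i \in V).
rewrite -(bigA_distr_bigA w) (bigD1 i) //=; congr (_ * _).
  rewrite /w eqxx -sum1_card natr_sum [RHS]big_mkcond /=.
  by apply: eq_bigr => y _; case: (y \in V).
rewrite (eq_bigr (fun=> N)) => [|j /negPf ji].
  rewrite prodr_const; congr (_ ^+ _).
  by transitivity #|predC1 i|; [apply: eq_card => j; rewrite !inE|rewrite cardC1 card_ord].
rewrite /w ji sumr_const card_ord /N //.
Qed.

(** There are at most k^2 * N^(k-1) continuations: one vertex of the pattern goes to one vertex of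
    the last copy. Each multiplies the weight by at most rho * N^-(k-1). *)
Lemma weight_path s : \sum_(f <- enum (path_step s)) weight (f :: s) <= 4^-1 * weight s.
Proof.
case: s => [|g s'].
  rewrite big_seq big1 => [|f]; last by rewrite mem_enum inE /= !andbF.
  by apply: mulr_ge0; rewrite ?weight_ge0 // invr_ge0.
set s := g :: s'.
have step f : f \in path_step s -> weight (f :: s) <= rho * weight s * N ^- k.-1.
  case/and3P => /injectiveP fi /eqP c1 _.
  have cV : #|verts (f :: s)| = (#|verts s| + k.-1)%N.
    rewrite verts_cons; have := cardsUI (vset f) (verts s); rewrite c1 card_vset //.
    by move: k0; clear; card_lia.
  have cE : #|edges EK (f :: s)| = (#|edges EK s| + #|EK|)%N.
    rewrite edges_cons cardsU card_eset // (_ : _ :&: _ = set0) ?cards0 ?subn0 1?addnC //.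
    apply/setP => e; rewrite in_setI in_set0; apply/andP => -[ef es].
    have : e \subset vset f :&: verts s by rewrite subsetI (eset_sub ef) (edges_sub es).
    by move=> /subset_leq_card; rewrite c1 (eset_card2 EK2 fi ef).
  rewrite /weight cV cE !exprD invfM.
  have : rho ^+ #|EK| <= rho by rewrite ler_iXnr // card_gt0.
  have : 0 <= rho ^+ #|edges EK s| * (N ^- #|verts s| * N ^- k.-1).
    by rewrite !mulr_ge0 ?exprn_ge0 // invr_ge0 exprn_ge0 // ltW.
  move=> w0 le_rho; rewrite -mulrA mulrCA [leRHS](_ : _ = rho * (rho ^+ #|edges EK s| * (N ^- #|verts s| * N ^- k.-1))).
    exact: ler_wpM2r.
  by rewrite !mulrA.
rewrite big_enum /=; apply: (@le_trans _ _ (\sum_(f in path_step s) rho * weight s * N ^- k.-1)).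
  by apply: ler_sum.
rewrite sumr_const -[leLHS]mulr_natl.
have cP : #|path_step s|%:R <= (k ^ 2)%:R * N ^+ k.-1 :> R.
  apply: (@le_trans _ _ (\sum_(i < k) #|[set f : copy | f i \in vset g]|%:R)).
    rewrite -natr_sum ler_nat.
    have sub : path_step s \subset \bigcup_(i < k) [set f : copy | f i \in vset g].
      apply/subsetP => f /and3P[fi /eqP c1 sg].
      have /card_gt0P[z zf] : (0 < #|vset f :&: verts s|)%N by rewrite c1.
      have := zf; rewrite inE => /andP[/imsetP[i _ zi] _].
      by apply/bigcupP; exists i => //; rewrite inE -zi (subsetP sg).
    rewrite (leq_trans (subset_leq_card sub)) //.
    by apply: (big_ind2 (fun (A : {set copy}) m => #|A| <= m)%N); rewrite ?cards0 // => A a B b' ? ?;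
      apply: leq_trans (leq_card_setU _ _) _; apply: leq_add.
  rewrite (eq_bigr (fun=> #|vset g|%:R * N ^+ k.-1)) => [|i _]; last exact: card_ffun_in.
  rewrite sumr_const card_ord -[leLHS]mulr_natl mulrA expnS expn1 natrM; apply: ler_wpM2r; first by rewrite exprn_ge0 // ltW.
  rewrite ler_wpM2l ?ler0n // ler_nat (leq_trans (leq_imset_card _ _)) //.
  by rewrite cardsT card_ord.
have Nk : 0 < N ^+ k.-1 by rewrite exprn_gt0.
have w0 := weight_ge0 s.
apply: (@le_trans _ _ ((k ^ 2)%:R * N ^+ k.-1 * (rho * weight s * N ^- k.-1))).
  by apply: ler_wpM2r => //; apply: mulr_ge0; [apply: mulr_ge0|rewrite invr_ge0 ltW].
have -> : (k ^ 2)%:R * N ^+ k.-1 * (rho * weight s * N ^- k.-1) = (k ^ 2)%:R * rho * weight s.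
  by move: Nk; move: (N ^+ _) => x x0; field; rewrite lt0r_neq0.
by apply: ler_wpM2r.
Qed.

(** Summed over its possible positions, each vertex contributes at most the number of known vertices
    plus N * N^-1 = 1. New edges are ignored, as rho <= 1. *)
Lemma weight_free s : \sum_(f <- enum [pred f : copy | injectiveb f]) weight (f :: s) <=
  ((k * size s).+1 ^ k)%:R * weight s.
Proof.
pose w (y : 'I_n) : R := if y \in verts s then 1 else N^-1.
have step (f : copy) : injectiveb f -> weight (f :: s) <= weight s * \prod_i w (f i).
  move=> /injectiveP fi.
  have -> : \prod_i w (f i) = N ^- #|fresh (verts s) f|.
    rewrite /w (bigID (fun i => f i \in verts s)) /= big1 ?mul1r => [|i ->//].
    rewrite (eq_bigr (fun=> N^-1)) => [|i /negPf->//].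
    by rewrite prodr_const exprVn; congr (_ ^- _); apply: eq_card => i; rewrite !inE.
  rewrite /weight -card_fresh // -mulrA -invfM -exprD.
  have -> : #|verts (f :: s)| = (#|vset f :\: verts s| + #|verts s|)%N.
    rewrite verts_cons; have := cardsUI (vset f) (verts s); have := cardsID (verts s) (vset f).
    by clear; card_lia.
  rewrite addnC; apply: ler_wpM2r; first by rewrite invr_ge0 exprn_ge0 // ltW.
  by apply: ler_wiXn2l => //; rewrite edges_cons subset_leq_card ?subsetUr.
rewrite big_enum /=; apply: (@le_trans _ _ (\sum_(f : copy) weight s * \prod_i w (f i))).
  have w0 (f : copy) : 0 <= weight s * \prod_i w (f i).
    rewrite mulr_ge0 ?weight_ge0 // prodr_ge0 // => i _; rewrite /w; case: ifP => _ //.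
    by rewrite invr_ge0 ltW.
  rewrite [leRHS](bigID (fun f : copy => injectiveb f)) /= ler_wpDr ?sumr_ge0 //.
  by apply: ler_sum => f; apply: step.
rewrite -big_distrr /= sum_ffun_weight mulrC; apply: ler_wpM2r; first exact: weight_ge0.
rewrite natrX; apply: lerXn2r; rewrite ?nnegrE ?ler0n //.
  by apply: sumr_ge0 => y _; rewrite /w; case: ifP => _ //; rewrite invr_ge0 ltW.
have -> : \sum_y w y = N^-1 * \sum_(y : 'I_n) (if y \in verts s then N else 1).
  rewrite big_distrr /=; apply: eq_bigr => y _; rewrite /w; case: ifP => _; last by rewrite mulr1.
  by rewrite mulVf // lt0r_neq0.
rewrite sum_in_weight mulrDr mulrCA mulVf ?lt0r_neq0 // mulr1 -natr1 lerD //.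
  by rewrite ler_nat card_verts.
rewrite mulrC ler_pdivrMr // mul1r ler_nat card_ord; exact: leq_subr.
Qed.

(** The factor [m.+1] accounts for the position of each free step and closes the induction: (m+1)Q +
    Q = (m+2)Q. *)
Lemma chains_weight m d :
  \sum_(s <- chains k 'I_n m d) weight s <= 4^-1 ^+ m * ((4 * m.+1 * (k * m).+1 ^ k)%:R) ^+ d.
Proof.
elim: m d => [|m IH] d.
  rewrite /= big_seq1 expr0 mul1r /weight /edges /verts !big_nil !cards0 !expr0 invr1 mulr1.
  by rewrite muln0 exp1n muln1 -natrX ler1n expn_gt0.
rewrite /= big_cat /= big_allpairs_dep /=.
set Q : nat := ((k * m).+1 ^ k)%N; set Q' : nat := ((k * m.+1).+1 ^ k)%N.
have QQ : (Q <= Q')%N by rewrite leq_exp2r // ltnS leq_mul2l leqnSn orbT.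
have le1 : \sum_(s <- chains k 'I_n m d) \sum_(f <- enum (path_step s)) weight (f :: s) <=
    4^-1 * (4^-1 ^+ m * (4 * m.+1 * Q)%:R ^+ d).
  apply: le_trans (_ : _ <= 4^-1 * \sum_(s <- chains k 'I_n m d) weight s) _.
    by rewrite big_distrr /=; apply: ler_sum => s _; apply: weight_path.
  by rewrite ler_pM2l ?invr_gt0.
case: d le1 => [|d] le1.
  by rewrite big_nil addr0; apply: le_trans le1 _; rewrite !expr0 !mulr1 exprS.
have le2 : \sum_(s <- [seq f :: s | s <- chains k 'I_n m d, f <- enum [pred f : copy | injectiveb f]]) weight s <=
    Q%:R * (4^-1 ^+ m * (4 * m.+1 * Q)%:R ^+ d).
  rewrite big_allpairs_dep /=; apply: le_trans (_ : _ <= Q%:R * \sum_(s <- chains k 'I_n m d) weight s) _.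
    rewrite big_distrr /= big_seq [leRHS]big_seq; apply: ler_sum => s /chains_size[sz _].
    by have := weight_free s; rewrite sz.
  by rewrite ler_wpM2l ?ler0n.
apply: le_trans (lerD le1 le2) _.
rewrite !exprS; set a := 4^-1 ^+ m; set z := (4 * m.+1 * Q)%:R ^+ d.
have -> : 4^-1 * (a * ((4 * m.+1 * Q)%:R * z)) + Q%:R * (a * z) =
    4^-1 * a * ((4 * m.+2 * Q)%:R * z).
  by rewrite !natrM -[m.+2]addn2 -[m.+1]addn1 !natrD; field.
have a0 : 0 <= 4^-1 * a by rewrite mulr_ge0 ?exprn_ge0 ?invr_ge0.
apply: ler_wpM2l => //; rewrite -exprS /z.
apply: le_trans (_ : (4 * m.+2 * Q')%:R ^+ d.+1 <= _) => //.
rewrite exprS ler_pM ?ler0n ?exprn_ge0 ?ler0n // ?ler_nat ?leq_mul //.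
by apply: lerXn2r; rewrite ?nnegrE ?ler0n // ler_nat !leq_mul.
Qed.

(** Without its leading 2, this bounds the polynomial factor of [chains_weight] divided by 2^m,
    through [exp_le_exp2] with t = (k+1)d. The 2 bounds the remaining sum of 2^-m. *)
Definition chain_const d : nat := 2 * (4 ^ d * k ^ (k.+1 * d) * ((k.+1 * d)`! * 2 ^ (k.+1 * d))).

Lemma chains_weight_sum d M :
  \sum_(m < M) \sum_(s <- chains k 'I_n m d) weight s <= (chain_const d)%:R.
Proof.
pose B := (4 ^ d * k ^ (k.+1 * d) * ((k.+1 * d)`! * 2 ^ (k.+1 * d)))%N.
have leB m : ((4 * m.+1 * (k * m).+1 ^ k) ^ d <= B * 2 ^ m)%N.
  apply: (@leq_trans ((4 * (k * m.+1) ^ k.+1) ^ d)).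
    have mono a b' : (a <= b')%N -> (a ^ d <= b' ^ d)%N by case: (d) => // d' ?; rewrite leq_exp2r.
    apply: mono; rewrite expnS mulnA leq_mul //; first by rewrite leq_mul2l leq_pmull.
    by rewrite leq_exp2r // mulnS; move: k0; clear; lia.
  rewrite expnMn -expnM expnMn mulnA -!mulnA leq_mul2l; apply/orP; right.
  by rewrite leq_mul2l [(_ * (_ * 2 ^ m))%N]mulnA exp_le_exp2 orbT.
apply: (@le_trans _ _ (\sum_(m < M) B%:R * 2^-1 ^+ m)).
  apply: ler_sum => m _; apply: le_trans (chains_weight m d) _.
  have -> : 4^-1 ^+ m = 2^-1 ^+ m * 2^-1 ^+ m :> R by rewrite -exprMn -invfM -natrM.
  have -> : B%:R * 2^-1 ^+ m = 2^-1 ^+ m * 2^-1 ^+ m * (B * 2 ^ m)%:R :> R.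
    rewrite natrM natrX exprVn; have : (2 ^+ m : R) != 0 by rewrite expf_neq0 // pnatr_eq0.
    by move: (2 ^+ m) => x x0; field.
  apply: ler_wpM2l; first by rewrite mulr_ge0 ?exprn_ge0 ?invr_ge0.
  by rewrite -natrX ler_nat.
have -> : (chain_const d)%:R = B%:R * 2 :> R by rewrite mulrC -natrM.
rewrite -big_distrr /=; apply: ler_wpM2l; first exact: ler0n.
suff -> : \sum_(m < M) 2^-1 ^+ m = 2 - 2 * 2^-1 ^+ M :> R.
  by rewrite gerBl mulr_ge0 ?exprn_ge0 ?invr_ge0.
elim: M => [|M IH]; first by rewrite big_ord0 expr0; lra.
by rewrite big_ord_recr /= IH exprS; lra.
Qed.

Definition dense (s : seq copy) : bool := (#|EK| * #|verts s| < k.-1 * #|edges EK s|)%N.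

(** Density means (k-1)|F| >= e|V| + 1, and this 1 yields the factor 1/y = n^(-1/e). *)
Lemma dense_chain_prob (p y : R) d M : 0 <= p <= 1 -> 1 <= y -> N = y ^+ #|EK| ->
  p = rho * y ^- k.-1 ->
  expect p (all_edges n) (fun EG => (has (fun m => has (fun s => dense s && (edges EK s \subset EG))
     (chains k 'I_n m d)) (iota 0 M))%:R) <= (chain_const d)%:R / y.
Proof.
move=> p01 y1 Ny py; have y0 : 0 < y by apply: lt_le_trans y1.
have le_has (X : eqType) (r : seq X) (P : pred X) : (has P r)%:R <= \sum_(x <- r) (P x)%:R :> R.
  elim: r => [|x r IH]; first by rewrite big_nil.
  by rewrite big_cons /=; case: (P x) => /=; rewrite ?add0r // lerDl sumr_ge0 // => z _; rewrite ler0n.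
apply: (@le_trans _ _ (expect p (all_edges n) (fun EG => \sum_(m < M) \sum_(s <- chains k 'I_n m d)
    (dense s && (edges EK s \subset EG))%:R))).
  apply: expect_le => // EG _; apply: le_trans (le_has _ _ _) _.
  rewrite -[M in iota 0 M]subn0 -/(index_iota 0 M) big_mkord; apply: ler_sum => m _; exact: le_has.
rewrite expect_sum; apply: (@le_trans _ _ (\sum_(m < M) \sum_(s <- chains k 'I_n m d) weight s / y)); last first.
  under eq_bigr do rewrite -big_distrl /=.
  by rewrite -big_distrl /= ler_wpM2r ?invr_ge0 ?(ltW y0) // chains_weight_sum.
apply: ler_sum => m _; rewrite expect_sum big_seq [leRHS]big_seq; apply: ler_sum => s sC.
have [_ sinj] := chains_size sC.
have sA : edges EK s \subset all_edges n.
  apply/subsetP => e /bigcup_seqP[f]; rewrite andbT => /sinj fi ef.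
  by rewrite inE (eset_card2 EK2 fi ef).
have wy0 : 0 <= weight s / y by rewrite divr_ge0 ?weight_ge0 // ltW.
have [ds|_] := boolP (dense s); last first.
  by rewrite (@eq_expect _ _ _ _ _ (fun=> 0)) ?expect_cst.
rewrite (@eq_expect _ _ _ _ _ (fun EG => (edges EK s \subset EG)%:R * 1)); last by move=> EG _; rewrite mulr1.
rewrite expect_sub // expect_cst mulr1 py exprMn /weight Ny -mulrA.
apply: ler_wpM2l; first by rewrite exprn_ge0.
rewrite exprVn -!exprM -invfM -exprSr lef_pV2 ?posrE ?exprn_gt0 //.
by apply: ler_weXn2l.
Qed.
End ChainWeight.

(** * Bounds on the probability that Client wins *)

Lemma client_win_prob_le (R : realFieldType) (h n k b : nat) (EH : {set {set 'I_h}})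
    (EK : {set {set 'I_k}}) (phi : 'I_k -> 'I_h) (p rho y : R) :
  (3 <= k)%N -> (0 < b)%N -> good_pattern b EK -> injective phi ->
  (forall e, e \in EK -> phi @: e \in EH) -> (0 < n)%N ->
  0 <= p <= 1 -> 0 <= rho -> (k ^ 2)%:R * rho <= 4^-1 -> 1 <= y -> n%:R = y ^+ #|EK| ->
  p = rho * y ^- k.-1 ->
  expect p (all_edges n) (fun EG => (is_client_win b EH EG)%:R) <=
    (chain_const k (free_max EK))%:R / y.
Proof.
move=> k3 b0 gp phii phiE n0 p01 r0 r1 y1 ny py.
have k0 : (0 < k)%N by apply: leq_trans k3.
have EK0 : EK != set0.
  have /set0Pn[e /touchP[eE _]] := gp_star gp (Ordinal k0).
  by apply/set0Pn; exists e.
(* The crude range of lengths, up to 2^n, is harmless because the bound does not depend on it. *)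
apply: le_trans (dense_chain_prob (gp_card2 gp) EK0 n0 k0 r0 r1 (free_max EK) #|{set 'I_n}|.+1 p01 y1 ny py).
apply: expect_le => // EG _; rewrite ler_nat; case: hasP => [_|noD]; first by rewrite leq_b1.
rewrite (waiter_beats_sparse k3 b0 gp phii phiE) // => m s lem sC sE.
rewrite leqNgt; apply/negP => ds; apply: noD; exists m; first by rewrite mem_iota.
by apply/hasP; exists s; rewrite // /dense ds.
Qed.

Lemma ffact_ge n m : ((n - m) ^ m <= n ^_ m)%N.
Proof.
rewrite ffact_prod -[X in (_ ^ X)%N]card_ord -prod_nat_const leq_prod // => i _.
by apply: leq_sub2l; apply: ltnW.
Qed.

Lemma client_win_prob_ge (R : realFieldType) (exp : R -> R) (h n b : nat) (EH : {set {set 'I_h}}) (p c : R) :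
  exp 0 = 1 -> (forall x y, exp (x + y) = exp x * exp y) -> (forall x, 1 + x <= exp x) ->
  (forall e, e \in EH -> #|e| = 2) -> (0 < n)%N -> (2 * b.+1 * h <= n)%N -> 0 < p -> p <= 1 -> 0 < c -> EH != set0 ->
  (forall J, inner EH J != set0 -> c <= n%:R ^+ #|J|.-1 * p ^+ #|inner EH J|) ->
  1 - 2 ^+ n * exp (- ((2 * b.+1)%:R ^- h ^+ 2 * c / (4 * (h.+1)%:R ^+ h) * n%:R)) <=
    expect p (all_edges n) (fun EG => (is_client_win b EH EG)%:R).
Proof.
move=> exp0 expD exp_ge EH2 n0 lenh p0 p1 c0 EH0 dens.
have p01 : 0 <= p <= 1 by rewrite p1 ltW.
(* From |C| >= n/(b+1) and n >= 2(b+1)h follows |C| - h >= n/(2(b+1)), so [C] admits at least a *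
   n^h injective maps. *)
set a := (2 * b.+1)%:R ^- h; set E := exp _.
pose big (C : {set 'I_n}) := (n <= b.+1 * #|C|)%N.
have step C : big C -> expect p (all_edges n) (fun EG => (~~ has_copy EH EG C)%:R) <= E.
  move=> bC; apply: no_copy_prob => //; first by rewrite invr_ge0 exprn_ge0 ?ler0n.
  rewrite /a mulrC ler_pdivrMr ?exprn_gt0 ?ltr0n ?muln_gt0 //.
  rewrite -!natrX -natrM ler_nat; apply: leq_trans (leq_mul (ffact_ge _ _) (leqnn _)).
  rewrite -expnMn; case: (h) lenh => // h' lenh; rewrite leq_exp2r //.
  move: bC; rewrite /big => bC; rewrite mulnBl; apply: (@leq_trans (2 * n - n)).
    by lia.
  apply: leq_sub; last by move: lenh; clear; lia.
  by rewrite mulnCA leq_mul2l [(#|C| * _)%N]mulnC bC orbT.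
have le1 : expect p (all_edges n) (fun EG => 1 - \sum_(C | big C) (~~ has_copy EH EG C)%:R) <=
    expect p (all_edges n) (fun EG => (is_client_win b EH EG)%:R).
  apply: expect_le => // EG _; have [/existsP[C /andP[bC nC]]|noC] :=
      boolP [exists C : {set 'I_n}, big C && ~~ has_copy EH EG C].
    apply: (@le_trans _ _ 0); last exact: ler0n.
    rewrite subr_le0 (bigD1 C) //= nC lerDl sumr_ge0 // => D _; exact: ler0n.
  rewrite (_ : is_client_win b EH EG = true); last first.
    apply: client_wins_everywhere; rewrite ?cards0 ?cardsT ?card_ord ?muln0 //.
      by move=> C bC; apply: contraNT noC => nC; apply/existsP; exists C; rewrite /big bC.
    by rewrite disjoints_subset sub0set.
  by rewrite gerBl sumr_ge0 // => C _; exact: ler0n.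
apply: le_trans le1; rewrite expectB expect_cst expect_sum lerD2l lerN2.
apply: (@le_trans _ _ (\sum_(C : {set 'I_n} | big C) E)); first exact: ler_sum.
have E0 : 0 <= E by apply: exp_ge0 expD _.
apply: (@le_trans _ _ (\sum_(C : {set 'I_n}) E)).
  by rewrite [leRHS](bigID big) /= lerDl sumr_ge0.
rewrite sumr_const -[leLHS]mulr_natl (_ : #|_| = (2 ^ n)%N) ?natrX //.
by rewrite -cardsT -powersetT card_powerset cardsT card_ord.
Qed.

(** * Densities and limits *)

Lemma root_unbounded (R : archiRealFieldType) (K eps : R) (e : nat) : 0 <= K -> 0 < eps ->
  exists N : nat, forall n (y : R), (N <= n)%N -> 1 <= y -> n%:R = y ^+ e -> K / y < eps.
Proof.
move=> K0 eps0; pose z := K / eps + 1.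
have z0 : 0 < z by rewrite ltr_pwDr // divr_ge0 // ltW.
exists (Num.bound (z ^+ e)) => n y len y1 ny; have y0 : 0 < y by apply: lt_le_trans y1.
have ltzy : z < y.
  rewrite ltNge; apply/negP => yz.
  have le1 : y ^+ e <= z ^+ e by apply: lerXn2r => //; rewrite nnegrE ltW.
  have := archi_boundP (exprn_ge0 e (ltW z0)); rewrite ltNge; apply/negP; rewrite negbK.
  by rewrite (le_trans _ le1) // -ny ler_nat.
rewrite ltr_pdivrMr // mulrC -ltr_pdivrMr //; apply: lt_trans ltzy.
by rewrite ltrDl.
Qed.

(** [exp 1 >= 2] gives [exp 2 >= 4], so for kappa >= 2 each vertex contributes at most 2/4, and 2^-n
    <= 1/n. *)
Lemma exp_beats_subsets (R : realFieldType) (exp : R -> R) (kappa : R) (n : nat) :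
  exp 0 = 1 -> (forall x y, exp (x + y) = exp x * exp y) -> (forall x, 1 + x <= exp x) ->
  2 <= kappa -> (0 < n)%N -> 2 ^+ n * exp (- (kappa * n%:R)) <= n%:R^-1.
Proof.
move=> exp0 expD exp_ge k2 n0.
have e4 : exp (- 2) <= 4^-1.
  have e2 : 4 <= exp 2.
    have -> : 2 = 1 + 1 :> R by lra.
    rewrite expD; have := exp_ge 1; move: (exp 1) => z z2; nra.
  have : exp (- 2) * exp 2 = 1 by rewrite -expD addNr.
  by move: (exp_ge0 expD (- 2)) e2; move: (exp 2) (exp (- 2)) => u v v0 u4 vu; nra.
have expn m : exp (- (2 * m%:R)) = exp (- 2) ^+ m.
  elim: m => [|m IH]; first by rewrite mulr0 oppr0 exp0 expr0.
  by rewrite -[m.+1%:R]natr1 mulrDr opprD mulr1 expD IH exprSr.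
have le1 : exp (- (kappa * n%:R)) <= 4^-1 ^+ n.
  apply: (@le_trans _ _ (exp (- (2 * n%:R)))).
    by apply: (exp_mono expD exp_ge); rewrite lerN2 ler_wpM2r ?ler0n.
  rewrite expn; apply: lerXn2r; rewrite ?nnegrE ?invr_ge0 ?ler0n // exp_ge0 //.
apply: (@le_trans _ _ (2 ^+ n * 4^-1 ^+ n)).
  by rewrite ler_wpM2l ?exprn_ge0.
have -> : 2 ^+ n * 4^-1 ^+ n = (2 ^ n)%:R^-1 :> R.
  have -> : 4^-1 = 2^-1 * 2^-1 :> R by rewrite -invfM -natrM.
  by rewrite exprMn mulrA -exprMn divff ?pnatr_eq0 // expr1n mul1r exprVn natrX.
by rewrite lef_pV2 ?posrE ?ltr0n ?expn_gt0 // ler_nat ltnW // ltn_expl.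
Qed.

(** The total exponent of y is e(|J|-1) - k * e(J) >= 0, and [1 <= c] lets c^e(J) be replaced by c.
    Here [k] is one less than the number of vertices of the pattern. *)
Lemma balanced_dens (R : realFieldType) (h n k e : nat) (EH : {set {set 'I_h}}) (y p c : R) :
  1 <= y -> n%:R = y ^+ e -> 1 <= c -> c * y ^- k <= p ->
  (forall J, inner EH J != set0 -> k * #|inner EH J| <= e * #|J|.-1)%N ->
  forall J, inner EH J != set0 -> c <= n%:R ^+ #|J|.-1 * p ^+ #|inner EH J|.
Proof.
move=> y1 ny c1 cp bal J J0; have y0 : 0 < y by apply: lt_le_trans y1.
have c0 : 0 < c by apply: lt_le_trans c1.
have yk : 0 < y ^- k by rewrite invr_gt0 exprn_gt0.
have i0 : (0 < #|inner EH J|)%N by rewrite card_gt0.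
apply: (@le_trans _ _ (n%:R ^+ #|J|.-1 * (c * y ^- k) ^+ #|inner EH J|)); last first.
  rewrite ler_wpM2l ?exprn_ge0 ?ler0n //; apply: lerXn2r; rewrite ?nnegrE // ltW ?mulr_gt0 //.
  by apply: lt_le_trans cp; rewrite mulr_gt0.
rewrite exprMn ny -exprM exprVn -exprM mulrCA.
rewrite -[leLHS]mulr1; apply: ler_pM => //; first exact: ltW.
  by rewrite ler_eXnr.
by rewrite ler_pdivlMr ?exprn_gt0 // mul1r; apply: ler_weXn2l => //; apply: bal.
Qed.

Lemma le_bigRmax (I : finType) (P : pred I) (F : I -> Rdefinitions.R) j : P j ->
  Rle (F j) (\big[Rmax/R0]_(i | P i) F i).
Proof.
move=> Pj; have : j \in index_enum I by rewrite mem_index_enum.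
elim: (index_enum I) => // i r IH; rewrite inE big_cons => /predU1P[<-|/IH le].
  by rewrite Pj; apply: Rmax_l.
by case: ifP => // _; apply: Rle_trans le (Rmax_r _ _).
Qed.

Lemma density_balanced (h k e : nat) (EH : {set {set 'I_h}}) :
  (forall c, c \in EH -> #|c| = 2) -> (1 < k)%N ->
  m1_density EH = e%:R / k.-1%:R :> Rdefinitions.R ->
  forall J, inner EH J != set0 -> (k.-1 * #|inner EH J| <= e * #|J|.-1)%N.
Proof.
move=> EH2 k1 m1E J J0.
have J2 : (2 <= #|J|)%N.
  have /set0Pn[c] := J0; rewrite inE => /andP[cE cJ].
  by have := subset_leq_card cJ; rewrite EH2.
have sub : is_subgraph EH J (inner EH J).
  apply/andP; split; first by apply/subsetP => c; rewrite inE => /andP[].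
  by apply/forall_inP => c; rewrite inE => /andP[].
have := @le_bigRmax _ (fun WF => is_subgraph EH WF.1 WF.2 && (2 <= #|WF.1|)%N)
  (fun WF => d1_density WF.1 WF.2) (J, inner EH J).
rewrite /= sub J2 => /(_ isT); rewrite -/(m1_density EH) m1E => /RleP.
have -> : d1_density J (inner EH J) = #|inner EH J|%:R / #|J|.-1%:R :> Rdefinitions.R.
  rewrite /d1_density RdivE RminusE !INRE; congr (_ / _).
  by rewrite -[in LHS](prednK (ltnW J2)) -natr1 addrK.
have k10 : 0 < k.-1%:R :> Rdefinitions.R by rewrite ltr0n; case: (k) k1 => [|[]].
have j10 : 0 < #|J|.-1%:R :> Rdefinitions.R by rewrite ltr0n; case: #|J| J2 => [|[]].
rewrite ler_pdivlMr // mulrAC ler_pdivrMr // -!natrM ler_nat mulnC.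
by [].
Qed.

Lemma prob_client_winE (h b n : nat) (EH : {set {set 'I_h}}) (p : Rdefinitions.R) :
  prob_client_win b EH n p =
    expect p (all_edges n) (fun EG => (is_client_win b EH EG)%:R).
Proof.
rewrite /prob_client_win /expect big_mkcondr; apply: eq_bigr => EG _.
by rewrite !RpowE; case: (is_client_win _ _ _); rewrite ?mulr1 ?mulr0.
Qed.

(** With y = n^(1/e), both n and the threshold n^(-1/m_1), m_1 = e/(k-1), are integer powers of y,
    so real exponents are left behind. *)
Lemma Rpower_root (n k e : nat) : (0 < n)%N -> (0 < e)%N -> (1 < k)%N ->
  exists y : Rdefinitions.R, [/\ 1 <= y, n%:R = y ^+ e &
    Rpower (INR n) (Ropp (Rinv (e%:R / k.-1%:R : Rdefinitions.R))) = y ^- k.-1].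
Proof.
move=> n0 e0 k1; exists (Rpower (INR n) (Rinv (INR e))).
have n1 : Rle 1 (INR n) by apply/RleP; rewrite INRE ler1n.
have npos : Rlt 0 (INR n) by apply: Rlt_le_trans n1; apply: Rlt_0_1.
have y0 : Rlt 0 (Rpower (INR n) (Rinv (INR e))) by apply: exp_pos.
have eneq : (e%:R : Rdefinitions.R) != 0 by rewrite pnatr_eq0 -lt0n.
split.
- apply/RleP; rewrite -[X in Rle X _](Rpower_O (INR n)) //; apply: Rle_Rpower => //.
  by apply/RleP; rewrite RinvE INRE invr_ge0 ler0n.
- rewrite -RpowE -Rpower_pow // Rpower_mult RmultE RinvE !INRE mulVf // Rpower_1 //.
  by rewrite -INRE.
- rewrite Rpower_Ropp RinvE; congr (_^-1).
  rewrite -RpowE -Rpower_pow // Rpower_mult; congr (Rpower _ _).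
  by rewrite RmultE !RinvE !INRE invf_div mulrC.
Qed.

Section Limits.
Variables (h k b : nat) (EH : {set {set 'I_h}}) (EK : {set {set 'I_k}}) (phi : 'I_k -> 'I_h).
Hypotheses (k3 : (3 <= k)%N) (b0 : (0 < b)%N) (gp : good_pattern b EK) (phii : injective phi).
Hypothesis phiE : forall e, e \in EK -> phi @: e \in EH.
Hypothesis EH2 : forall e, e \in EH -> #|e| = 2.
Hypothesis m1E : m1_density EH = #|EK|%:R / k.-1%:R :> Rdefinitions.R.
Variable p : nat -> Rdefinitions.R.
Hypothesis p01 : forall n, 0 <= p n <= 1.

Let k0 : (0 < k)%N. Proof. exact: leq_trans k3. Qed.
Let k1 : (1 < k)%N. Proof. exact: leq_trans k3. Qed.

Let EK0 : EK != set0.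
Proof.
have /set0Pn[e /touchP[eE _]] := gp_star gp (Ordinal k0).
by apply/set0Pn; exists e.
Qed.

Let cEK0 : (0 < #|EK|)%N. Proof. by rewrite card_gt0. Qed.

Lemma client_loses_limit (N : nat) :
  (forall n, (N <= n)%N ->
     p n <= (4 * (k ^ 2)%:R)^-1 * Rpower (INR n) (Ropp (Rinv (m1_density EH)))) ->
  Un_cv (fun n => prob_client_win b EH n (p n)) R0.
Proof.
move=> lep eps /RltP eps0; pose K : Rdefinitions.R := (chain_const k (free_max EK))%:R.
have [N1 hN1] := root_unbounded #|EK| (ler0n _ _ : 0 <= K) eps0.
exists (maxn 1 (maxn N N1)) => n /ssrnat.leP; rewrite !geq_max => /and3P[n0 nN nN1].
have [y [y1 ny xy]] := Rpower_root n0 cEK0 k1.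
have := lep n nN; rewrite m1E xy => lepn.
have /andP[pn0 pn1] := p01 n.
have y0 : 0 < y by apply: lt_le_trans y1.
have yk : 0 < y ^+ k.-1 by rewrite exprn_gt0.
have k20 : 0 < (k ^ 2)%:R :> Rdefinitions.R by rewrite ltr0n expn_gt0 k0.
(* Here rho is the ratio of p to the threshold; c = 1/(4k^2) is just what gives k^2 * rho <= 1/4. *)
have le1 : expect (p n) (all_edges n) (fun EG => (is_client_win b EH EG)%:R) <= K / y.
  apply: (@client_win_prob_le _ h n k b EH EK phi (p n) (p n * y ^+ k.-1) y) => //.
  - by rewrite mulr_ge0 // ltW.
  - move: lepn; rewrite ler_pdivlMr // => le2.
    rewrite mulrC -ler_pdivlMr //; apply: le_trans le2 _.
    by rewrite invfM.
  - by rewrite mulfK // lt0r_neq0.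
rewrite prob_client_winE RdistE subr0 ger0_norm; last first.
  by apply: expect_ge0 => // S _; apply: ler0n.
by apply/RltP; apply: le_lt_trans le1 (hN1 n y nN1 y1 ny).
Qed.

(** Chosen to make the rate in [client_win_prob_ge] at least 2, where 8 = 2 * 4; the summand 1 keeps
    it at least 1, as [balanced_dens] requires. *)
Definition win_const : nat := 1 + 8 * h.+1 ^ h * (2 * b.+1) ^ (h * 2).

Lemma client_wins_limit (N : nat) :
  (forall n, (N <= n)%N ->
     win_const%:R * Rpower (INR n) (Ropp (Rinv (m1_density EH))) <= p n) ->
  Un_cv (fun n => prob_client_win b EH n (p n)) R1.
Proof.
move=> gep eps /RltP eps0.
pose N1 := Num.bound (eps^-1).
exists (maxn 1 (maxn N (maxn N1 (2 * b.+1 * h)))) => n /ssrnat.leP; rewrite !geq_max => /and4P[n0 nN nN1 nh].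
have [y [y1 ny xy]] := Rpower_root n0 cEK0 k1.
have := gep n nN; rewrite m1E xy => gepn.
have /andP[pn0 pn1] := p01 n.
have y0 : 0 < y by apply: lt_le_trans y1.
have c1 : 1 <= win_const%:R :> Rdefinitions.R by rewrite ler1n.
have c0 : 0 < win_const%:R :> Rdefinitions.R by apply: lt_le_trans c1.
have ppos : 0 < p n.
  by apply: lt_le_trans gepn; rewrite mulr_gt0 // invr_gt0 exprn_gt0.
have EH0 : EH != set0.
  by have /set0Pn[e eE] := EK0; apply/set0Pn; exists (phi @: e); apply: phiE.
have dens := balanced_dens y1 ny c1 gepn (density_balanced EH2 k1 m1E).
have exp_ge (x : Rdefinitions.R) : 1 + x <= exp x by apply/RleP; apply: exp_ineq1_le.
have ge1 := client_win_prob_ge exp_0 exp_plus exp_ge EH2 n0 nh ppos pn1 c0 EH0 dens.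
set kappa := _ ^- h ^+ 2 * _ / _ in ge1.
have kap : 2 <= kappa.
  have h0 : 0 < (h.+1)%:R ^+ h :> Rdefinitions.R by rewrite exprn_gt0 ?ltr0n.
  have z0 : 0 < (2 * b.+1)%:R ^+ h :> Rdefinitions.R by rewrite exprn_gt0 ?ltr0n.
  rewrite /kappa ler_pdivlMr; last by rewrite mulr_gt0.
  rewrite exprVn [leRHS]mulrC ler_pdivlMr; last by rewrite exprn_gt0.
  rewrite /win_const natrD !natrM !natrX exprM -natrM.
  move: ((h.+1)%:R ^+ h) ((2 * b.+1)%:R ^+ h) h0 z0 => u v u0 v0.
  have -> : 2 * (4 * u) * v ^+ 2 = 8 * u * v ^+ 2 by ring.
  by rewrite lerDr.
have lt2 : 2 ^+ n * exp (- (kappa * n%:R)) < eps.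
  apply: le_lt_trans (exp_beats_subsets exp_0 exp_plus exp_ge kap n0) _.
  rewrite invf_plt ?posrE ?ltr0n //.
  have := archi_boundP (ltW (_ : 0 < eps^-1)); rewrite invr_gt0 => /(_ eps0) lt3.
  by apply: lt_le_trans lt3 _; rewrite ler_nat.
rewrite prob_client_winE RdistE; apply/RltP.
set P := expect _ _ _ in ge1 *.
have leP : P <= 1.
  rewrite -[leRHS](expect_cst (p n) (all_edges n)); apply: expect_le => // S _.
  by rewrite lern1 leq_b1.
rewrite ler0_norm ?subr_le0 // opprB.
by apply: le_lt_trans lt2; rewrite lerBlDr addrC -lerBlDr.
Qed.
End Limits.

Local Close Scope ring_scope.

Theorem theorem9 (k b h : nat) (EH : {set {set 'I_h}}) :
  0 < k -> 0 < b ->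
  (4 <= k \/ (k = 3 /\ 2 <= b)) ->
  is_graph EH ->
  (exists (W : {set 'I_h}) (F : {set {set 'I_h}}),
      is_subgraph EH W F /\ 2 <= #|W| /\ d1_density W F = m1_density EH /\
      (is_clique k W F \/ is_cycle k W F)) ->
  exists c C : R, Rlt R0 c /\ Rlt R0 C /\
    (forall p : nat -> R, (forall n, Rle R0 (p n) /\ Rle (p n) R1) ->
       (exists N, forall n, N <= n ->
          Rle (Rmult C (Rpower (INR n) (Ropp (Rinv (m1_density EH))))) (p n)) ->
       Un_cv (fun n => prob_client_win b EH n (p n)) R1) /\
    (forall p : nat -> R, (forall n, Rle R0 (p n) /\ Rle (p n) R1) ->
       (exists N, forall n, N <= n ->
          Rle (p n) (Rmult c (Rpower (INR n) (Ropp (Rinv (m1_density EH)))))) ->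
       Un_cv (fun n => prob_client_win b EH n (p n)) R0).
Proof.
move=> _ b0 kb /forall_inP EHg [W [F [sub [W2 [dE cc]]]]].
have k3 : 3 <= k by case: kb => [/ltnW|[->]].
have [EK [phi [gp phii phiE [cW cF]]]] := pattern_of_subgraph b0 kb sub cc.
have EH2 e : e \in EH -> #|e| = 2 by move=> /EHg/eqP.
have m1E : m1_density EH = (#|EK|%:R / k.-1%:R)%R :> Rdefinitions.R.
  rewrite -dE /d1_density RdivE RminusE !INRE cW cF; congr (_ / _)%R.
  by rewrite -[in LHS](prednK (leq_trans _ k3)) // -natr1 addrK.
exists (4 * (k ^ 2)%:R)^-1%R, (win_const h b)%:R%R; split; last split; last split.
- apply/RltP; rewrite invr_gt0 mulr_gt0 // ltr0n expn_gt0 (leq_trans _ k3) //.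
- by apply/RltP; rewrite ltr0n.
- move=> p p01 [N hN]; have p01' n : (0 <= p n <= 1)%R by have [/RleP-> /RleP->] := p01 n.
  by apply: (client_wins_limit k3 gp phiE EH2 m1E p01' (N := N)) => n nN; apply/RleP/hN.
- move=> p p01 [N hN]; have p01' n : (0 <= p n <= 1)%R by have [/RleP-> /RleP->] := p01 n.
  by apply: (client_loses_limit k3 b0 gp phii phiE m1E p01' (N := N)) => n nN; apply/RleP/hN.
Qed.
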